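(* Let $\mathbb{K}$ be a field of characteristic $0$ and let $s_\bullet$ be a gauge. If $\mathfrak g$ is a nilpotent $L_\infty$-algebra over $\mathbb K$, then the inclusion of simplicial sets $\gamma_\bullet(\mathfrak g)\hookrightarrow\mathrm{MC}_\bullet(\mathfrak g)$ is a homotopy equivalence; in other words, it induces $\pi_0(\gamma_\bullet(\mathfrak g))\cong\pi_0(\mathrm{MC}_\bullet(\mathfrak g))$ and, for every $0$-simplex $\alpha_0\in\mathrm{MC}_0(\mathfrak g)=\mathrm{MC}(\mathfrak g)$ and every $i>0$, $\pi_i(\gamma_\bullet(\mathfrak g),\alpha_0)\cong\pi_i(\mathrm{MC}_\bullet(\mathfrak g),\alpha_0)$.
   Context: $L_\infty$-algebras. An $L_\infty$-algebra is a graded $\mathbb{K}$-vector space $\mathfrak{g}$ with multilinear operations $[x_1,\dots,x_k]$, $k\ge1$, of degree $2-k$, graded antisymmetric, i.e. $[x_1,\dots,x_i,x_{i+1},\dots,x_k]+(-1)^{|x_i||x_{i+1}|}[x_1,\dots,x_{i+1},x_i,\dots,x_k]=0$, such that for each $n\ge1$ $$\sum_{k=1}^n(-1)^k\sum(-1)^{\varepsilon}[[x_{i_1},\dots,x_{i_k}],x_{j_1},\dots,x_{j_{n-k}}]=0,$$ the inner sum being over $i_1<\dots<i_k$, $j_1<\dots<j_{n-k}$ with $\{i_1,\dots,i_k\}\cup\{j_1,\dots,j_{n-k}\}=\{1,\dots,n\}$, and $(-1)^\varepsilon$ being the product of the sign of the permutation $(1,\dots,n)\mapsto(i_1,\dots,i_k,j_1,\dots,j_{n-k})$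 with the Koszul sign of its action on $(x_1,\dots,x_n)$. Write $\delta x=[x]$. Put $F^1\mathfrak g=\mathfrak g$ and, for $i>1$, $F^i\mathfrak g=\sum_{k\ge2}\sum_{i_1+\dots+i_k=i}[F^{i_1}\mathfrak g,\dots,F^{i_k}\mathfrak g]$; $\mathfrak g$ is nilpotent if $F^i\mathfrak g=0$ for all sufficiently large $i$. For nilpotent $\mathfrak g$, $\mathrm{MC}(\mathfrak g)$ is the set of $\alpha\in\mathfrak g^1$ with $\delta\alpha+\sum_{\ell\ge2}\frac1{\ell!}[\alpha,\dots,\alpha]=0$ ($\ell$ entries $\alpha$). Forms. $\Omega_n=\mathbb K[t_0,\dots,t_n,dt_0,\dots,dt_n]/(t_0+\dots+t_n-1,\,dt_0+\dots+dt_n)$ is the differential graded (dg) commutative algebra of polynomial forms on the $n$-simplex ($|t_i|=0$, $|dt_i|=1$); these form a simplicial dg algebra $\Omega_\bullet$, where $f:[k]\to[n]$ acts by $f^*t_i=\sum_{f(j)=i}t_j$. For an $L_\infty$-algebra $\mathfrak g$, $\mathfrak g\otimes\Omega_n$ is an $L_\infty$-algebra with $[x\otimes a]=[x]\otimes a+(-1)^{|x|}x\otimes da$ and, for $k\ge2$, $[x_1\otimes a_1,\dots,x_k\otimes a_k]=(-1)^{\sum_{i<j}|a_i||x_j|}[x_1,\dots,x_k]\otimes a_1\cdots a_k$. Set $\mathrm{MC}_\bullet(\mathfrak g)=\mathrm{MC}(\mathfrak g\otimes\Omega_\bullet)$, a simplicial set (in fact a Kan complex). Gauges. For $i_0,\dots,i_k\in\{0,\dots,n\}$,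 $I_{i_0\dots i_k}:\Omega_n\to\mathbb K$ is integration over the $k$-chain spanned by the vertices $(e_{i_0},\dots,e_{i_k})$: pull back to $\Omega_k$ along the affine map sending the $p$-th vertex to $e_{i_p}$, then apply $t_1^{a_1}\cdots t_k^{a_k}dt_1\cdots dt_k\mapsto a_1!\cdots a_k!/(a_1+\dots+a_k+k)!$ (zero on forms of degree $\ne k$). Put $\omega_{i_0\dots i_k}=k!\sum_{j=0}^k(-1)^jt_{i_j}dt_{i_0}\cdots\widehat{dt_{i_j}}\cdots dt_{i_k}$ and $P_n\omega=\sum_{k=0}^n\sum_{i_0<\dots<i_k}\omega_{i_0\dots i_k}I_{i_0\dots i_k}(\omega)$. A contraction is a family of $\mathbb K$-linear maps $s_n:\Omega_n^*\to\Omega_n^{*-1}$, compatible with all simplicial operators, with $\mathrm{id}-P_n=ds_n+s_nd$. A gauge is a contraction with $s_n^2=0$ for all $n$. The maps $s_n$ are extended to $\mathfrak g\otimes\Omega_n$ by acting on the second factor. Definition of $\gamma_\bullet$. $\gamma_n(\mathfrak g)=\{\alpha\in\mathrm{MC}_n(\mathfrak g)\mid s_n\alpha=0\}$, a simplicial subset of $\mathrm{MC}_\bullet(\mathfrak g)$ (in fact a Kan complex) with the same $0$-simplices. *)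

(* Defs.v *)
From Stdlib Require Import Relation_Operators.
From HB Require Import structures.
From mathcomp Require Import all_boot all_order all_algebra.
From mathcomp Require Import finmap.
From mathcomp.multinomials Require Import monalg.

Set Implicit Arguments.
Unset Strict Implicit.
Unset Printing Implicit Defensive.

Import GRing.Theory.
Local Open Scope ring_scope.

Arguments ucm {I} i.

(* A Z-graded space is given by its total space, the direct sum of its
   homogeneous parts, with the projections [gcomp i] onto the parts. *)
Record graded (K : fieldType) := Graded {
  gspace :> lmodType K;
  gcomp : int -> {linear gspace -> gspace};
  gcomp_comp : forall (i j : int) (x : gspace),
    gcomp i (gcomp j x) = if i == j then gcomp j x else 0;
  gcomp_fin : forall x : gspace,
    exists r : seq int, uniq r && (x == \sum_(i <- r) gcomp i x)
}.

Definition homog (K : fieldType) (V : graded K) (i : int) (x : V) : bool :=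
  gcomp V i x == x.

(* A finite list of degrees containing those in which [x] has a nonzero
   component. *)
Definition gdegs (K : fieldType) (V : graded K) (x : V) : seq int :=
  xchoose (gcomp_fin x).

Section LInfinity.

Variable K : fieldType.

Definition ksign (z : int) : K := (-1) ^ z.

(* The permutation (1, ..., n) |-> (i_1, ..., i_k, j_1, ..., j_{n-k}) inverts
   exactly the pairs j < i with i in I and j outside I; each of them contributes
   -1 to its sign and (-1)^(d i * d j) to the Koszul sign. *)
Definition unshuffle_sign n (d : 'I_n -> int) (I : {set 'I_n}) : K :=
  \prod_(i in I) \prod_(j in ~: I | (j < i)%N) (- ksign (d i * d j)).

(* [brk [:: x_1; ...; x_k]] is [x_1, ..., x_k]; the value [brk [::]] is not
   constrained, and it is never used. *)
Record is_Linfty (V : graded K) (brk : seq V -> V) : Prop := {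
  brk_linear : forall (a : K) (r1 r2 : seq V) (x y : V),
    brk (r1 ++ (a *: x + y) :: r2) =
    a *: brk (r1 ++ x :: r2) + brk (r1 ++ y :: r2);
  brk_degree : forall (ds : seq int) (xs : seq V), xs != [::] ->
    all2 (fun d x => homog d x) ds xs ->
    homog (\sum_(d <- ds) d + 2 - (size xs)%:Z) (brk xs);
  brk_antisym : forall (r1 r2 : seq V) (p q : int) (x y : V),
    homog p x -> homog q y ->
    brk (r1 ++ x :: y :: r2) + ksign (p * q) *: brk (r1 ++ y :: x :: r2) = 0;
  brk_jacobi : forall n (d : 'I_n -> int) (x : 'I_n -> V), (0 < n)%N ->
    (forall i, homog (d i) (x i)) ->
    \sum_(1 <= k < n.+1) (-1) ^+ k *:
      (\sum_(I : {set 'I_n} | #|I| == k) unshuffle_sign d I *: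
         brk (brk [seq x i | i <- enum I] :: [seq x j | j <- enum (~: I)])) = 0
}.

Record Linfty := MkLinfty {
  lspace :> graded K;
  brk : seq lspace -> lspace;
  brkP : is_Linfty brk
}.

(* [lcs g i] is F^i g, for i >= 1. *)
Inductive lcs (g : Linfty) : nat -> g -> Prop :=
| lcs_1 x : lcs 1 x
| lcs_brk (i : seq nat) (x : seq g) :
    (2 <= size x)%N -> size i = size x ->
    (forall p, (p < size x)%N -> (1 <= nth 0%N i p)%N) ->
    (forall p, (p < size x)%N -> lcs (nth 0%N i p) (nth 0 x p)) ->
    lcs (sumn i) (brk x)
| lcs_0 i : lcs i 0
| lcs_lin i (a : K) x y : lcs i x -> lcs i y -> lcs i (a *: x + y).

Definition nilpotent (g : Linfty) : Prop :=
  exists N, forall i, (N <= i)%N -> forall x : g, lcs i x -> x = 0.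

(* The Maurer-Cartan equation.  The sum over l is finite in the nilpotent case;
   its value is the one at which its partial sums stabilize. *)
Definition is_MC (V : graded K) (b : seq V -> V) (a : V) : Prop :=
  homog 1 a /\
  exists N, forall M, (N <= M)%N ->
    \sum_(1 <= l < M.+1) (l`!%:R)^-1 *: b (nseq l a) = 0.

End LInfinity.

Lemma sum_malgU (G : zmodType) (T : choiceType) (D : {fset T}) (h : T -> G) (c : T) :
  (\sum_(k <- D) << h k *g k >>)@_c = if c \in D then h c else 0.
Proof.
rewrite raddf_sum /=; case: ifP => cD.
  rewrite (big_fsetD1 c cD) /= mcoeffUU big_seq_cond big1 ?addr0 // => k.
  by rewrite in_fsetD1 andbT mcoeffU => /andP[/negbTE ->].
rewrite big_seq_cond big1 // => k; rewrite andbT mcoeffU => kD.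
by case: eqP kD cD => // -> ->.
Qed.

(* [(m, S) : cell n] stands for the form t_1^(m 1) ... t_n^(m n) dt_S, where
   dt_S is the product of the dt_i, for i in S, in increasing order.  The indices
   1, ..., n are represented by 'I_n.  The relations t_0 + ... + t_n = 1 and
   dt_0 + ... + dt_n = 0 eliminate t_0 and dt_0, so that the cells are a basis of
   Omega_n; see [coord_sum] and [dcoord_sum]. *)
Definition cell n := ('X_{1..n} * {set 'I_n})%type.

Definition cdeg n (c : cell n) : nat := #|c.2|.

Section Forms.

Variables (K : fieldType) (V : lmodType K).

(* V (x) Omega_n, as the space of finite formal sums of x (x) c, with x in V and
   c a cell; see [tens] for the pure tensors, and [tens_universal]. *)
Definition gform n := {malg V[cell n]}.

HB.instance Definition _ n := GRing.Zmodule.on (gform n).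

Definition gform_scale n (a : K) (u : gform n) : gform n :=
  [malg c in msupp u => a *: u@_c].

Lemma gform_scaleE n a (u : gform n) c : (gform_scale a u)@_c = a *: u@_c.
Proof.
by rewrite mcoeffE; case: ifP => // /negbT /mcoeff_outdom ->; rewrite scaler0.
Qed.

Lemma gform_scaleA n a b (u : gform n) :
  gform_scale a (gform_scale b u) = gform_scale (a * b) u.
Proof. by apply/malgP => c; rewrite !gform_scaleE scalerA. Qed.

Lemma gform_scale1 n (u : gform n) : gform_scale 1 u = u.
Proof. by apply/malgP => c; rewrite gform_scaleE scale1r. Qed.

Lemma gform_scaleDr n a (u v : gform n) :
  gform_scale a (u + v) = gform_scale a u + gform_scale a v.
Proof. by apply/malgP => c; rewrite !(gform_scaleE, mcoeffD) scalerDr. Qed.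

Lemma gform_scaleDl n (u : gform n) a b :
  gform_scale (a + b) u = gform_scale a u + gform_scale b u.
Proof. by apply/malgP => c; rewrite !(gform_scaleE, mcoeffD) scalerDl. Qed.

HB.instance Definition _ n := GRing.Zmodule_isLmodule.Build K (gform n)
  (@gform_scaleA n) (@gform_scale1 n) (@gform_scaleDr n) (@gform_scaleDl n).

Lemma gcoeffZ n a (u : gform n) c : (a *: u)@_c = a *: u@_c.
Proof. exact: gform_scaleE. Qed.

End Forms.

Definition Omega (K : fieldType) n := gform K^o n.

Section Operations.

Variable K : fieldType.
Implicit Type V : lmodType K.

Local Notation Omega := (Omega K).

Definition mono n (c : cell n) : Omega n := << (1 : K^o) *g c >>.

Definition tens V n (x : V) (a : Omega n) : gform V n :=
  \sum_(c <- msupp a) << (a@_c : K) *: x *g c >>.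

(* For a linear map L : Omega_m -> Omega_n given on the basis of cells, this is
   id (x) L : V (x) Omega_m -> V (x) Omega_n.  In particular, for V = K this is L. *)
Definition linext V m n (L : cell m -> Omega n) (u : gform V m) : gform V n :=
  \sum_(c <- msupp u) tens u@_c (L c).

(* (m, S) (m', S') is zero if S meets S', and otherwise reordering dt_S dt_S'
   exchanges the pairs (i, j) of S * S' with j < i. *)
Definition cmul n (c c' : cell n) : Omega n :=
  if [disjoint c.2 & c'.2] then
    (-1) ^+ #|[set p : 'I_n * 'I_n | [&& p.1 \in c.2, p.2 \in c'.2 & (p.2 < p.1)%N]]|
      *: mono (mulcm c.1 c'.1, c.2 :|: c'.2)
  else 0.

Definition omul n (a b : Omega n) : Omega n :=
  \sum_(c <- msupp a) \sum_(c' <- msupp b) (a@_c * b@_c' : K) *: cmul c c'.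

Definition oone n : Omega n := mono (onecm _, set0).

Definition oexp n (a : Omega n) (k : nat) : Omega n := iter k (omul a) (oone n).

Definition coord n (i : 'I_n.+1) : Omega n :=
  if unlift ord0 i is Some j then mono (ucm j, set0)
  else oone n - \sum_(j < n) mono (ucm j, set0).

Definition dcoord n (i : 'I_n.+1) : Omega n :=
  if unlift ord0 i is Some j then mono (onecm _, [set j])
  else - \sum_(j < n) mono (onecm _, [set j]).

Lemma coord_sum n : \sum_(i < n.+1) coord i = oone n.
Proof.
rewrite big_ord_recl {1}/coord unlift_none.
rewrite [X in _ + X](eq_bigr (fun j => mono (ucm j, set0))) ?subrK // => j _.
by rewrite /coord liftK.
Qed.

Lemma dcoord_sum n : \sum_(i < n.+1) dcoord i = 0.
Proof.
rewrite big_ord_recl {1}/dcoord unlift_none.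
rewrite [X in _ + X](eq_bigr (fun j => mono (onecm _, [set j]))) ?addNr // => j _.
by rewrite /dcoord liftK.
Qed.

(* d (t^m dt_S) = \sum_i m_i t^(m - e_i) dt_i dt_S *)
Definition dcell n (c : cell n) : Omega n :=
  \sum_(i < n) ((c.1 i)%:R : K) *: cmul (divcm c.1 (ucm i), [set i]) (onecm _, c.2).

Definition dform n : Omega n -> Omega n := linext (@dcell n).

(* f^* t_i and f^* dt_i.  Simplicial operators are given by nondecreasing f, and
   affine maps of simplices sending vertices to vertices by arbitrary f. *)
Definition pull_coord k n (f : 'I_k.+1 -> 'I_n.+1) (i : 'I_n.+1) : Omega k :=
  \sum_(j < k.+1 | f j == i) coord j.

Definition pull_dcoord k n (f : 'I_k.+1 -> 'I_n.+1) (i : 'I_n.+1) : Omega k :=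
  \sum_(j < k.+1 | f j == i) dcoord j.

Definition pull_cell k n (f : 'I_k.+1 -> 'I_n.+1) (c : cell n) : Omega k :=
  omul (\big[@omul k/oone k]_(i < n) oexp (pull_coord f (lift ord0 i)) (c.1 i))
       (\big[@omul k/oone k]_(i in c.2) pull_dcoord f (lift ord0 i)).

Definition pull V k n (f : 'I_k.+1 -> 'I_n.+1) : gform V n -> gform V k :=
  linext (pull_cell f).

Definition is_kform n (k : nat) (a : Omega n) : Prop :=
  forall c, c \in msupp a -> cdeg c = k.

Definition integral k (a : Omega k) : K :=
  \sum_(c <- msupp a | c.2 == [set: 'I_k])
     (a@_c : K) * ((\prod_(i < k) (c.1 i)`!)%N%:R / ((\sum_(i < k) c.1 i) + k)`!%:R).

Definition Iint k n (f : 'I_k.+1 -> 'I_n.+1) (a : Omega n) : K :=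
  integral (pull f a).

Definition whitney k n (f : 'I_k.+1 -> 'I_n.+1) : Omega n :=
  (k`!%:R : K) *: \sum_(j < k.+1) ((-1) ^+ j : K) *:
    omul (coord (f j)) (\big[@omul n/oone n]_(p < k.+1 | p != j) dcoord (f p)).

Definition increasing k n (f : 'I_k.+1 -> 'I_n.+1) : bool :=
  [forall p : 'I_k.+1, forall q : 'I_k.+1, (p < q)%N ==> (f p < f q)%N].

Definition Pform n (a : Omega n) : Omega n :=
  \sum_(k < n.+1) \sum_(f : {ffun 'I_k.+1 -> 'I_n.+1} | increasing f)
     Iint f a *: whitney f.

Definition nondecreasing k n (f : 'I_k.+1 -> 'I_n.+1) : Prop :=
  forall p q : 'I_k.+1, (p <= q)%N -> (f p <= f q)%N.

Record is_contraction (s : forall n, {linear Omega n -> Omega n}) : Prop := {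
  contraction_deg0 : forall n (a : Omega n), is_kform 0 a -> s n a = 0;
  contraction_deg : forall n k (a : Omega n), is_kform k.+1 a -> is_kform k (s n a);
  contraction_simplicial : forall k n (f : 'I_k.+1 -> 'I_n.+1), nondecreasing f ->
    forall a : Omega n, s k (pull f a) = pull f (s n a);
  contraction_homotopy : forall n (a : Omega n),
    a - Pform a = dform (s n a) + s n (dform a)
}.

Definition is_gauge (s : forall n, {linear Omega n -> Omega n}) : Prop :=
  is_contraction s /\ forall n (a : Omega n), s n (s n a) = 0.

Lemma tens_coeff V n (x : V) (a : Omega n) c : (tens x a)@_c = (a@_c : K) *: x.
Proof.
rewrite /tens sum_malgU; case: ifP => // /negbT ca.
by rewrite (mcoeff_outdom ca) scale0r.
Qed.

Lemma tens_mono V n (x : V) (c : cell n) : tens x (mono c) = << x *g c >>.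
Proof.
apply/malgP => c'; rewrite tens_coeff !mcoeffU.
by case: eqP => _; rewrite ?mulr1n ?mulr0n ?scale1r ?scale0r.
Qed.

Lemma tens_universal V n (W : lmodType K) (b : V -> Omega n -> W) :
  (forall (a : K) x y w, b (a *: x + y) w = a *: b x w + b y w) ->
  (forall x (a : K) v w, b x (a *: v + w) = a *: b x v + b x w) ->
  exists2 F : {linear gform V n -> W}, forall x w, F (tens x w) = b x w &
    forall G : {linear gform V n -> W},
      (forall x w, G (tens x w) = b x w) -> forall u, G u = F u.
Proof.
move=> bl br.
have b0l w : b 0 w = 0 by have := bl (-1) 0 0 w; rewrite scaler0 addr0 scaleN1r addNr.
have b0r x : b x 0 = 0 by have := br x (-1) 0 0; rewrite scaler0 addr0 scaleN1r addNr.
pose F (u : gform V n) : W := \sum_(c <- msupp u) b u@_c (mono c).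
have FE (D : {fset cell n}) (u : gform V n) :
    (msupp u `<=` D)%fset -> F u = \sum_(c <- D) b u@_c (mono c).
  move=> uD; apply: big_fset_incl => // c _ cu.
  by rewrite (mcoeff_outdom cu) b0l.
have Flin : linear F.
  move=> a u v; set D := (msupp u `|` msupp v `|` msupp (a *: u + v))%fset.
  have uD : (msupp u `<=` D)%fset by rewrite /D -fsetUA fsubsetUl.
  have vD : (msupp v `<=` D)%fset by rewrite /D (fsetUC (msupp u)) -fsetUA fsubsetUl.
  have wD : (msupp (a *: u + v) `<=` D)%fset by rewrite /D fsubsetUr.
  rewrite (FE D u uD) (FE D v vD) (FE D _ wD) scaler_sumr -big_split /=.
  by apply: eq_bigr => c _; rewrite mcoeffD gcoeffZ bl.
have bsum x (r : seq (cell n)) (h : cell n -> K) :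
    b x (\sum_(c <- r) h c *: mono c) = \sum_(c <- r) h c *: b x (mono c).
  elim: r => [|c r IH]; first by rewrite !big_nil b0r.
  by rewrite !big_cons br IH.
have monoE (c : cell n) (k : K) : << (k : K^o) *g c >> = k *: mono c :> Omega n.
  apply/malgP => c'; rewrite [RHS]gcoeffZ [LHS]mcoeffU /mono [X in _ *: X]mcoeffU.
  by case: (c == c'); rewrite ?mulr0n ?scaler0 // !mulr1n; exact/esym/mulr1.
have wE (w : Omega n) : w = \sum_(c <- msupp w) (w@_c : K) *: mono c.
  by rewrite [LHS]monalgE; apply: eq_bigr => c _; exact: monoE.
pose FL := GRing.isLinear.Build K (gform V n) W *:%R F Flin.
pose G0 : {linear gform V n -> W} := HB.pack F FL.
exists G0 => [x w|G GE u].
  have -> : G0 (tens x w) = F (tens x w) by [].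
  have xD : (msupp (tens x w) `<=` msupp w)%fset.
    apply/fsubsetP => c; rewrite -!mcoeff_neq0 tens_coeff.
    by apply: contra_neq => ->; rewrite scale0r.
  rewrite (FE _ _ xD) [in RHS](wE w) bsum; apply: eq_bigr => c _.
  by rewrite tens_coeff; have := bl w@_c x 0 (mono c); rewrite addr0 b0l addr0.
rewrite [u in LHS]monalgE raddf_sum; apply: eq_bigr => c _.
by rewrite -GE tens_mono.
Qed.

End Operations.

Section Tensor.

Variable K : fieldType.

Lemma gcomp_outdegs (V : graded K) (x : V) i : i \notin gdegs x -> gcomp V i x = 0.
Proof.
move=> ix; have /andP[_ /eqP {1}->] := xchooseP (gcomp_fin x).
rewrite raddf_sum big_seq big1 //= => j jx; rewrite gcomp_comp.
by case: eqP => // ij; move: ix; rewrite ij jx.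
Qed.

Lemma gcomp_sum (V : graded K) (x : V) (r : seq int) :
  uniq r -> {subset gdegs x <= r} -> \sum_(i <- r) gcomp V i x = x.
Proof.
move=> ur xr; have /andP[ux /eqP {2}->] := xchooseP (gcomp_fin x).
rewrite -/(gdegs x) (bigID [in gdegs x]) /= [X in _ + X]big1 ?addr0; last first.
  by move=> i /gcomp_outdegs.
rewrite -big_filter; apply: perm_big; apply: uniq_perm => //; first exact: filter_uniq.
by move=> i; rewrite mem_filter; case: (boolP (i \in gdegs x)) => //= /xr ->.
Qed.

Variables (V : graded K) (n : nat).

Definition tcomp (i : int) (u : gform V n) : gform V n :=
  [malg c in msupp u => gcomp V (i - (cdeg c)%:Z) u@_c].

Lemma tcompE i u c : (tcomp i u)@_c = gcomp V (i - (cdeg c)%:Z) u@_c.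
Proof.
by rewrite mcoeffE; case: ifP => // /negbT /mcoeff_outdom ->; rewrite raddf0.
Qed.

Lemma tcomp_linear i : linear (tcomp i).
Proof.
by move=> a u v; apply/malgP => c; rewrite !(tcompE, mcoeffD, gcoeffZ) linearP.
Qed.

HB.instance Definition _ i :=
  GRing.isLinear.Build K (gform V n) (gform V n) *:%R (tcomp i) (tcomp_linear i).

Lemma tcomp_comp (i j : int) (u : gform V n) :
  tcomp i (tcomp j u) = if i == j then tcomp j u else 0.
Proof.
apply/malgP => c; rewrite !tcompE gcomp_comp (inj_eq (addIr _)).
by case: eqP; rewrite ?tcompE ?mcoeff0.
Qed.

Lemma tcomp_fin (u : gform V n) :
  exists r : seq int, uniq r && (u == \sum_(i <- r) tcomp i u).
Proof.
pose r := undup (flatten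
  [seq [seq d + (cdeg c)%:Z | d <- gdegs u@_c] | c <- enum_fset (msupp u)]).
exists r; rewrite undup_uniq; apply/eqP/malgP => c; rewrite raddf_sum /=.
have [cu|cu] := boolP (c \in msupp u); last first.
  by rewrite (mcoeff_outdom cu) big1 // => i _; rewrite tcompE (mcoeff_outdom cu) raddf0.
rewrite -[LHS](@gcomp_sum _ _ [seq i - (cdeg c)%:Z | i <- r]).
- by rewrite big_map; apply: eq_bigr => i _; rewrite tcompE.
- by rewrite map_inj_uniq ?undup_uniq //; exact: addIr.
move=> d du; apply/mapP; exists (d + (cdeg c)%:Z); last by rewrite addrK.
by rewrite mem_undup; apply/flatten_mapP; exists c => //; apply: map_f.
Qed.

Definition tgraded : graded K :=
  @Graded K (gform V n) (fun i => tcomp i) tcomp_comp tcomp_fin.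

End Tensor.

Section TensorBracket.

Variables (K : fieldType) (g : Linfty K) (n : nat).

(* u is the sum of the x (x) c, for (|x|, x, c) in this list. *)
Definition terms (u : gform g n) : seq (int * g * cell n) :=
  [seq (d, gcomp g d u@_c, c) | c <- enum_fset (msupp u), d <- gdegs u@_c].

Definition choices (T : Type) (rs : seq (seq T)) : seq (seq T) :=
  foldr (fun r ps => [seq p :: q | p <- r, q <- ps]) [:: [::]] rs.

Definition exchange_sign (p : seq (int * g * cell n)) : K :=
  ksign K (\sum_(j < size p) \sum_(i < size p | (i < j)%N)
             [seq (cdeg q.2)%:Z | q <- p]`_i * [seq q.1.1 | q <- p]`_j).

(* The brackets of g (x) Omega_n: the given formulas for homogeneous x (x) c,
   extended by multilinearity. *)
Definition tbrk (us : seq (gform g n)) : gform g n :=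
  if us is [:: u] then
    \sum_(p <- terms u)
      (tens (brk [:: p.1.2]) (mono K p.2)
       + ksign K p.1.1 *: tens p.1.2 (dcell K p.2))
  else
    \sum_(p <- choices (map terms us))
      exchange_sign p *: tens (brk [seq q.1.2 | q <- p])
        (\big[@omul K n/oone K n]_(q <- p) mono K q.2).

Definition MC_simplex (u : gform g n) : Prop := @is_MC K (tgraded g n) tbrk u.

Definition gamma_simplex (s : {linear Omega K n -> Omega K n}) (u : gform g n) : Prop :=
  MC_simplex u /\ linext (fun c => s (mono K c)) u = 0.

End TensorBracket.

Section Homotopy.

(* [U] is an ambient simplicial set, with operators f^* given by [act]; simplicial
   subsets of it are families of predicates. *)
Variables (U : nat -> Type)
  (act : forall k n, ('I_k.+1 -> 'I_n.+1) -> U n -> U k).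

Definition face n (j : 'I_n.+2) (x : U n.+1) : U n := act (lift j) x.

Definition degenerate n (x0 : U 0) : U n := act (fun _ : 'I_n.+1 => ord0) x0.

Variable X : forall n, U n -> Prop.

Definition edge (x y : U 0) : Prop :=
  exists e : U 1, [/\ X e, face ord_max e = x & face ord0 e = y].

(* Representatives of the elements of pi_{n+1}(X, x0). *)
Definition sphere (x0 : U 0) n (x : U n.+1) : Prop :=
  X x /\ forall j, face j x = degenerate n x0.

(* An (n+2)-simplex with faces x0, ..., x0, x, y, z. *)
Definition bounds (x0 : U 0) n (x y z : U n.+1) : Prop :=
  exists w : U n.+2, X w /\ forall j : 'I_n.+3,
    face j w = if j == n :> nat then x
               else if j == n.+1 :> nat then y
               else if j == n.+2 :> nat then z
               else degenerate n.+1 x0.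

Definition homotopic (x0 : U 0) n (x y : U n.+1) : Prop :=
  [/\ sphere x0 x, sphere x0 y & bounds x0 (degenerate n.+1 x0) x y].

(* pi_0(X) and pi_{n+1}(X, x0) are the quotients of the vertices and of the
   spheres by the equivalence relations generated by [edge] and [homotopic]. *)
Definition pi0_eq : U 0 -> U 0 -> Prop := clos_refl_sym_trans (U 0) edge.

Definition pi_eq (x0 : U 0) n : U n.+1 -> U n.+1 -> Prop :=
  clos_refl_sym_trans (U n.+1) (@homotopic x0 n).

(* [x][y] = [z] in pi_{n+1}(X, x0). *)
Definition pi_mul (x0 : U 0) n (x y z : U n.+1) : Prop :=
  exists x' y' z', [/\ pi_eq x0 x x', pi_eq x0 y y', pi_eq x0 z z',
    (sphere x0 x' /\ sphere x0 y' /\ sphere x0 z') & bounds x0 x' z' y'].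

End Homotopy.

(* The bijection is A / R -> B / Q, for A included in B. *)
Definition induces_bijection (T : Type) (A B : T -> Prop) (R Q : T -> T -> Prop) : Prop :=
  [/\ forall x, A x -> B x,
      forall x y, A x -> A y -> (R x y <-> Q x y) &
      forall y, B y -> exists2 x, A x & Q x y].

Section Equivalence.

Variables (U : nat -> Type)
  (act : forall k n, ('I_k.+1 -> 'I_n.+1) -> U n -> U k)
  (X Y : forall n, U n -> Prop).

Definition pi0_iso : Prop :=
  induces_bijection (@X 0) (@Y 0) (pi0_eq act X) (pi0_eq act Y).

(* For Kan complexes [pi_mul] is the group law on classes, and this says that
   the map pi_{n+1}(X, x0) -> pi_{n+1}(Y, x0) is a bijective homomorphism. *)
Definition pi_iso (x0 : U 0) (n : nat) : Prop :=
  induces_bijection (@sphere U act X x0 n) (@sphere U act Y x0 n)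
    (@pi_eq U act X x0 n) (@pi_eq U act Y x0 n) /\
  forall x y z : U n.+1,
    sphere act X x0 x -> sphere act X x0 y -> sphere act X x0 z ->
    pi_mul act X x0 x y z -> pi_mul act Y x0 x y z.

Definition homotopy_equivalence : Prop :=
  [/\ forall n x, @X n x -> @Y n x,
      pi0_iso &
      forall x0, @Y 0 x0 -> @X 0 x0 /\ forall n, pi_iso x0 n].

End Equivalence.

(* Main.v *)
Require Import Defs.
From Stdlib Require Import Relation_Operators.
From HB Require Import structures.
From mathcomp Require Import all_boot all_order all_algebra.
From mathcomp Require Import finmap ring zify.
From mathcomp.multinomials Require Import monalg.
Import Defs.

(* There is a simplicial retraction r of MC(g) onto gamma(g), moving every simplex
   by a gauge transformation, and this gives everything.

   Gauge transformations: for lam of degree 0 and al a Maurer-Cartan element of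
   g (x) Omega_n, the Maurer-Cartan element a of g (x) Omega_n (x) K[u, du] with
   a = al at u = 0 and du-component lam is the unique solution of the equation
     a = al + d(u lam) - h F(a),
   where F collects the brackets of at least two entries and h integrates along u.
   The solution exists by nilpotency, and it is a Maurer-Cartan element because the
   Bianchi identity turns the fixed point equation into a linear one for the
   curvature of a, whose only solution is 0.  Then exp(lam).al is a at u = 1.

   Retraction: on Omega_n, P s = 0 for degree reasons, so that s d s = s.  For lam
   in the image of s, s(exp(lam).al) = s(al) + lam + (terms of higher filtration),
   so there is exactly one such lam = lam(al) with s(exp(lam).al) = 0; it commutes
   with simplicial operators and is zero on gamma.  Put r(al) = exp(lam(al)).al.

   Applying r to a chain of homotopies in MC gives one in gamma, hence injectivity
   on homotopy groups.  For a sphere x in MC, lam(x) vanishes on all the faces, so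
   that the sum of t_i f_i^* lam(x), with f_i sending the last vertex to i and
   fixing the others, has last face lam(x) and its other faces are zero; acting with
   it on a degeneracy of x gives a homotopy from x to r(x), hence surjectivity. *)

Set Implicit Arguments.
Unset Strict Implicit.
Unset Printing Implicit Defensive.

Import GRing.Theory.
Local Open Scope ring_scope.

(** * Polynomial forms *)

(** Signs are the main obstacle. Only brackets with at most one entry of degree different from 1
    occur. An entry x (x) a of total degree 1 has |x| = 1 - |a|, so its signs can be read off from
    the forms alone. Every operator on forms is therefore twisted by parity ([taup]) and applied as
    id (x) F, with no sign coming from g; such operators commute with the internal differential
    [delta]. The price is that the differential of g (x) Omega_n reads [delta - vdt] in degree 1 and
    [delta + vdt] in degrees 0 and 2. The equations for the path and for the gauge parameter both
    have the form a = T a, where T raises the filtration of differences. Iterating N times from 0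
    gives the solution. Its uniqueness gives naturality: the pullback of a solution solves the
    pulled back equation, which is what makes the retraction simplicial. Characteristic 0 enters
    through the coefficients 1/l! of the brackets, the denominators k+1 of integration, and the
    vanishing of squares of 1-forms. *)

(* Locked copies: conversion does not terminate in practice on distinct terms
   built from the finite maps underlying [mono] and [tens]. *)
HB.lock Definition mon (K : fieldType) n (c : cell n) : Omega K n := mono K c.

HB.lock Definition tn (K : fieldType) (V : lmodType K) n (x : V) (w : Omega K n) : gform V n :=
  tens x w.

HB.lock Definition lx (K : fieldType) (V : lmodType K) m n (L : cell m -> Omega K n)
  (u : gform V m) : gform V n := linext L u.

HB.lock Definition mulo (K : fieldType) n (a b : Omega K n) : Omega K n := omul a b.

Arguments mon {K n} c.

(** * Linear maps on V (x) Omega_n, determined by pure tensors of cells *)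

Section LinearExtension.

Variable K : fieldType.

Section LinearMaps.

Variables (V W : lmodType K) (f : V -> W).
Hypothesis fL : linear f.

Let F : {linear V -> W} := HB.pack f (GRing.isLinear.Build K V W *:%R f fL).

(** Linearity is kept as a property of bare functions, so that composites and sums assembled by
    [lin_comp], [lin_add] and [lin_scale] need no declared structure. *)
Lemma lin0 : f 0 = 0. Proof. exact: (raddf0 F). Qed.
Lemma linD : {morph f : x y / x + y}. Proof. exact: (raddfD F). Qed.
Lemma linB : {morph f : x y / x - y}. Proof. exact: (raddfB F). Qed.
Lemma linN : {morph f : x / - x}. Proof. exact: (raddfN F). Qed.
Lemma linZ a : {morph f : x / a *: x}. Proof. by move=> x; have := fL a x 0; rewrite lin0 !addr0. Qed.
Lemma lin_sum I r (P : pred I) E :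
  f (\sum_(i <- r | P i) E i) = \sum_(i <- r | P i) f (E i).
Proof. exact: (raddf_sum F). Qed.

End LinearMaps.

Lemma lin_comp (U V W : lmodType K) (f : V -> W) (g : U -> V) :
  linear f -> linear g -> linear (fun x => f (g x)).
Proof. by move=> fL gL a x y; rewrite gL fL. Qed.

Lemma lin_add (U V : lmodType K) (f g : U -> V) :
  linear f -> linear g -> linear (fun x => f x + g x).
Proof. by move=> fL gL a x y; rewrite gL fL scalerDr addrACA. Qed.

Lemma lin_scale (U V : lmodType K) (k : K) (f : U -> V) :
  linear f -> linear (fun x => k *: f x).
Proof. by move=> fL a x y; rewrite fL scalerDr !scalerA mulrC. Qed.

Lemma lin_id (U : lmodType K) : linear (fun x : U => x).
Proof. by []. Qed.

(** [lx], [mulo] and the brackets are sums of this shape over a support; their linearity in the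
    element whose support is summed over comes from [bext_linear]. *)
Definition bext (V W : lmodType K) n (B : V -> cell n -> W) (u : gform V n) : W :=
  \sum_(c <- msupp u) B u@_c c.

Section BilinearExtension.

Variables (V W : lmodType K) (n : nat) (B : V -> cell n -> W).
Hypothesis BL : forall c, linear (B^~ c).

Lemma bextE (D : {fset cell n}) (u : gform V n) :
  (msupp u `<=` D)%fset -> bext B u = \sum_(c <- D) B u@_c c.
Proof.
move=> uD; apply: big_fset_incl => // c _ cu.
by rewrite (mcoeff_outdom cu) (lin0 (BL c)).
Qed.

Lemma bext_linear : linear (bext B).
Proof.
move=> a u v; set D := (msupp u `|` msupp v `|` msupp (a *: u + v))%fset.
have uD : (msupp u `<=` D)%fset by rewrite /D -fsetUA fsubsetUl.
have vD : (msupp v `<=` D)%fset by rewrite /D (fsetUC (msupp u)) -fsetUA fsubsetUl.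
have wD : (msupp (a *: u + v) `<=` D)%fset by rewrite /D fsubsetUr.
rewrite (bextE uD) (bextE vD) (bextE wD) scaler_sumr -big_split /=.
by apply: eq_bigr => c _; rewrite mcoeffD gcoeffZ BL.
Qed.

Lemma bext_mono c x : bext B << x *g c >> = B x c.
Proof.
rewrite (@bextE [fset c]%fset) ?msuppU_le //.
by rewrite big_seq_fset1 mcoeffUU.
Qed.

End BilinearExtension.

Lemma gform_scaleU (V : lmodType K) n (a : K) (x : V) (c : cell n) :
  a *: (<< x *g c >> : gform V n) = << a *: x *g c >>.
Proof. by apply/malgP => c'; rewrite [LHS]gcoeffZ [X in _ *: X]mcoeffU [RHS]mcoeffU scalerMnr. Qed.

Lemma tens_linear (V : lmodType K) n (w : Omega K n) : linear (fun x : V => tens x w).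
Proof.
move=> a x y; rewrite /tens scaler_sumr -big_split; apply: eq_bigr => c _ /=.
by rewrite gform_scaleU -monalgUD scalerDr !scalerA mulrC.
Qed.

Lemma tens_linearr (V : lmodType K) n (x : V) : linear (tens x : Omega K n -> gform V n).
Proof.
have BL (c : cell n) : linear (fun y : K^o => << (y : K) *: x *g c >> : gform V n).
  by move=> a y z; rewrite gform_scaleU -monalgUD scalerDl scalerA.
exact: (bext_linear BL).
Qed.

Lemma tn_linear (V : lmodType K) n (w : Omega K n) : linear (fun x : V => tn x w).
Proof. by rewrite tn.unlock; exact: tens_linear. Qed.

Lemma tn_linearr (V : lmodType K) n (x : V) : linear (tn x : Omega K n -> gform V n).
Proof. by rewrite tn.unlock; exact: tens_linearr. Qed.

Lemma lx_linear (V : lmodType K) m n (L : cell m -> Omega K n) : linear (lx L : gform V m -> _).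
Proof.
by rewrite lx.unlock; exact: (bext_linear (fun c => tens_linear (V := V) (L c))).
Qed.

HB.instance Definition _ (V : lmodType K) n (x : V) :=
  GRing.isLinear.Build K (Omega K n) (gform V n) *:%R (tn x) (tn_linearr x).

HB.instance Definition _ (V : lmodType K) m n (L : cell m -> Omega K n) :=
  GRing.isLinear.Build K (gform V m) (gform V n) *:%R (lx L) (lx_linear L).

Lemma gform_tn (V : lmodType K) n (u : gform V n) :
  u = \sum_(c <- msupp u) tn u@_c (mon c).
Proof.
by rewrite tn.unlock mon.unlock [LHS]monalgE; apply: eq_bigr => c _; rewrite tens_mono.
Qed.

Lemma lx_tn_mon (V : lmodType K) m n (L : cell m -> Omega K n) (x : V) c :
  lx L (tn x (mon c)) = tn x (L c).
Proof.
rewrite lx.unlock tn.unlock mon.unlock tens_mono.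
exact: (bext_mono (fun c => tens_linear (V := V) (L c))).
Qed.

Lemma tn_coeff (V : lmodType K) n (x : V) (w : Omega K n) c : (tn x w)@_c = (w@_c : K) *: x.
Proof. by rewrite tn.unlock; exact: tens_coeff. Qed.

Lemma tnK n (x : K^o) (w : Omega K n) : tn x w = (x : K) *: w.
Proof. by apply/malgP => c; rewrite [LHS]tn_coeff [RHS]gcoeffZ; exact: mulrC. Qed.

Lemma bext_tn (V W : lmodType K) n (B : V -> cell n -> W) (BL : forall c, linear (B^~ c)) x c :
  bext B (tn x (mon c)) = B x c.
Proof. by rewrite tn.unlock mon.unlock tens_mono; exact: (bext_mono BL). Qed.

Lemma bext_mon (W : lmodType K) n (B : K^o -> cell n -> W) (BL : forall c, linear (B^~ c)) c :
  bext B (mon c) = B 1 c.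
Proof. by rewrite mon.unlock; exact: (bext_mono BL). Qed.

Lemma lx_mon m n (L : cell m -> Omega K n) c : lx L (mon c : Omega K m) = L c.
Proof. by rewrite -[in LHS](scale1r (mon c)) -tnK lx_tn_mon tnK scale1r. Qed.

Lemma Omega_mon n (w : Omega K n) : w = \sum_(c <- msupp w) (w@_c : K) *: mon c.
Proof. by rewrite {1}[w]gform_tn; apply: eq_bigr => c _; rewrite tnK. Qed.

Lemma mon_coeff n (c c' : cell n) : (mon c : Omega K n)@_c' = (c == c')%:R.
Proof. by rewrite mon.unlock; exact: mcoeffU. Qed.

Lemma Omega_ind n (P : Omega K n -> Prop) :
  P 0 -> (forall (a : K) u v, P u -> P v -> P (a *: u + v)) -> (forall c, P (mon c)) ->
  forall w, P w.
Proof.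
move=> P0 PD Pc w; rewrite [w]Omega_mon; elim: enum_fset => [|c r IH].
  by rewrite big_nil.
by rewrite big_cons; exact: PD.
Qed.

Lemma gform_ind (V : lmodType K) n (P : gform V n -> Prop) :
  P 0 -> (forall u v, P u -> P v -> P (u + v)) -> (forall x c, P (tn x (mon c))) ->
  forall w, P w.
Proof.
move=> P0 PD Pc w; rewrite [w]gform_tn; elim: enum_fset => [|c r IH].
  by rewrite big_nil.
by rewrite big_cons; exact: PD.
Qed.

Lemma Omega_linear_eq n (W : lmodType K) (F G : Omega K n -> W) :
  linear F -> linear G -> (forall c, F (mon c) = G (mon c)) -> F =1 G.
Proof.
move=> FL GL FG w; elim/Omega_ind: w => [|a u v IHu IHv|//].
  by rewrite (lin0 FL) (lin0 GL).
by rewrite FL GL IHu IHv.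
Qed.

Lemma gform_linear_eq (V : lmodType K) n (W : lmodType K) (F G : gform V n -> W) :
  linear F -> linear G -> (forall x c, F (tn x (mon c)) = G (tn x (mon c))) ->
  F =1 G.
Proof.
move=> FL GL FG w; elim/gform_ind: w => [|u v IHu IHv|//].
  by rewrite (lin0 FL) (lin0 GL).
by rewrite (linD FL) (linD GL) IHu IHv.
Qed.

Lemma lx_tn (V : lmodType K) m n (L : cell m -> Omega K n) (x : V) w :
  lx L (tn x w) = tn x (lx L w).
Proof.
have L1 := lin_comp (@lx_linear V _ _ L) (tn_linearr x).
have L2 := lin_comp (tn_linearr x) (@lx_linear K^o _ _ L).
move: w; apply: (Omega_linear_eq L1 L2) => c.
by rewrite lx_tn_mon lx_mon.
Qed.

Lemma lx_comp (V : lmodType K) l m n (L : cell l -> Omega K m) (M : cell m -> Omega K n)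
    (u : gform V l) :
  lx M (lx L u) = lx (fun c => lx M (L c)) u.
Proof.
have L1 := lin_comp (@lx_linear V _ _ M) (@lx_linear V _ _ L).
move: u; apply: (gform_linear_eq L1) => [|x c]; first exact: lx_linear.
by rewrite !lx_tn_mon lx_tn.
Qed.

Lemma eq_lx (V : lmodType K) m n (L M : cell m -> Omega K n) :
  L =1 M -> @lx K V m n L =1 lx M.
Proof. by move=> LM u; rewrite lx.unlock; apply: eq_bigr => c _; rewrite LM. Qed.

Lemma lx_id (V : lmodType K) n (u : gform V n) : lx mon u = u.
Proof.
by rewrite [RHS]gform_tn lx.unlock tn.unlock.
Qed.

End LinearExtension.

(** * Omega_n as an algebra *)

Section Algebra.

Variable K : fieldType.

Local Notation Omega := (Omega K).
Implicit Types (n : nat).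

(* The number of pairs exchanged when dt_S dt_T is put in increasing order. *)
Definition ninv n (S T : {set 'I_n}) : nat := \sum_(i in S) \sum_(j in T) (j < i)%N.

Lemma cmulE n (c c' : cell n) :
  cmul K c c' = if [disjoint c.2 & c'.2] then
    ((-1) ^+ ninv c.2 c'.2 : K) *: mon (mulcm c.1 c'.1, c.2 :|: c'.2) else 0.
Proof.
rewrite mon.unlock /cmul; case: ifP => // _; congr ((-1) ^+ _ *: _).
rewrite /ninv pair_big_dep /= -sum1_card big_mkcond /= [RHS]big_mkcond.
by apply: eq_bigr => [[i j]] _; rewrite inE /=; case: (i \in _); case: (j \in _); case: ltnP.
Qed.

Let linBr n (x : K^o) (c : cell n) c' :
  linear (fun y : K^o => (x * y : K) *: cmul K c c').
Proof. by move=> a y z; rewrite mulrDr scalerDl scalerA /GRing.scale /= mulrCA. Qed.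

Lemma mulo_linearr n (a : Omega n) : linear (mulo a).
Proof.
move=> k u v; rewrite mulo.unlock /omul scaler_sumr -big_split; apply: eq_bigr => c _ /=.
exact: (bext_linear (linBr a@_c c)).
Qed.

Let linBl n (b : Omega n) (c : cell n) :
  linear (fun x : K^o => bext (fun (y : K^o) c' => (x * y : K) *: cmul K c c') b).
Proof.
move=> k x y; rewrite /bext scaler_sumr -big_split /=; apply: eq_bigr => c' _.
by rewrite mulrDl scalerDl scalerA /GRing.scale /= mulrA.
Qed.

Lemma mulo_linearl n (b : Omega n) : linear (fun a : Omega n => mulo a b).
Proof. by rewrite mulo.unlock; exact: (bext_linear (linBl b)). Qed.

Lemma mulo_mon n (c c' : cell n) :
  mulo (mon c) (mon c') = if [disjoint c.2 & c'.2] then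
    ((-1) ^+ ninv c.2 c'.2 : K) *: mon (mulcm c.1 c'.1, c.2 :|: c'.2) else 0.
Proof.
rewrite -cmulE.
transitivity (bext (fun (y : K^o) c' => (1 * y : K) *: cmul K c c') (mon c')).
  by rewrite mulo.unlock; exact: (bext_mon (linBl (mon c'))).
by rewrite [LHS](bext_mon (linBr 1 c)) mulr1 scale1r.
Qed.

Lemma cmul_mon n (c c' : cell n) : cmul K c c' = mulo (mon c) (mon c').
Proof. by rewrite mulo_mon cmulE. Qed.

Lemma sum_setU_disj n (S T : {set 'I_n}) (F : 'I_n -> nat) :
  [disjoint S & T] ->
  (\sum_(i in S :|: T) F i = \sum_(i in S) F i + \sum_(i in T) F i)%N.
Proof. by move=> d; rewrite (eq_bigl [in [predU S & T]]) ?bigU // => i; rewrite !inE. Qed.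

Lemma disjointsUl n (S T U : {set 'I_n}) :
  [disjoint S :|: T & U] = [disjoint S & U] && [disjoint T & U].
Proof. by rewrite -!setI_eq0 setIUl setU_eq0. Qed.

Lemma disjointsUr n (S T U : {set 'I_n}) :
  [disjoint S & T :|: U] = [disjoint S & T] && [disjoint S & U].
Proof. by rewrite -!setI_eq0 setIUr setU_eq0. Qed.

Lemma ninvUl n (S T U : {set 'I_n}) :
  [disjoint S & T] -> ninv (S :|: T) U = (ninv S U + ninv T U)%N.
Proof. by move=> dST; rewrite /ninv sum_setU_disj. Qed.

Lemma ninvUr n (S T U : {set 'I_n}) :
  [disjoint T & U] -> ninv S (T :|: U) = (ninv S T + ninv S U)%N.
Proof.
by move=> d; rewrite /ninv -big_split /=; apply: eq_bigr => i _; rewrite sum_setU_disj.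
Qed.

Lemma ninv_sym n (S T : {set 'I_n}) :
  [disjoint S & T] -> (ninv S T + ninv T S = #|S| * #|T|)%N.
Proof.
move=> dST; rewrite /ninv [X in (_ + X)%N]exchange_big -big_split /=.
rewrite (eq_bigr (fun=> #|T|)); first by rewrite sum_nat_const.
move=> i iS; rewrite -big_split /= (eq_bigr (fun=> 1%N)) ?sum1_card // => j jT.
case: (ltngtP i j) => // /val_inj ij; move: (disjointFr dST iS).
by rewrite ij jT.
Qed.

(** On cells with form parts S, T, U both sides carry the exponent ninv(S,T) + ninv(S,U) +
    ninv(T,U), because [ninv] is additive in each argument over disjoint unions. *)
Lemma muloA n : associative (@mulo K n).
Proof.
move=> a b c.
have L1 := mulo_linearl (mulo b c).
have L2 := lin_comp (mulo_linearl c) (mulo_linearl b).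
move: a; apply: (Omega_linear_eq L1 L2) => ca {L1 L2}.
have L1 := lin_comp (mulo_linearr (mon ca)) (mulo_linearl c).
have L2 := lin_comp (mulo_linearl c) (mulo_linearr (mon ca)).
move: b; apply: (Omega_linear_eq L1 L2) => cb {L1 L2}.
have L1 := lin_comp (mulo_linearr (mon ca)) (mulo_linearr (mon cb)).
have L2 := mulo_linearr (mulo (mon ca) (mon cb)).
move: c; apply: (Omega_linear_eq L1 L2) => cc {L1 L2}.
rewrite (mulo_mon ca cb) (mulo_mon cb cc).
have [dab|ndab] := boolP [disjoint ca.2 & cb.2]; last first.
  rewrite (lin0 (mulo_linearl _)); case: ifP => [dbc|_]; last first.
    by rewrite (lin0 (mulo_linearr _)).
  rewrite (linZ (mulo_linearr _)) mulo_mon /= disjointsUr (negbTE ndab).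
  by rewrite scaler0.
rewrite (linZ (mulo_linearl _)) mulo_mon /= disjointsUl.
have [dbc|ndbc] := boolP [disjoint cb.2 & cc.2]; last first.
  by rewrite (lin0 (mulo_linearr _)) andbF scaler0.
rewrite (linZ (mulo_linearr _)) mulo_mon /= disjointsUr dab andbT /=.
case: ifP => _; last by rewrite !scaler0.
rewrite !scalerA -!exprD ninvUl // ninvUr // mulcmA setUA.
by congr ((-1) ^+ _ *: _); rewrite addnC -addnA.
Qed.

Lemma mul1o n : left_id (mon (onecm _, set0)) (@mulo K n).
Proof.
move=> a; move: a; apply: (Omega_linear_eq (mulo_linearr _) (@lin_id _ _)) => c.
rewrite mulo_mon /= -setI_eq0 set0I eqxx /ninv big_set0 scale1r mul0cm set0U.
by case: c.
Qed.

Lemma mulo1 n : right_id (mon (onecm _, set0)) (@mulo K n).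
Proof.
move=> a; move: a; apply: (Omega_linear_eq (mulo_linearl _) (@lin_id _ _)) => c.
rewrite mulo_mon /= -setI_eq0 setI0 eqxx /ninv big1 => [|i _]; last by rewrite big_set0.
rewrite scale1r mulcm0 setU0.
by case: c.
Qed.

Lemma mon_neq0 n (c : cell n) : mon c != 0 :> Omega n.
Proof.
apply/eqP => /(congr1 (mcoeff c)); rewrite [LHS]mon_coeff [RHS]mcoeff0 eqxx.
by apply/eqP; exact: oner_neq0.
Qed.

Lemma muloDl n : left_distributive (@mulo K n) +%R.
Proof. by move=> a b c; rewrite (linD (mulo_linearl c)). Qed.

Lemma muloDr n : right_distributive (@mulo K n) +%R.
Proof. by move=> a b c; rewrite (linD (mulo_linearr a)). Qed.

HB.instance Definition _ n := GRing.Zmodule_isNzRing.Build (gform K^o n)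
  (@muloA n) (@mul1o n) (@mulo1 n) (@muloDl n) (@muloDr n) (mon_neq0 (onecm _, set0)).

Lemma muloAl n (k : K) (a b : gform K^o n) : k *: (a * b) = k *: a * b.
Proof. by rewrite -[LHS](linZ (mulo_linearl b)). Qed.

HB.instance Definition _ n := GRing.Lmodule_isLalgebra.Build K (gform K^o n) (@muloAl n).

Lemma muloAr n (k : K) (a b : gform K^o n) : k *: (a * b) = a * (k *: b).
Proof. by rewrite -[LHS](linZ (mulo_linearr a)). Qed.

HB.instance Definition _ n := GRing.Lalgebra_isAlgebra.Build K (gform K^o n) (@muloAr n).

End Algebra.

(** * Generators, parity operators and the de Rham differential *)

Section Forms.

Variable K : fieldType.
Local Notation Omega := (Omega K).
Implicit Types (n : nat).

Definition tvar n (i : 'I_n) : Omega n := mon (ucm i, set0).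
Definition dvar n (i : 'I_n) : Omega n := mon (onecm _, [set i]).

Lemma mon1 n : mon (onecm _, set0) = 1 :> Omega n.
Proof. by []. Qed.

Lemma mul_linearl n (b : Omega n) : linear (fun a : Omega n => a * b).
Proof. exact: mulo_linearl. Qed.

Lemma mul_linearr n (b : Omega n) : linear (fun a : Omega n => b * a).
Proof. exact: mulo_linearr. Qed.

Lemma monM n (c c' : cell n) : (mon c : Omega n) * mon c' =
  if [disjoint c.2 & c'.2] then
    ((-1) ^+ ninv c.2 c'.2 : K) *: mon (mulcm c.1 c'.1, c.2 :|: c'.2) else 0.
Proof. exact: mulo_mon. Qed.

Lemma ninv0l n (S : {set 'I_n}) : ninv set0 S = 0%N.
Proof. by rewrite /ninv big_set0. Qed.

Lemma tvarM n i (c : cell n) : tvar i * mon c = mon (mulcm (ucm i) c.1, c.2) :> Omega n.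
Proof. by rewrite monM -setI_eq0 set0I eqxx ninv0l scale1r set0U. Qed.

Lemma dvarM n i (c : cell n) : dvar i * mon c =
  if i \in c.2 then 0 else ((-1) ^+ ninv [set i] c.2 : K) *: mon (c.1, i |: c.2) :> Omega n.
Proof. by rewrite monM /= disjoints1 mul0cm; case: (i \in c.2). Qed.

(** Every cell is reached from 1 by left multiplication with generators; the counts supply the
    decreasing measure for [Omega_gen_ind]. The sign [e] undoes the sorting sign of [dvarM]. *)
Lemma mon_cases n (c : cell n) :
  [\/ mon c = 1 :> Omega n,
      exists i (c' : cell n), [/\ mon c = tvar i * mon c' :> Omega n, c'.2 = c.2 &
        ((\sum_j c'.1 j).+1 = \sum_j c.1 j)%N] |
      exists i (c' : cell n) (e : K), [/\ mon c = e *: (dvar i * mon c') :> Omega n, c'.1 = c.1 &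
        (#|c'.2|.+1 = #|c.2|)%N]].
Proof.
case: c => m S; have [m0|[i mi]] : m = onecm _ \/ exists i, (0 < m i)%N.
- case: (pickP (fun i => 0 < m i)%N) => [i mi|m0]; first by right; exists i.
  by left; apply/eqP/cmP => i; move/negbT: (m0 i); rewrite -leqNgt leqn0 cm1 => /eqP.
- case: (set_0Vmem S) => [S0|[i iS]]; first by constructor 1; rewrite m0 S0.
  constructor 3; exists i, (m, S :\ i), ((-1) ^+ ninv [set i] (S :\ i)); split=> //=.
    by rewrite dvarM /= !inE eqxx /= scalerA -exprMn mulrNN mulr1 expr1n scale1r setD1K.
  by rewrite (cardsD1 i S) iS.
constructor 2; exists i, (divcm m (ucm i), S); split=> //=.
  rewrite tvarM /=; congr (mon (_, _)); apply/eqP/cmP => j.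
  by rewrite mulcmE divcmE cmU; case: eqP => [<-|_]; rewrite ?subn0 // subnKC.
rewrite (bigD1 i) //= [RHS](bigD1 i) //= divcmE cmUU -addSn subn1 prednK //.
congr (_ + _)%N; apply: eq_bigr => j ji; rewrite divcmE cmU eq_sym (negbTE ji).
by rewrite subn0.
Qed.

Lemma Omega_gen_ind n (P : Omega n -> Prop) :
  P 0 -> (forall (a : K) u v, P u -> P v -> P (a *: u + v)) -> P 1 ->
  (forall i a, P a -> P (tvar i * a)) -> (forall i a, P a -> P (dvar i * a)) ->
  forall w, P w.
Proof.
move=> P0 PD P1 Pt Pd; apply: Omega_ind => // c.
have [k] := ubnP (\sum_j c.1 j + #|c.2|)%N; elim: k c => // k IH c ck.
have [->//|[i [c' [-> c2 c1]]]|[i [c' [e [-> c1 c2]]]]] := mon_cases c.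
  by apply/Pt/IH; rewrite c2 -ltnS -addSn c1.
rewrite -[_ *: _]addr0; apply: PD => //; apply/Pd/IH.
by rewrite c1 -ltnS -addnS c2.
Qed.

(** The two maps need only obey the same recursion under left multiplication by generators. As [L]
    and [M] are arbitrary, this covers algebra maps as well as operators that pick up parity
    signs. *)
Lemma Omega_gen_eq n (W : lmodType K) (F G : Omega n -> W)
    (L : 'I_n -> W -> W) (M : 'I_n -> W -> W) : linear F -> linear G -> F 1 = G 1 ->
  (forall i a, F (tvar i * a) = L i (F a)) -> (forall i a, G (tvar i * a) = L i (G a)) ->
  (forall i a, F (dvar i * a) = M i (F a)) -> (forall i a, G (dvar i * a) = M i (G a)) ->
  F =1 G.
Proof.
move=> FL GL FG1 Ft Gt Fd Gd w; elim/Omega_gen_ind: w => [|a u v IHu IHv||i a IH|i a IH] //.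
- by rewrite (lin0 FL) (lin0 GL).
- by rewrite FL GL IHu IHv.
- by rewrite Ft Gt IH.
- by rewrite Fd Gd IH.
Qed.

(* Parity operators: [taup k] is (-1)^(k p) on p-forms. *)
Definition taup_cell n k (c : cell n) : Omega n := ((-1) ^+ (k * #|c.2|) : K) *: mon c.
Definition taup (V : lmodType K) n k : gform V n -> gform V n := lx (taup_cell k).

Lemma taup_linear (V : lmodType K) n k : linear (taup k : gform V n -> _).
Proof. exact: lx_linear. Qed.

Lemma taup_mon n k (c : cell n) : taup k (mon c) = ((-1) ^+ (k * #|c.2|) : K) *: mon c :> Omega n.
Proof. exact: lx_mon. Qed.

Lemma taupM n k : {morph (taup k : Omega n -> Omega n) : a b / a * b}.
Proof.
move=> a b; have tL := @taup_linear K^o n k.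
have L1 := lin_comp tL (mul_linearl b).
have L2 := lin_comp (mul_linearl (taup k b)) tL.
move: a; apply: (Omega_linear_eq L1 L2) => c {L1 L2}.
have L1 := lin_comp tL (mul_linearr (mon c)).
have L2 := lin_comp (mul_linearr (taup k (mon c))) tL.
move: b; apply: (Omega_linear_eq L1 L2) => c' {L1 L2}.
rewrite !taup_mon -scalerAl -scalerAr scalerA monM; case: ifP => dcc; last first.
  by rewrite scaler0 (lin0 tL).
rewrite (linZ tL) taup_mon !scalerA mulrC -!exprD -mulnDr /=.
by rewrite cardsU; move: dcc; rewrite -setI_eq0 => /eqP ->; rewrite cards0 subn0.
Qed.

Lemma taup_1 n k : taup k (1 : Omega n) = 1.
Proof. by rewrite -mon1 taup_mon cards0 muln0 scale1r. Qed.

Lemma taupD (V : lmodType K) n k l (u : gform V n) : taup k (taup l u) = taup (k + l) u.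
Proof.
rewrite /taup lx_comp; apply: eq_lx => c.
by rewrite (linZ (lx_linear _)) lx_mon /taup_cell scalerA -exprD mulnDl addnC.
Qed.

Lemma taup_even (V : lmodType K) n k (u : gform V n) : ~~ odd k -> taup k u = u.
Proof.
move=> ke; rewrite -[RHS]lx_id; apply: eq_lx => c.
by rewrite /taup_cell -signr_odd oddM (negbTE ke) scale1r.
Qed.

(** By [ninv_sym] the two sorting signs differ by (-1)^(|S||T|), which on a form of degree |T| is
    the effect of [taup #|c.2|]. *)
Lemma monC n (c : cell n) (b : Omega n) : mon c * b = taup #|c.2| b * mon c.
Proof.
have L1 := mul_linearr (mon c).
have L2 := lin_comp (mul_linearl (mon c)) (@taup_linear K^o n #|c.2|).
move: b; apply: (Omega_linear_eq L1 L2) => c'.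
rewrite taup_mon -scalerAl !monM disjoint_sym; case: ifP => dcc; last by rewrite scaler0.
rewrite scalerA mulcmC setUC; congr (_ *: _).
rewrite -(ninv_sym (S := c.2)) 1?disjoint_sym // exprD -mulrA -exprMn.
by rewrite mulrNN mulr1 expr1n mulr1.
Qed.

Lemma tvarC n i (b : Omega n) : tvar i * b = b * tvar i.
Proof. by rewrite monC /= cards0 taup_even. Qed.

Lemma dvarC n i (b : Omega n) : dvar i * b = taup 1 b * dvar i.
Proof. by rewrite monC /= cards1. Qed.

Lemma taup_tvar n k (i : 'I_n) : taup k (tvar i) = tvar i.
Proof. by rewrite /tvar taup_mon /= cards0 muln0 scale1r. Qed.

Lemma taup1_dvar n (i : 'I_n) : taup 1 (dvar i) = - dvar i.
Proof. by rewrite /dvar taup_mon /= cards1 muln1 expr1 scaleN1r. Qed.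

Lemma dvar_sqr n (i : 'I_n) : dvar i * dvar i = 0.
Proof. by rewrite {2}/dvar dvarM /= inE eqxx. Qed.

Lemma dvar_anti n (i j : 'I_n) : dvar i * dvar j = - (dvar j * dvar i).
Proof. by rewrite dvarC taup1_dvar mulNr. Qed.

(** The partial derivative along t_i, with the dt_j constant. It is an even derivation, so when d is
    written as the sum of the dt_i times these, the only sign in the Leibniz rule comes from moving
    dt_i past a form. *)
Definition pd_cell n (i : 'I_n) (c : cell n) : Omega n :=
  ((c.1 i)%:R : K) *: mon (divcm c.1 (ucm i), c.2).
Definition pd n (i : 'I_n) : Omega n -> Omega n := lx (pd_cell i).

Lemma pd_linear n (i : 'I_n) : linear (pd i).
Proof. exact: lx_linear. Qed.

Lemma pd_mon n (i : 'I_n) c : pd i (mon c) = pd_cell i c.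
Proof. exact: lx_mon. Qed.

Let pd_aux n (i : 'I_n) (m m' : 'X_{1..n}) (S : {set 'I_n}) (e : K) :
  ((m i)%:R : K) *: (e *: mon (mulcm (divcm m (ucm i)) m', S)) =
  e *: (((m i)%:R : K) *: mon (divcm (mulcm m m') (ucm i), S)) :> Omega n.
Proof.
(* If t_i does not occur in m, [divcm] truncates and the exponents need not match, but the
   coefficient is 0. *)
case: (posnP (m i)) => [->|mi]; first by rewrite !scale0r scaler0.
have -> : divcm (mulcm m m') (ucm i) = mulcm (divcm m (ucm i)) m'.
  apply/eqP/cmP => j; rewrite !(mulcmE, divcmE) cmU.
  by case: eqP => [<-|_]; rewrite ?subn0 // addnBAC.
by rewrite !scalerA mulrC.
Qed.

Lemma pdM n (i : 'I_n) (a b : Omega n) : pd i (a * b) = pd i a * b + a * pd i b.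
Proof.
have L1 := lin_comp (pd_linear i) (mul_linearl b).
have L2 := lin_add (lin_comp (mul_linearl b) (pd_linear i)) (mul_linearl (pd i b)).
move: a; apply: (Omega_linear_eq L1 L2) => c {L1 L2}.
have L1 := lin_comp (pd_linear i) (mul_linearr (mon c)).
have L2 := lin_add (mul_linearr (pd i (mon c))) (lin_comp (mul_linearr (mon c)) (pd_linear i)).
move: b; apply: (Omega_linear_eq L1 L2) => c' {L1 L2}.
rewrite !pd_mon /pd_cell -scalerAl -scalerAr !monM /=; case: ifP => _; last first.
  by rewrite (lin0 (pd_linear i)) !scaler0 addr0.
rewrite (linZ (pd_linear i)) pd_mon /pd_cell /= mulcmE natrD scalerDl scalerDr.
by rewrite pd_aux [in X in _ = _ + X]mulcmC pd_aux [mulcm c'.1 _]mulcmC.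
Qed.

Lemma pd_tvar n (i j : 'I_n) : pd i (tvar j) = (i == j)%:R.
Proof.
rewrite /tvar pd_mon /pd_cell /= cmU eq_sym; case: eqP => [->|_]; last by rewrite scale0r.
rewrite scale1r -mon1; congr (mon (_, _)); apply/eqP/cmP => k.
by rewrite divcmE cm1 subnn.
Qed.

Lemma pd_dvar n (i j : 'I_n) : pd i (dvar j) = 0.
Proof. by rewrite /dvar pd_mon /pd_cell cm1 scale0r. Qed.

Lemma pd_1 n (i : 'I_n) : pd i 1 = 0.
Proof. by rewrite -mon1 pd_mon /pd_cell cm1 scale0r. Qed.

Definition df_cell n (c : cell n) : Omega n := \sum_i dvar i * pd i (mon c).
Definition df n : Omega n -> Omega n := lx (@df_cell n).

Lemma df_linear n : linear (@df n).
Proof. exact: lx_linear. Qed.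

Lemma dfE n (w : Omega n) : df w = \sum_i dvar i * pd i w.
Proof.
have L1 : linear (fun w : Omega n => \sum_i dvar i * pd i w).
  move=> a u v; rewrite scaler_sumr -big_split /=; apply: eq_bigr => i _.
  by rewrite pd_linear mulrDr scalerAr.
by move: w; apply: (Omega_linear_eq (@df_linear n) L1) => c; exact: lx_mon.
Qed.

Lemma df_1 n : df (1 : Omega n) = 0.
Proof. by rewrite dfE big1 // => i _; rewrite pd_1 mulr0. Qed.

Lemma dfM n (a b : Omega n) : df (a * b) = df a * b + taup 1 a * df b.
Proof.
rewrite !dfE mulr_suml mulr_sumr -big_split /=; apply: eq_bigr => i _.
by rewrite pdM mulrDr !mulrA (dvarC i a).
Qed.

Lemma df_tvar n (i : 'I_n) : df (tvar i) = dvar i.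
Proof.
rewrite dfE (bigD1 i) //= pd_tvar eqxx mulr1 big1 ?addr0 // => j ji.
by rewrite pd_tvar (negbTE ji) mulr0.
Qed.

Lemma df_dvar n (i : 'I_n) : df (dvar i) = 0.
Proof. by rewrite dfE big1 // => j _; rewrite pd_dvar mulr0. Qed.

Lemma df_tvarM n (i : 'I_n) a : df (tvar i * a) = dvar i * a + tvar i * df a.
Proof. by rewrite dfM df_tvar taup_tvar. Qed.

Lemma df_dvarM n (i : 'I_n) a : df (dvar i * a) = - (dvar i * df a).
Proof. by rewrite dfM df_dvar taup1_dvar mul0r add0r mulNr. Qed.

Lemma df_df n (w : Omega n) : df (df w) = 0.
Proof.
have L0 := lin_comp (@df_linear n) (@df_linear n).
elim/Omega_gen_ind: w => [|a u v IHu IHv||i a IH|i a IH].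
- by rewrite (lin0 L0).
- by rewrite L0 IHu IHv scaler0 addr0.
- by rewrite df_1 (lin0 (@df_linear n)).
- by rewrite df_tvarM (linD (@df_linear n)) df_tvarM df_dvarM IH mulr0 addr0 addNr.
- by rewrite df_dvarM (linN (@df_linear n)) df_dvarM IH mulr0 !oppr0.
Qed.

Lemma taup_df n (w : Omega n) : taup 1 (df w) = - df (taup 1 w).
Proof.
have tL := @taup_linear K^o n 1.
have dL := @df_linear n.
elim/Omega_gen_ind: w => [|a u v IHu IHv||i a IH|i a IH].
- by rewrite (lin0 (lin_comp tL dL)) (lin0 (lin_comp dL tL)) oppr0.
- by rewrite (lin_comp tL dL) (lin_comp dL tL) IHu IHv opprD scalerN.
- by rewrite taup_1 df_1 (lin0 tL) oppr0.
- rewrite df_tvarM (linD tL) !taupM taup_tvar taup1_dvar IH df_tvarM opprD.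
  by rewrite mulNr mulrN.
- by rewrite df_dvarM (linN tL) !taupM taup1_dvar IH !mulNr (linN dL) df_dvarM mulrN.
Qed.

Lemma dformE n (w : Omega n) : dform w = df w.
Proof.
rewrite /dform /df lx.unlock; apply: eq_bigr => c _; congr (tens _ _).
rewrite /df_cell /dcell; apply: eq_bigr => i _.
rewrite pd_mon /pd_cell -scalerAr; congr (_ *: _).
rewrite cmul_mon mulo_mon dvarM /= disjoints1 mulcm0.
by case: (i \in c.2).
Qed.

End Forms.

Arguments tvar {K n} i.
Arguments dvar {K n} i.

(** * Forms of a fixed degree *)

Section KForms.

Variable K : fieldType.
Local Notation Omega := (Omega K).
Implicit Types (n k : nat).

Lemma kformP n k (w : Omega n) : is_kform k w <-> forall c : cell n, #|c.2| != k -> w@_c = 0.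
Proof.
split=> [wk c ck|wk c]; first by apply/mcoeff_outdom/negP => /wk /eqP; apply/negP.
by rewrite -mcoeff_neq0; apply: contra_neq_eq => /wk.
Qed.

Lemma kform0 n k : is_kform k (0 : Omega n).
Proof. by apply/kformP => c _; rewrite mcoeff0. Qed.

Lemma kform_lin n k (a : K) (u v : Omega n) :
  is_kform k u -> is_kform k v -> is_kform k (a *: u + v).
Proof.
move=> /kformP uk /kformP vk; apply/kformP => c ck.
by rewrite mcoeffD gcoeffZ uk // vk // scaler0 addr0.
Qed.

Lemma kformZ n k (a : K) (u : Omega n) : is_kform k u -> is_kform k (a *: u).
Proof. by move=> uk; rewrite -[_ *: _]addr0; apply: kform_lin => //; exact: kform0. Qed.

Lemma kformD n k (u v : Omega n) : is_kform k u -> is_kform k v -> is_kform k (u + v).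
Proof. by move=> uk vk; rewrite -[u]scale1r; exact: kform_lin. Qed.

Lemma kform_sum n k (I : Type) (r : seq I) (P : pred I) (F : I -> Omega n) :
  (forall i, P i -> is_kform k (F i)) -> is_kform k (\sum_(i <- r | P i) F i).
Proof.
move=> Fk; elim: r => [|i r IH]; first by rewrite big_nil; exact: kform0.
by rewrite big_cons; case: ifP => // Pi; apply: kformD => //; exact: Fk.
Qed.

Lemma kform_mon n (c : cell n) : is_kform #|c.2| (mon c : Omega n).
Proof.
apply/kformP => c' cc'; rewrite [LHS]mon_coeff.
by case: (eqVneq c c') cc' => [->|//]; rewrite eqxx.
Qed.

Lemma kform1 n : is_kform 0 (1 : Omega n).
Proof. by rewrite -mon1; have := @kform_mon n (onecm _, set0); rewrite cards0. Qed.

Lemma kform_ind n k (P : Omega n -> Prop) :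
  P 0 -> (forall (a : K) u v, P u -> P v -> P (a *: u + v)) ->
  (forall c : cell n, #|c.2| = k -> P (mon c)) -> forall w, is_kform k w -> P w.
Proof.
move=> P0 PD Pc w wk; rewrite [w]Omega_mon big_seq.
elim/big_rec: _ => [//|c u cw Pu]; apply: PD => //; apply: Pc; exact: wk.
Qed.

Lemma kformM n k l (a b : Omega n) : is_kform k a -> is_kform l b -> is_kform (k + l) (a * b).
Proof.
move=> ak bl; elim/kform_ind: ak => {a} [|x u v IHu IHv|c ck].
- by rewrite mul0r; exact: kform0.
- by rewrite mulrDl -scalerAl; exact: kform_lin.
elim/kform_ind: bl => {b} [|x u v IHu IHv|c' cl].
- by rewrite mulr0; exact: kform0.
- by rewrite mulrDr -scalerAr; exact: kform_lin.
rewrite monM; case: ifP => [dcc|_]; last exact: kform0.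
apply: kformZ; rewrite -ck -cl.
have -> : (#|c.2| + #|c'.2|)%N = #|c.2 :|: c'.2|.
  by rewrite cardsU; move: dcc; rewrite -setI_eq0 => /eqP ->; rewrite cards0 subn0.
by have := @kform_mon n (mulcm c.1 c'.1, c.2 :|: c'.2).
Qed.

Lemma kform_taup n k l (w : Omega n) : is_kform k w -> taup l w = ((-1) ^+ (l * k) : K) *: w.
Proof.
have tL := @taup_linear K K^o n l.
elim/kform_ind => [|x u v IHu IHv|c ck].
- by rewrite scaler0 (lin0 tL).
- by rewrite tL IHu IHv scalerDr !scalerA mulrC.
- by rewrite taup_mon ck.
Qed.

Lemma kformC n k (w b : Omega n) : is_kform k w -> w * b = taup k b * w.
Proof.
elim/kform_ind => [|x u v IHu IHv|c ck].
- by rewrite mul0r mulr0.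
- by rewrite mulrDl mulrDr -scalerAl -scalerAr IHu IHv.
- by rewrite monC ck.
Qed.

Lemma kform_df n k (w : Omega n) : is_kform k w -> is_kform k.+1 (df w).
Proof.
have dL := @df_linear K n.
elim/kform_ind => [|x u v IHu IHv|c ck].
- by rewrite (lin0 dL); exact: kform0.
- by rewrite dL; exact: kform_lin.
rewrite dfE; apply: kform_sum => i _; rewrite pd_mon /pd_cell -scalerAr; apply: kformZ.
have := kformM (@kform_mon n (onecm _, [set i])) (@kform_mon n (divcm c.1 (ucm i), c.2)).
by rewrite /= cards1 ck.
Qed.

Lemma kform_tvar n (i : 'I_n) : is_kform 0 (tvar i : Omega n).
Proof. by have := @kform_mon n (ucm i, set0); rewrite cards0. Qed.

Lemma kform_dvar n (i : 'I_n) : is_kform 1 (dvar i : Omega n).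
Proof. by have := @kform_mon n (onecm _, [set i]); rewrite cards1. Qed.

End KForms.

(** * Substitutions and pullbacks *)

Section Substitution.

Variable K : fieldType.
Local Notation Omega := (Omega K).

Section Fixed.

Variables (n k : nat) (p q : 'I_n -> Omega k).

Definition sub_cell (c : cell n) : Omega k :=
  (\prod_(i < n) p i ^+ c.1 i) * \prod_(i in c.2) q i.

Definition sub (V : lmodType K) : gform V n -> gform V k := lx sub_cell.

Lemma sub_linear (V : lmodType K) : linear (@sub V).
Proof. exact: lx_linear. Qed.

Lemma sub_mon (c : cell n) : sub (mon c : Omega n) = sub_cell c.
Proof. exact: lx_mon. Qed.

Lemma sub_1 : sub (1 : Omega n) = 1.
Proof.
rewrite -mon1 sub_mon /sub_cell /= big_set0 mulr1 big1 // => i _.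
by rewrite cm1 expr0.
Qed.

Hypotheses (p0 : forall i, is_kform 0 (p i)) (q1 : forall i, is_kform 1 (q i)).

Lemma sub_pC i b : p i * b = b * p i.
Proof. by rewrite (kformC _ (@p0 i)) taup_even. Qed.

Lemma sub_tvarM i (w : Omega n) : sub (tvar i * w) = p i * sub w.
Proof.
have L1 := lin_comp (@sub_linear K^o) (mul_linearr (tvar i)).
have L2 := lin_comp (mul_linearr (p i)) (@sub_linear K^o).
move: w; apply: (Omega_linear_eq L1 L2) => c.
rewrite tvarM !sub_mon /sub_cell mulrA /=; congr (_ * _).
(* The product is ordered, in a ring that is not commutative, so [p i] is moved along the index list
   by induction until it reaches its own factor. *)
have: uniq (index_enum 'I_n) by exact: index_enum_uniq.
have: i \in index_enum 'I_n by rewrite mem_index_enum.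
elim: (index_enum 'I_n) => // j r IH; rewrite inE !big_cons.
have pred1 r' : i \notin r' -> \prod_(l <- r') p l ^+ mulcm (ucm i) c.1 l =
    \prod_(l <- r') p l ^+ c.1 l.
  move=> ir; rewrite !big_seq; apply: eq_bigr => l lr.
  rewrite mulcmE cmU; case: eqP => [il|]; last by rewrite add0n.
  by move: ir; rewrite il lr.
have [<-{j} /= _ /andP[ir _]|ij /= ir /andP[_ ur]] := eqVneq i j.
  by rewrite pred1 // mulcmE cmUU exprS mulrA.
by rewrite mulcmE cmU (negbTE ij) add0n IH // mulrA -sub_pC -!mulrA.
Qed.

Hypotheses (qq : forall i, q i * q i = 0).

Lemma sub_qC i j : q i * q j = - (q j * q i).
Proof. by rewrite (kformC _ (@q1 i)) (kform_taup _ (@q1 j)) muln1 expr1 scaleN1r mulNr. Qed.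

Lemma sub_dvarM i (w : Omega n) : sub (dvar i * w) = q i * sub w.
Proof.
have L1 := lin_comp (@sub_linear K^o) (mul_linearr (dvar i)).
have L2 := lin_comp (mul_linearr (q i)) (@sub_linear K^o).
move: w; apply: (Omega_linear_eq L1 L2) => c.
rewrite dvarM !sub_mon /sub_cell mulrA.
have -> : q i * \prod_(j < n) p j ^+ c.1 j = \prod_(j < n) p j ^+ c.1 j * q i.
  apply: (big_ind (fun x => q i * x = x * q i)) => [|a b ea eb|j _].
  - by rewrite mulr1 mul1r.
  - by rewrite mulrA ea -!mulrA eb.
  by elim: (c.1 j) => [|m IH]; rewrite ?mulr1 ?mul1r // exprS mulrA -sub_pC -!mulrA IH.
rewrite -mulrA.
suff -> : q i * \prod_(j in c.2) q j = if i \in c.2 then 0 else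
    ((-1) ^+ ninv [set i] c.2 : K) *: \prod_(j in i |: c.2) q j.
  case: ifP => _; first by rewrite (lin0 (@sub_linear K^o)) mulr0.
  by rewrite (linZ (@sub_linear K^o)) sub_mon /sub_cell /= -scalerAr.
rewrite /ninv big_set1; move: (c.2) => S.
(* The index list is increasing, so [q i] passes exactly the factors with index j < i in S, whose
   number is the exponent; if i is in S it then meets its own factor, and the product is 0. *)
have sr : sorted (relpre (@nat_of_ord n) ltn) (index_enum 'I_n).
  by rewrite /index_enum [locked_with _ _]unlock -enumT -sorted_map val_enum_ord iota_ltn_sorted.
have: i \in index_enum 'I_n by rewrite mem_index_enum.
elim: (index_enum 'I_n) sr => // j r IH /= jr; rewrite inE !big_cons.
have trlt : transitive (relpre (@nat_of_ord n) ltn) by move=> a b d; exact: ltn_trans.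
have /allP jlt := order_path_min trlt jr.
have {}IH := IH (path_sorted jr).
have [eij _|ij /= ir] := eqVneq i j.
  rewrite -{j}eij in jr jlt *; rewrite in_setU1 eqxx /= ltnn add0n.
  have [iS|iS] := boolP (i \in S); first by rewrite mulrA qq mul0r.
  have -> : (\sum_(l <- r | l \in S) (l < i) = 0)%N.
    rewrite big_seq_cond big1 // => l /andP[lr _].
    by have /= il := jlt _ lr; rewrite ltnNge (ltnW il).
  rewrite expr0 scale1r.
  suff -> : \prod_(l <- r | l \in S) q l = \prod_(l <- r | l \in i |: S) q l by [].
  rewrite big_seq_cond [RHS]big_seq_cond; apply: eq_bigl => l.
  rewrite in_setU1; case: eqVneq => // ->.
  by case: (boolP (i \in r)) => // ir; have := jlt _ ir; rewrite /= ltnn.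
have /= ji := jlt _ ir.
rewrite in_setU1 eq_sym (negbTE ij) /= ji.
case: ifP => jS; last exact: IH.
rewrite mulrA sub_qC mulNr -mulrA IH //; case: ifP => _; first by rewrite mulr0 oppr0.
by rewrite add1n exprS mulN1r scaleNr -scalerAr.
Qed.

Lemma subM (a b : Omega n) : sub (a * b) = sub a * sub b.
Proof.
have sL := @sub_linear K^o.
elim/Omega_gen_ind: a b => [|x u v IHu IHv||i a IH|i a IH] b.
- by rewrite mul0r (lin0 sL) mul0r.
- by rewrite mulrDl -scalerAl !sL IHu IHv mulrDl scalerAl.
- by rewrite mul1r sub_1 mul1r.
- by rewrite -mulrA !sub_tvarM IH mulrA.
- by rewrite -mulrA !sub_dvarM IH mulrA.
Qed.

Lemma sub_tvar i : sub (tvar i : Omega n) = p i.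
Proof. by rewrite -[tvar i]mulr1 sub_tvarM sub_1 mulr1. Qed.

Lemma sub_dvar i : sub (dvar i : Omega n) = q i.
Proof. by rewrite -[dvar i]mulr1 sub_dvarM sub_1 mulr1. Qed.

Lemma sub_taup l (w : Omega n) : sub (taup l w) = taup l (sub w).
Proof.
have tL m := @taup_linear K K^o m l.
have sL := @sub_linear K^o.
move: w; apply: (Omega_gen_eq (L := fun i w => p i * w)
  (M := fun i w => ((-1) ^+ l : K) *: (q i * w)) (lin_comp sL (tL _)) (lin_comp (tL _) sL)).
- by rewrite taup_1 sub_1 taup_1.
- by move=> i a; rewrite taupM taup_tvar sub_tvarM.
- by move=> i a; rewrite sub_tvarM taupM (kform_taup _ (@p0 i)) muln0 scale1r.
- move=> i a; rewrite taupM (kform_taup _ (@kform_dvar K _ i)) muln1.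
  by rewrite -scalerAl (linZ sL) sub_dvarM.
- by move=> i a; rewrite sub_dvarM taupM (kform_taup _ (@q1 i)) muln1 -scalerAl.
Qed.

Lemma kform_sub_cell (c : cell n) : is_kform #|c.2| (sub_cell c).
Proof.
rewrite /sub_cell -[#|_|]add0n; apply: kformM.
  elim/big_ind: _ => [|a b|i _]; first exact: kform1.
    exact: (@kformM _ _ 0 0).
  elim: (c.1 i) => [|m IH]; first exact: kform1.
  by rewrite exprS; exact: (@kformM _ _ 0 0).
rewrite -sum1_card; elim/big_rec2: _ => [|i m a _ ma]; first exact: kform1.
exact: kformM.
Qed.

Lemma kform_sub m w : is_kform m w -> is_kform m (sub w).
Proof.
have sL := @sub_linear K^o.
elim/kform_ind => [|x u v IHu IHv|c <-].
- by rewrite (lin0 sL); exact: kform0.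
- by rewrite sL; exact: kform_lin.
- by rewrite sub_mon; exact: kform_sub_cell.
Qed.

Hypotheses (dp : forall i, df (p i) = q i) (dq : forall i, df (q i) = 0).

Lemma sub_df (w : Omega n) : sub (df w) = df (sub w).
Proof.
have dL m := @df_linear K m.
have sL := @sub_linear K^o.
elim/Omega_gen_ind: w => [|x u v IHu IHv||i a IH|i a IH].
- by rewrite (lin0 (lin_comp sL (dL _))) (lin0 (lin_comp (dL _) sL)).
- by rewrite (lin_comp sL (dL _)) (lin_comp (dL _) sL) IHu IHv.
- by rewrite df_1 sub_1 df_1 (lin0 sL).
- rewrite df_tvarM (linD sL) sub_dvarM !sub_tvarM dfM dp IH.
  by rewrite (kform_taup _ (@p0 i)) muln0 scale1r.
- rewrite df_dvarM (linN sL) !sub_dvarM dfM dq IH mul0r add0r.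
  by rewrite (kform_taup _ (@q1 i)) muln1 expr1 scaleN1r mulNr.
Qed.

End Fixed.

Hypothesis charK : [pchar K] =i pred0.

Lemma K2_neq0 : 2%:R != 0 :> K.
Proof. by apply/eqP => K2; have := charK 2; rewrite inE /= K2 eqxx. Qed.

(** A 1-form anticommutes with itself, so twice its square is 0, and 2 is invertible. *)
Lemma oddform_sqr n (w : Omega n) : is_kform 1 w -> w * w = 0.
Proof.
move=> w1; have /eqP := kformC w w1.
rewrite (kform_taup _ w1) muln1 expr1 scaleN1r mulNr -addr_eq0 -mulr2n -scaler_nat => /eqP.
move/(congr1 (fun u => 2%:R^-1 *: u)); rewrite scalerA mulVf ?K2_neq0 // scale1r.
by rewrite scaler0.
Qed.

Section PolynomialMap.

Variables (n k : nat) (p : 'I_n -> Omega k).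
Hypothesis p0 : forall i, is_kform 0 (p i).

(** The images of the dt_i are forced by compatibility with d. Pullbacks along vertex maps, the
    inclusion [up] and the evaluations [ev] of the cylinder are all of this kind, so that
    multiplicativity and compatibility with degrees and d are proved once. *)
Definition psub (V : lmodType K) : gform V n -> gform V k := @sub n k p (fun i => df (p i)) V.

Lemma psub_linear (V : lmodType K) : linear (@psub V).
Proof. exact: lx_linear. Qed.

Let q1 i : is_kform 1 (df (p i)). Proof. exact: kform_df. Qed.
Let qq i : df (p i) * df (p i) = 0. Proof. exact: oddform_sqr. Qed.

Lemma psub_1 : psub (1 : Omega n) = 1. Proof. exact: sub_1. Qed.

Lemma psubM (a b : Omega n) : psub (a * b) = psub a * psub b.
Proof. exact: subM. Qed.

Lemma psub_tvar i : psub (tvar i : Omega n) = p i.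
Proof. exact: sub_tvar. Qed.

Lemma psub_dvar i : psub (dvar i : Omega n) = df (p i).
Proof. exact: sub_dvar. Qed.

Lemma psub_taup l (w : Omega n) : psub (taup l w) = taup l (psub w).
Proof. exact: sub_taup. Qed.

Lemma psub_df (w : Omega n) : psub (df w) = df (psub w).
Proof. by apply: sub_df => // i; exact: df_df. Qed.

Lemma kform_psub m w : is_kform m w -> is_kform m (psub w).
Proof. exact: kform_sub. Qed.

End PolynomialMap.

Lemma eq_psub (V : lmodType K) n k (p p' : 'I_n -> Omega k) :
  p =1 p' -> forall u : gform V n, psub p u = psub p' u.
Proof.
move=> pp' u; apply: eq_lx => c; rewrite /sub_cell; congr (_ * _).
  by apply: eq_bigr => i _; rewrite pp'.
by apply: eq_bigr => i _; rewrite pp'.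
Qed.

Lemma psub_comp (V : lmodType K) l n k (p : 'I_l -> Omega n) (r : 'I_n -> Omega k)
    (p0 : forall i, is_kform 0 (p i)) (r0 : forall i, is_kform 0 (r i)) (u : gform V l) :
  psub r (psub p u) = psub (fun i => psub r (p i)) u.
Proof.
rewrite /psub /sub lx_comp; apply: eq_lx => c.
have rp0 i : is_kform 0 (psub r (p i)) by exact: kform_psub.
rewrite -[sub_cell p _ c]lx_mon -[RHS]lx_mon.
have FL := lin_comp (@psub_linear n k r K^o) (@psub_linear l n p K^o).
apply: (Omega_gen_eq (L := fun i w => psub r (p i) * w) (M := fun i w => df (psub r (p i)) * w)
   FL (@psub_linear l k _ K^o)) => [|i a|i a|i a|i a].
- by rewrite !psub_1.
- by rewrite !psubM // psub_tvar.
- by rewrite psubM // psub_tvar.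
- by rewrite !psubM // psub_dvar // psub_df.
- by rewrite psubM // psub_dvar.
Qed.

Lemma psub_tvars (V : lmodType K) n (u : gform V n) : psub tvar u = u.
Proof.
rewrite -[RHS]lx_id; apply: eq_lx => c; rewrite -[LHS]lx_mon.
have t0 (i : 'I_n) : is_kform 0 (tvar i : Omega n) by exact: kform_tvar.
apply: (Omega_gen_eq (L := fun i w => tvar i * w) (M := fun i w => dvar i * w)
   (@psub_linear n n _ K^o) (@lin_id K (Omega n))) => [|i a|i a|i a|i a] //.
- exact: psub_1.
- by rewrite psubM // psub_tvar.
- by rewrite psubM // psub_dvar // df_tvar.
Qed.

Lemma coordE n (i : 'I_n.+1) :
  coord K i = if unlift ord0 i is Some j then tvar j else 1 - \sum_(j < n) tvar j.
Proof. by rewrite /coord /tvar -mon1 mon.unlock. Qed.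

Lemma dcoordE n (i : 'I_n.+1) :
  dcoord K i = if unlift ord0 i is Some j then dvar j else - \sum_(j < n) dvar j.
Proof. by rewrite /dcoord /dvar mon.unlock. Qed.

Lemma kform_coord n (i : 'I_n.+1) : is_kform 0 (coord K i).
Proof.
rewrite coordE; case: unlift => [j|]; first exact: kform_tvar.
rewrite addrC -scaleN1r; apply: kform_lin; last exact: kform1.
by apply: kform_sum => j _; exact: kform_tvar.
Qed.

Lemma df_coord n (i : 'I_n.+1) : df (coord K i) = dcoord K i.
Proof.
rewrite coordE dcoordE; case: unlift => [j|]; first exact: df_tvar.
rewrite (linB (@df_linear K n)) df_1 sub0r (lin_sum (@df_linear K n)).
by congr (- _); apply: eq_bigr => j _; rewrite df_tvar.
Qed.

Definition pcoord k n (f : 'I_k.+1 -> 'I_n.+1) (i : 'I_n) : Omega k := pull_coord K f (lift ord0 i).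

Lemma kform_pull_coord k n (f : 'I_k.+1 -> 'I_n.+1) i : is_kform 0 (pull_coord K f i).
Proof. by apply: kform_sum => j _; exact: kform_coord. Qed.

Lemma kform_pcoord k n (f : 'I_k.+1 -> 'I_n.+1) i : is_kform 0 (pcoord f i).
Proof. exact: kform_pull_coord. Qed.

Lemma oexpE n (a : Omega n) k : oexp a k = a ^+ k.
Proof.
elim: k => [|k IH].
  by transitivity (mon (onecm 'I_n, set0) : Omega n); first by rewrite mon.unlock.
by rewrite exprS -IH; transitivity (mulo a (oexp a k)); first by rewrite mulo.unlock.
Qed.

Lemma pullE (V : lmodType K) k n (f : 'I_k.+1 -> 'I_n.+1) (u : gform V n) :
  pull f u = psub (pcoord f) u.
Proof.
rewrite /pull /psub /sub lx.unlock; apply: eq_bigr => c _; congr (tens _ _).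
have oE : @omul K k = *%R by transitivity (@mulo K k); first by rewrite mulo.unlock.
have o1 : oone K k = 1 by rewrite -mon1 mon.unlock.
rewrite /pull_cell oE o1 /sub_cell; congr (_ * _).
  by apply: eq_bigr => i _; rewrite oexpE.
apply: eq_bigr => i _; rewrite (lin_sum (@df_linear K k)).
by apply: eq_bigr => j _; rewrite df_coord.
Qed.

Lemma psub_coord n k (p : 'I_n -> Omega k) (p0 : forall i, is_kform 0 (p i)) i :
  psub p (coord K i) = if unlift ord0 i is Some j then p j else 1 - \sum_(j < n) p j.
Proof.
have pL := @psub_linear n k p K^o.
rewrite coordE; case: unlift => [j|]; first by rewrite psub_tvar.
rewrite (linB pL) psub_1 (lin_sum pL); congr (_ - _).
by apply: eq_bigr => j _; rewrite psub_tvar.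
Qed.

Lemma sum_coord n : \sum_(i < n.+1) coord K i = 1.
Proof. by rewrite coord_sum -mon1 mon.unlock. Qed.

Lemma pull_coordE k n (f : 'I_k.+1 -> 'I_n.+1) i : pull f (coord K i) = pull_coord K f i.
Proof.
rewrite pullE psub_coord; last exact: kform_pcoord.
case: unliftP => [j ->//|->].
(* For the eliminated index 0, the unit is rewritten as the sum of all coordinates of the k-simplex,
   grouped by their images under f; the groups of positive index cancel. *)
rewrite -(sum_coord k) (partition_big f predT) //= big_ord_recl addrK.
by apply: eq_bigl => j.
Qed.

Lemma pull_comp (V : lmodType K) l k n (f : 'I_l.+1 -> 'I_k.+1) (g : 'I_k.+1 -> 'I_n.+1)
    (u : gform V n) :
  pull f (pull g u) = pull (fun i => g (f i)) u.
Proof.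
rewrite !pullE psub_comp; try exact: kform_pcoord.
apply: eq_psub => i; rewrite -pullE /pcoord /pull_coord.
have pL : linear (pull f : Omega k -> Omega l).
  by move=> a x y; rewrite !pullE psub_linear.
rewrite (lin_sum pL) (eq_bigr (fun j => pull_coord K f j)); last first.
  by move=> j _; exact: pull_coordE.
rewrite /pull_coord [RHS](partition_big f (fun j => g j == lift ord0 i)) //=.
apply: eq_bigr => j /eqP gj; apply: eq_bigl => m.
by case: (eqVneq (f m) j) => [->|_]; rewrite ?andbF ?andbT // gj eqxx.
Qed.

Lemma eq_pull (V : lmodType K) k n (f g : 'I_k.+1 -> 'I_n.+1) (u : gform V n) :
  f =1 g -> pull f u = pull g u.
Proof.
move=> fg; rewrite !pullE; apply: eq_psub => i; apply: eq_bigl => j.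
by rewrite fg.
Qed.

Lemma pull_id (V : lmodType K) n (u : gform V n) : pull id u = u.
Proof.
rewrite pullE -[RHS]psub_tvars; apply: eq_psub => i.
rewrite /pcoord /pull_coord (big_pred1 (lift ord0 i)) => [|j]; last by rewrite pred1E.
by rewrite coordE liftK.
Qed.

End Substitution.

(** * Forms on the cylinder *)

Section Cylinder.

Variable K : fieldType.
Hypothesis charK : [pchar K] =i pred0.
Local Notation Omega := (Omega K).

Lemma natK_neq0 k : k.+1%:R != 0 :> K.
Proof. by rewrite ((pcharf0P K).1 charK). Qed.

Section Fixed.

Variable n : nat.

(** Omega_n (x) K[u, du] is taken to be Omega_(n+1), with u the variable of index [ord0]: once t_0
    is eliminated, both are free on the same variables. The brackets on g (x) Omega_(n+1) then serve
    for the cylinder as well. *)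
Definition up_var (i : 'I_n) : Omega n.+1 := tvar (lift ord0 i).
Definition ev_var (e : K) (i : 'I_n.+1) : Omega n :=
  if unlift ord0 i is Some j then tvar j else e *: 1.

Definition up : Omega n -> Omega n.+1 := psub up_var (V := K^o).
Definition ev e : Omega n.+1 -> Omega n := psub (ev_var e) (V := K^o).

Local Notation U := (tvar ord0 : Omega n.+1).
Local Notation dU := (dvar ord0 : Omega n.+1).

Lemma kform_up_var i : is_kform 0 (up_var i). Proof. exact: kform_tvar. Qed.

Lemma kform_ev_var e i : is_kform 0 (ev_var e i).
Proof.
rewrite /ev_var; case: unlift => [j|]; first exact: kform_tvar.
by apply: kformZ; exact: kform1.
Qed.

Lemma up_linear : linear up. Proof. exact: psub_linear. Qed.
Lemma ev_linear e : linear (ev e). Proof. exact: psub_linear. Qed.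

Lemma up_1 : up 1 = 1. Proof. exact: psub_1. Qed.
Lemma ev_1 e : ev e 1 = 1. Proof. exact: psub_1. Qed.

Lemma upM a b : up (a * b) = up a * up b.
Proof. by apply: psubM => //; exact: kform_up_var. Qed.

Lemma evM e a b : ev e (a * b) = ev e a * ev e b.
Proof. by apply: psubM => //; exact: kform_ev_var. Qed.

Lemma up_tvar i : up (tvar i) = tvar (lift ord0 i).
Proof. by apply: psub_tvar; exact: kform_up_var. Qed.

Lemma up_dvar i : up (dvar i) = dvar (lift ord0 i).
Proof.
rewrite /up psub_dvar //; last exact: kform_up_var.
by rewrite /up_var df_tvar.
Qed.

Lemma up_df w : up (df w) = df (up w).
Proof. by apply: psub_df => //; exact: kform_up_var. Qed.

Lemma ev_df e w : ev e (df w) = df (ev e w).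
Proof. by apply: psub_df => //; exact: kform_ev_var. Qed.

Lemma ev_taup l e w : ev e (taup l w) = taup l (ev e w).
Proof. by apply: psub_taup => //; exact: kform_ev_var. Qed.

Lemma ev_U e : ev e U = e *: 1.
Proof.
rewrite /ev psub_tvar; last exact: kform_ev_var.
by rewrite /ev_var unlift_none.
Qed.

Lemma ev_dU e : ev e dU = 0.
Proof. by rewrite -df_tvar ev_df ev_U (linZ (@df_linear K n)) df_1 scaler0. Qed.

Lemma ev_up e a : ev e (up a) = a.
Proof.
rewrite /ev /up psub_comp //; [|exact: kform_up_var|exact: kform_ev_var].
rewrite -[RHS](psub_tvars charK); apply: eq_psub => i.
rewrite /up_var psub_tvar; last exact: kform_ev_var.
by rewrite /ev_var liftK.
Qed.

Lemma cylvarC (b : Omega n.+1) : U * b = b * U. Proof. exact: tvarC. Qed.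

Lemma cylvar_expC k (b : Omega n.+1) : b * U ^+ k = U ^+ k * b.
Proof. by apply/commrX/esym/cylvarC. Qed.

Lemma cyl_ind (P : Omega n.+1 -> Prop) :
  P 0 -> (forall (a : K) u v, P u -> P v -> P (a *: u + v)) ->
  (forall k a, P (U ^+ k * up a)) -> (forall k a, P (U ^+ k * dU * up a)) -> forall w, P w.
Proof.
(* [P] is generalized because each generator split off is absorbed into the predicate. *)
move=> P0 PD PU PdU w; move: P P0 PD PU PdU.
elim/Omega_gen_ind: w => [|a u v IHu IHv||i w IH|i w IH] P P0 PD PU PdU //.
- exact: PD (IHu P P0 PD PU PdU) (IHv P P0 PD PU PdU).
- by have := PU 0 1; rewrite up_1 !mul1r.
- apply: (IH (fun w => P (tvar i * w))) => [|a u v|k a|k a]; first by rewrite mulr0.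
  + by rewrite mulrDr -scalerAr; exact: PD.
  + case: (unliftP ord0 i) => [j ->|->]; last by rewrite mulrA -exprS; exact: PU.
    by rewrite mulrA cylvar_expC -mulrA -up_tvar -upM; exact: PU.
  case: (unliftP ord0 i) => [j ->|->]; last by rewrite !mulrA -exprS; exact: PdU.
  rewrite !mulrA cylvar_expC -(mulrA (U ^+ k)) tvarC mulrA -mulrA -up_tvar -upM.
  exact: PdU.
apply: (IH (fun w => P (dvar i * w))) => [|a u v|k a|k a]; first by rewrite mulr0.
+ by rewrite mulrDr -scalerAr; exact: PD.
+ case: (unliftP ord0 i) => [j ->|->]; last by rewrite mulrA cylvar_expC; exact: PdU.
  by rewrite mulrA cylvar_expC -mulrA -up_dvar -upM; exact: PU.
case: (unliftP ord0 i) => [j ->|->]; last first.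
  by rewrite !mulrA cylvar_expC -(mulrA (U ^+ k)) dvar_sqr mulr0 mul0r.
rewrite !mulrA cylvar_expC -(mulrA (U ^+ k)) dvar_anti mulrN mulNr mulrA -mulrA -up_dvar -upM.
by rewrite -scaleN1r -[_ *: _]addr0; apply: PD.
Qed.

Lemma cyl_linear_eq (W : lmodType K) (F G : Omega n.+1 -> W) : linear F -> linear G ->
  (forall k a, F (U ^+ k * up a) = G (U ^+ k * up a)) ->
  (forall k a, F (U ^+ k * dU * up a) = G (U ^+ k * dU * up a)) -> F =1 G.
Proof.
move=> FL GL FU FdU; elim/cyl_ind => [|a u v IHu IHv|k a|k a] //.
  by rewrite (lin0 FL) (lin0 GL).
by rewrite FL GL IHu IHv.
Qed.

(* Integration from [0] to [u] along the first coordinate [u] of the cylinder. *)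
Definition hint_cell (c : cell n.+1) : Omega n.+1 :=
  if ord0 \in c.2 then
    ((c.1 ord0).+1%:R^-1 : K) *: mon (mulcm (ucm ord0) c.1, c.2 :\ ord0) else 0.

Definition hint : Omega n.+1 -> Omega n.+1 := lx hint_cell.

Lemma hint_linear : linear hint. Proof. exact: lx_linear. Qed.

Lemma hint_mon c : hint (mon c) = hint_cell c. Proof. exact: lx_mon. Qed.

Lemma kform_hint k w : is_kform k w -> is_kform k.-1 (hint w).
Proof.
elim/kform_ind => [|x u v IHu IHv|c ck].
- by rewrite (lin0 hint_linear); exact: kform0.
- by rewrite hint_linear; exact: kform_lin.
rewrite hint_mon /hint_cell; case: ifP => [c0|_]; last exact: kform0.
apply: kformZ; have := @kform_mon K _ (mulcm (ucm ord0) c.1, c.2 :\ ord0).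
by rewrite -ck /= [in X in X.-1](cardsD1 ord0) c0.
Qed.

Lemma kform0_hint w : is_kform 0 w -> hint w = 0.
Proof.
elim/kform_ind => [|x u v IHu IHv|c ck].
- by rewrite (lin0 hint_linear).
- by rewrite hint_linear IHu IHv scaler0 addr0.
rewrite hint_mon /hint_cell; move/eqP: ck; rewrite cards_eq0 => /eqP ->.
by rewrite inE.
Qed.

Lemma hint_tvarM i w : hint (tvar (lift ord0 i) * w) = tvar (lift ord0 i) * hint w.
Proof.
have L1 := lin_comp hint_linear (mul_linearr (tvar (lift ord0 i))).
have L2 := lin_comp (mul_linearr (tvar (lift ord0 i))) hint_linear.
move: w; apply: (Omega_linear_eq L1 L2) => c.
rewrite tvarM !hint_mon /hint_cell /=; case: ifP => _; last by rewrite mulr0.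
rewrite -scalerAr tvarM /= mulcmE cmU /= add0n.
by rewrite mulcmA [mulcm (ucm ord0) (ucm _)]mulcmC -mulcmA.
Qed.

Lemma hint_dvarM i w : hint (dvar (lift ord0 i) * w) = - (dvar (lift ord0 i) * hint w).
Proof.
have L1 := lin_comp hint_linear (mul_linearr (dvar (lift ord0 i))).
have L2 := lin_scale (-1) (lin_comp (mul_linearr (dvar (lift ord0 i))) hint_linear).
rewrite -scaleN1r.
move: w; apply: (Omega_linear_eq L1 L2) => c; rewrite scaleN1r.
rewrite dvarM hint_mon /hint_cell; have [c0|c0] := boolP (ord0 \in c.2); last first.
  rewrite mulr0 oppr0; case: ifP => _; first by rewrite (lin0 hint_linear).
  by rewrite (linZ hint_linear) hint_mon /hint_cell /= !inE (negbTE c0) scaler0.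
rewrite -scalerAr dvarM /= 2!inE /=.
case: ifP => ci; first by rewrite (lin0 hint_linear) scaler0 oppr0.
rewrite (linZ hint_linear) hint_mon /hint_cell /= !inE c0 /=.
rewrite -scalerN -scaleNr !scalerA mulrC; congr (_ *: mon (_, _)); last first.
  by apply/setP => j; rewrite !inE; case: (eqVneq j ord0) => [->|] //=.
(* du has the smallest index, so it makes exactly one inversion with the new factor; removing it
   changes the sorting sign once. *)
congr (_ * _); rewrite /ninv !big_set1 (bigD1 ord0) //= exprS mulN1r.
by congr (- (-1) ^+ _); apply: eq_bigl => j; rewrite !inE andbC.
Qed.

Lemma U_exp k : exists m : 'X_{1..n.+1}, U ^+ k = mon (m, set0) /\
  forall j, m j = if j == ord0 then k else 0%N.
Proof.
elim: k => [|k [m [mE m0]]].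
  by exists (onecm _); split=> // j; rewrite cm1; case: eqP.
exists (mulcm (ucm ord0) m); rewrite exprS mE tvarM; split=> // j.
by rewrite mulcmE cmU m0 eq_sym; case: eqP.
Qed.

Lemma hint_U k a : hint (U ^+ k * up a) = 0.
Proof.
have L1 := lin_comp hint_linear (lin_comp (mul_linearr (U ^+ k)) up_linear).
(* Zero is presented as [0 *: up a], a linear map that satisfies any homogeneous recursion. *)
have L2 := lin_scale (V := Omega n.+1) 0 up_linear.
rewrite -[RHS](scale0r (up a)).
move: a; apply: (Omega_gen_eq (L := fun i w => tvar (lift ord0 i) * w)
  (M := fun i w => - (dvar (lift ord0 i) * w)) L1 L2) => [|i a|i a|i a|i a].
- have [m [-> m0]] := U_exp k.
  by rewrite up_1 mulr1 hint_mon /hint_cell inE scale0r.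
- by rewrite upM up_tvar mulrA -cylvar_expC -mulrA hint_tvarM.
- by rewrite !scale0r mulr0.
- by rewrite upM up_dvar mulrA -cylvar_expC -mulrA hint_dvarM.
- by rewrite !scale0r mulr0 oppr0.
Qed.

Lemma hint_dU k a : hint (U ^+ k * dU * up a) = (k.+1%:R^-1 : K) *: (U ^+ k.+1 * up a).
Proof.
have L1 := lin_comp hint_linear (lin_comp (mul_linearr (U ^+ k * dU)) up_linear).
have L2 := lin_scale (k.+1%:R^-1) (lin_comp (mul_linearr (U ^+ k.+1)) up_linear).
move: a; apply: (Omega_gen_eq (L := fun i w => tvar (lift ord0 i) * w)
  (M := fun i w => dvar (lift ord0 i) * w) L1 L2) => [|i a|i a|i a|i a].
- have [m [mE m0]] := U_exp k; have [m' [m'E m'0]] := U_exp k.+1.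
  rewrite up_1 !mulr1 mE m'E /dvar monM -setI_eq0 set0I eqxx ninv0l scale1r /= set0U.
  rewrite hint_mon /hint_cell /= inE eqxx mulcm0 m0 eqxx.
  congr (_ *: mon (_, _)); last by rewrite setDv.
  apply/eqP/cmP => j; rewrite mulcmE cmU m0 m'0 eq_sym.
  by case: eqP.
- by rewrite upM up_tvar mulrA -[_ * dU * _]tvarC -mulrA hint_tvarM.
- by rewrite upM up_tvar -scalerAr mulrA -cylvar_expC -mulrA.
- rewrite upM up_dvar mulrA -(mulrA (U ^+ k)) dvar_anti mulrN mulNr (linN hint_linear).
  by rewrite mulrA -(cylvar_expC k (dvar (lift ord0 i))) -!mulrA hint_dvarM opprK.
- by rewrite upM up_dvar -scalerAr mulrA -cylvar_expC -mulrA.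
Qed.

Lemma df_U k : df (U ^+ k) = (k%:R : K) *: (U ^+ k.-1 * dU).
Proof.
elim: k => [|k IH]; first by rewrite df_1 scale0r.
rewrite exprS df_tvarM IH -scalerAr mulrA /=.
rewrite (mulrS 1 k) scalerDl scale1r; congr (_ + _); first exact: cylvar_expC.
by case: k {IH} => [|k]; rewrite ?scale0r //= exprS.
Qed.

Lemma df_Uup k a : df (U ^+ k * up a) = (k%:R : K) *: (U ^+ k.-1 * dU * up a) + U ^+ k * up (df a).
Proof.
rewrite dfM df_U -scalerAl -up_df; congr (_ + _ * _).
by elim: k => [|k IH]; rewrite ?taup_1 // exprS taupM IH taup_tvar.
Qed.

Lemma df_UdUup k a : df (U ^+ k * dU * up a) = - (U ^+ k * dU * up (df a)).
Proof.
rewrite dfM [df (_ * dU)]dfM df_U df_dvar mulr0 addr0 -scalerAl -(mulrA _ dU dU) dvar_sqr mulr0.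
rewrite scaler0 mul0r add0r taupM taup1_dvar -up_df mulrN mulNr; congr (- (_ * _ * _)).
by elim: k => [|k IH]; rewrite ?taup_1 // exprS taupM IH taup_tvar.
Qed.

(** The fundamental theorem of calculus in u, checked on u^k a and u^k du a. Only u^0 a has a
    nonzero value at u = 0, and there both terms on the left lose a. *)
Lemma hint_homotopy w : df (hint w) + hint (df w) = w - up (ev 0 w).
Proof.
have dL := @df_linear K n.+1.
have L1 := lin_add (lin_comp dL hint_linear) (lin_comp hint_linear dL).
have L2 := lin_add (@lin_id K (Omega n.+1)) (lin_scale (-1) (lin_comp up_linear (ev_linear 0))).
rewrite -scaleN1r; move: w; apply: (cyl_linear_eq L1 L2) => k a; rewrite scaleN1r.
  rewrite hint_U (lin0 dL) add0r df_Uup (linD hint_linear) hint_U addr0 (linZ hint_linear).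
  rewrite evM ev_up; case: k => [|k].
    by rewrite scale0r !expr0 ev_1 !mul1r subrr.
  rewrite hint_dU scalerA divff ?natK_neq0 // scale1r exprS evM ev_U scale0r !mul0r.
  by rewrite (lin0 up_linear) subr0.
rewrite hint_dU (linZ dL) df_Uup scalerDr scalerA mulVf ?natK_neq0 // scale1r.
rewrite df_UdUup (linN hint_linear) hint_dU addrK.
by rewrite evM [ev 0 (_ * dU)]evM ev_dU mulr0 mul0r (lin0 up_linear) subr0.
Qed.

Lemma ev0_hint w : ev 0 (hint w) = 0.
Proof.
have L1 := lin_comp (ev_linear 0) hint_linear.
have L2 := lin_scale 0 (ev_linear 0).
rewrite -[RHS](scale0r (ev 0 w)).
move: w; apply: (cyl_linear_eq L1 L2) => k a; rewrite scale0r.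
  by rewrite hint_U (lin0 (ev_linear 0)).
by rewrite hint_dU (linZ (ev_linear 0)) evM exprS evM ev_U scale0r !mul0r scaler0.
Qed.

End Fixed.

Section Naturality.

Variables (n k : nat) (p : 'I_n -> Omega k).
Hypothesis p0 : forall i, is_kform 0 (p i).

(** The product of the polynomial map p with the identity of the line. *)
Definition cyl_var (i : 'I_n.+1) : Omega k.+1 :=
  if unlift ord0 i is Some j then up (p j) else tvar ord0.

Lemma kform_cyl_var i : is_kform 0 (cyl_var i).
Proof.
rewrite /cyl_var; case: unlift => [j|]; last exact: kform_tvar.
by apply: kform_psub => //; exact: kform_up_var.
Qed.

Lemma psub_cyl_up a : psub cyl_var (up a) = up (psub p a).
Proof.
rewrite /up !psub_comp //; try exact: kform_up_var; last exact: kform_cyl_var.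
apply: eq_psub => i; rewrite psub_tvar; last exact: kform_cyl_var.
by rewrite /cyl_var liftK.
Qed.

Lemma ev_psub_cyl e a : ev e (psub cyl_var a) = psub p (ev e a).
Proof.
rewrite /ev !psub_comp //; try exact: kform_ev_var; last exact: kform_cyl_var.
apply: eq_psub => i; rewrite /cyl_var /ev_var; case: unlift => [j|].
  by rewrite psub_tvar // -/(ev e _) ev_up.
rewrite (linZ (@psub_linear K n k p K^o)) psub_1 psub_tvar; last exact: kform_ev_var.
by rewrite /ev_var unlift_none.
Qed.

Lemma psub_cyl_U : psub cyl_var (tvar ord0 : Omega n.+1) = tvar ord0.
Proof. by rewrite psub_tvar ?/cyl_var ?unlift_none //; exact: kform_cyl_var. Qed.

Lemma psub_cyl_dU : psub cyl_var (dvar ord0 : Omega n.+1) = dvar ord0.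
Proof.
rewrite psub_dvar //; last exact: kform_cyl_var.
by rewrite /cyl_var unlift_none df_tvar.
Qed.

Lemma psub_cyl_hint a : psub cyl_var (hint a) = hint (psub cyl_var a).
Proof.
have cL := @psub_linear K n.+1 k.+1 cyl_var K^o.
have L1 := lin_comp cL (@hint_linear n).
have L2 := lin_comp (@hint_linear k) cL.
have cM (x y : Omega n.+1) : psub cyl_var (x * y) = psub cyl_var x * psub cyl_var y.
  by apply: psubM => //; exact: kform_cyl_var.
have cX l : psub cyl_var ((tvar ord0 : Omega n.+1) ^+ l) = tvar ord0 ^+ l.
  by elim: l => [|l IH]; rewrite ?psub_1 // !exprS cM IH psub_cyl_U.
move: a; apply: (cyl_linear_eq L1 L2) => l a.
  by rewrite hint_U (lin0 cL) cM cX psub_cyl_up hint_U.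
by rewrite hint_dU (linZ cL) !cM !cX psub_cyl_dU psub_cyl_up hint_dU.
Qed.

End Naturality.

End Cylinder.

(** * Brackets with values in forms *)

Section VectorValued.

Variable K : fieldType.
Local Notation Omega := (Omega K).

(* [id (x) F] on V (x) Omega *)
Definition vx (V : lmodType K) m n (F : Omega m -> Omega n) : gform V m -> gform V n :=
  lx (fun c => F (mon c)).

Lemma vx_linear (V : lmodType K) m n (F : Omega m -> Omega n) : linear (vx F : gform V m -> _).
Proof. exact: lx_linear. Qed.

Lemma vx_tn (V : lmodType K) m n (F : Omega m -> Omega n) (x : V) w :
  linear F -> vx F (tn x w) = tn x (F w).
Proof.
move=> FL; rewrite /vx lx_tn; congr (tn x _).
by move: w; apply: (Omega_linear_eq (@lx_linear K K^o _ _ _) FL) => c; rewrite lx_mon.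
Qed.

Lemma vx_comp (V : lmodType K) l m n (F : Omega m -> Omega n) (G : Omega l -> Omega m)
    (u : gform V l) : linear F -> vx F (vx G u) = vx (fun w => F (G w)) u.
Proof.
move=> FL; rewrite /vx lx_comp; apply: eq_lx => c.
by move: (G _); apply: (Omega_linear_eq (@lx_linear K K^o _ _ _) FL) => c'; rewrite lx_mon.
Qed.

Lemma eq_vx (V : lmodType K) m n (F G : Omega m -> Omega n) (u : gform V m) :
  F =1 G -> vx F u = vx G u.
Proof. by move=> FG; apply: eq_lx => c; rewrite FG. Qed.

Lemma vx_id (V : lmodType K) n (u : gform V n) : vx id u = u.
Proof. exact: lx_id. Qed.

Lemma vx_lin (V : lmodType K) m n a (F G : Omega m -> Omega n) (u : gform V m) :
  vx (fun w => a *: F w + G w) u = a *: vx F u + vx G u.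
Proof.
have L1 := lin_add (lin_scale a (@vx_linear V m n F)) (@vx_linear V m n G).
move: u; apply: (gform_linear_eq (@vx_linear V m n _) L1) => x c.
by rewrite /vx !lx_tn_mon (tn_linearr x).
Qed.

Lemma vxD (V : lmodType K) m n (F G : Omega m -> Omega n) (u : gform V m) :
  vx (fun w => F w + G w) u = vx F u + vx G u.
Proof.
rewrite -[X in X + _]scale1r -vx_lin; apply: eq_vx => w.
by rewrite scale1r.
Qed.

Lemma vxN (V : lmodType K) m n (F : Omega m -> Omega n) (u : gform V m) :
  vx (fun w => - F w) u = - vx F u.
Proof.
have L1 := lin_scale (-1) (@vx_linear V m n F).
rewrite -scaleN1r; move: u; apply: (gform_linear_eq (@vx_linear V m n _) L1) => x c.
by rewrite /vx !lx_tn_mon scaleN1r linearN.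
Qed.

Lemma vxB (V : lmodType K) m n (F G : Omega m -> Omega n) (u : gform V m) :
  vx (fun w => F w - G w) u = vx F u - vx G u.
Proof. by rewrite vxD vxN. Qed.

Lemma vx0 (V : lmodType K) m n (u : gform V m) : vx (fun=> 0 : Omega n) u = 0.
Proof.
have L1 := lin_scale 0 (@vx_linear V m n (fun=> 0)).
rewrite -[RHS](scale0r (vx (fun=> 0) u)); move: u.
apply: (gform_linear_eq (@vx_linear V m n _) L1) => x c.
by rewrite /vx !lx_tn_mon scale0r linear0.
Qed.

Lemma vx_sum (V : lmodType K) m n (I : Type) (r : seq I) (F : I -> Omega m -> Omega n)
    (u : gform V m) :
  vx (fun w => \sum_(i <- r) F i w) u = \sum_(i <- r) vx (F i) u.
Proof.
elim: r => [|i r IH]; first by rewrite big_nil -(vx0 n u); apply: eq_vx => w; rewrite big_nil.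
by rewrite big_cons -IH -vxD; apply: eq_vx => w; rewrite big_cons.
Qed.

Lemma vx_sum_tn (V : lmodType K) m n (F : Omega m -> Omega n) (u : gform V m) :
  vx F u = \sum_(c <- msupp u) tn u@_c (F (mon c)).
Proof.
rewrite [in LHS](gform_tn u) (lin_sum (@vx_linear V m n F)).
by apply: eq_bigr => c _; rewrite /vx lx_tn_mon.
Qed.

End VectorValued.

(** * Sums over words *)

Section Words.

Variables (T : Type) (W : zmodType).

(** A bracket of m copies of one element expands multilinearly into such a sum, with r the support
    of the element. Words are lists so that they can be concatenated and masked. *)
Fixpoint wsum (r : seq T) m (G : seq T -> W) : W :=
  if m is m'.+1 then \sum_(c <- r) wsum r m' (fun cs => G (c :: cs)) else G [::].

Lemma eq_wsum r m (G H : seq T -> W) :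
  (forall cs, size cs = m -> G cs = H cs) -> wsum r m G = wsum r m H.
Proof.
elim: m G H => [|m IH] G H GH /=; first exact: GH.
by apply: eq_bigr => c _; apply: IH => cs ms; apply: GH; rewrite /= ms.
Qed.

Lemma wsum0 r m : wsum r m (fun=> 0) = 0.
Proof. by elim: m => [//|m IH] /=; rewrite big1 // => c _; exact: IH. Qed.

Lemma wsumD r m (G H : seq T -> W) :
  wsum r m (fun cs => G cs + H cs) = wsum r m G + wsum r m H.
Proof.
elim: m G H => [|m IH] G H //=; rewrite -big_split /=.
by apply: eq_bigr => c _; rewrite IH.
Qed.

Lemma wsum_sum r m I (s : seq I) (P : pred I) (G : I -> seq T -> W) :
  wsum r m (fun cs => \sum_(i <- s | P i) G i cs) = \sum_(i <- s | P i) wsum r m (G i).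
Proof.
elim: m G => [|m IH] G //=; rewrite exchange_big /=.
by apply: eq_bigr => c _; rewrite -IH.
Qed.

Lemma wsum_cat r m k (G : seq T -> W) :
  wsum r (m + k) G = wsum r m (fun cs => wsum r k (fun cs' => G (cs ++ cs'))).
Proof.
by elim: m G => [|m IH] G //=; apply: eq_bigr => c _; rewrite -/(addn m k) IH.
Qed.

Lemma wsum_rcons r m (G : seq T -> W) :
  wsum r m.+1 G = wsum r m (fun cs => \sum_(c <- r) G (rcons cs c)).
Proof.
rewrite -addn1 wsum_cat /=; apply: eq_wsum => cs _.
by apply: eq_bigr => c _; rewrite cats1.
Qed.

(** A word amounts to its subword at the positions marked by b together with the complementary one.
    The result depends on b only through the two lengths. *)
Lemma wsum_mask r (b : bitseq) (G : seq T -> seq T -> W) :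
  wsum r (size b) (fun cs => G (mask b cs) (mask (map negb b) cs)) =
  wsum r (count id b) (fun c1 => wsum r (count negb b) (fun c2 => G c1 c2)).
Proof.
elim: b G => [|[] b IH] G //=.
  by apply: eq_bigr => c _; rewrite (IH (fun c1 c2 => G (c :: c1) c2)).
rewrite wsum_sum; apply: eq_bigr => c _.
by rewrite (IH (fun c1 c2 => G c1 (c :: c2))).
Qed.

End Words.

Lemma wsum_linear (K : fieldType) (T : Type) (V W : lmodType K) (F : V -> W) (r : seq T) m G :
  linear F -> F (wsum r m G) = wsum r m (fun cs => F (G cs)).
Proof.
move=> FL; elim: m G => [|m IH] G //=; rewrite (lin_sum FL).
by apply: eq_bigr => c _; rewrite IH.
Qed.

(** * Jacobi and Leibniz identities for equal entries of degree 1 *)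

Section Bracket.

Variables (K : fieldType) (g : Linfty K) (n : nat).
Local Notation Omega := (Omega K n).
Local Notation gf := (gform g n).

(** If w has degree p and c has degree q, the bracket contributes (-1)^(p(1-q)) and moving c in
    front of w contributes (-1)^(pq); together they leave (-1)^p, which is [taup 1]. *)
Definition st (w : Omega) (c : cell n) : Omega := mon c * taup 1 w.

Lemma st_linear c : linear (st^~ c).
Proof. exact: (lin_comp (mul_linearr (mon c)) (@taup_linear K K^o n 1)). Qed.

Lemma foldl_st_linear cs : linear (fun w => foldl st w cs).
Proof.
elim: cs => [|c cs IH] //=; exact: (lin_comp IH (st_linear c)).
Qed.

(* The brackets of g (x) Omega_n, for elements of which all but the first have
   degree 1: since |x| = 1 - |c| for a homogeneous component x (x) c, the sign
   in the definition of [tbrk] depends on the forms only, and it amounts to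
   multiplying the forms in the opposite order, twisted by parities.  The lists
   [xs] and [w] accumulate the arguments already processed. *)
Fixpoint hbx (us : seq gf) (xs : seq g) (w : Omega) : gf :=
  if us is u :: us' then
    \sum_(c <- msupp u) hbx us' (rcons xs u@_c) (st w c)
  else tn (brk xs) w.

Definition hb (us : seq gf) : gf := hbx us [::] 1.

Lemma brk_linear_at r1 r2 : linear (fun x : g => brk (r1 ++ x :: r2)).
Proof. by move=> a x y; rewrite (brk_linear (brkP g)). Qed.

Lemma hbx_linear_w us xs : linear (hbx us xs).
Proof.
elim: us xs => [|u us IH] xs /=; first exact: tn_linearr.
move=> a w v; rewrite scaler_sumr -big_split; apply: eq_bigr => c _ /=.
by rewrite (st_linear c) IH.
Qed.

Lemma hbx_linear_x us xs1 xs2 w : linear (fun x : g => hbx us (xs1 ++ x :: xs2) w).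
Proof.
elim: us xs2 w => [|u us IH] xs2 w /=.
  exact: (lin_comp (tn_linear w) (brk_linear_at xs1 xs2)).
move=> a x y; rewrite scaler_sumr -big_split; apply: eq_bigr => c _ /=.
by rewrite !rcons_cat !rcons_cons IH.
Qed.

Lemma hbx_linear us1 us2 xs w : linear (fun u => hbx (us1 ++ u :: us2) xs w).
Proof.
elim: us1 xs w => [|v us IH] xs w /=; last first.
  move=> a x y; rewrite scaler_sumr -big_split; apply: eq_bigr => c _ /=.
  by rewrite IH.
have BL (c : cell n) : linear (fun x : g => hbx us2 (rcons xs x) (st w c)).
  by move=> a x y; rewrite -!cats1 (hbx_linear_x us2 xs [::]).
exact: (bext_linear BL).
Qed.

Lemma hbx_tn us xs w (x : g) (v : Omega) :
  hbx (tn x v :: us) xs w = hbx us (rcons xs x) (v * taup 1 w).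
Proof.
have L1 := lin_comp (hbx_linear [::] us xs w) (tn_linearr x).
have L2 := lin_comp (hbx_linear_w us (rcons xs x)) (mul_linearl (taup 1 w)).
move: v; apply: (Omega_linear_eq L1 L2) => c /=.
have BL (c' : cell n) : linear (fun x : g => hbx us (rcons xs x) (st w c')).
  by move=> a y z; rewrite -!cats1 (hbx_linear_x us xs [::]).
exact: (bext_tn BL).
Qed.

Lemma hbx_nseq (a : gf) m xs w :
  hbx (nseq m a) xs w = wsum (msupp a) m (fun cs =>
    tn (brk (xs ++ [seq a@_c | c <- cs])) (foldl st w cs)).
Proof.
elim: m xs w => [|m IH] xs w /=; first by rewrite cats0.
apply: eq_bigr => c _; rewrite IH; apply: eq_wsum => cs _.
by rewrite cat_rcons.
Qed.

Lemma hb_tn_nseq (a : gf) m x v :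
  hb (tn x v :: nseq m a) = wsum (msupp a) m (fun cs =>
    tn (brk (x :: [seq a@_c | c <- cs])) (foldl st v cs)).
Proof. by rewrite /hb hbx_tn taup_1 mulr1 hbx_nseq. Qed.

Lemma hb_linear us : linear (fun u => hb (u :: us)).
Proof. exact: (hbx_linear [::] us [::] 1). Qed.

Definition deg1 (c : cell n) : int := 1 - #|c.2|%:Z.

Definition esgn (c c' : cell n) : K := - ksign K (deg1 c * deg1 c').

Lemma esgnE c c' : esgn c c' = (-1) ^+ (#|c.2| * #|c'.2| + #|c.2| + #|c'.2|).
Proof.
rewrite /esgn /deg1; set p := #|c.2|; set q := #|c'.2|.
have N1 : (-1 : K) != 0 by rewrite oppr_eq0 oner_neq0.
have -> : (1 - p%:Z) * (1 - q%:Z) = 1 + (p * q + p + q)%N%:Z + (2 * - (p%:Z + q%:Z)) :> int.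
  by rewrite !PoszD PoszM; ring.
have N2 : (-1 : K) ^ (2%:Z) = 1 by rewrite -exprnP sqrrN expr1n.
rewrite /ksign expfzDr // expfzDr // -exprz_exp N2 exp1rz mulr1 expr1z -exprnP.
by rewrite mulN1r opprK.
Qed.

Lemma st2 w c c' : st (st w c) c' = ((-1) ^+ #|c.2| : K) *: (mon c' * mon c * w).
Proof.
by rewrite /st taupM taupD (taup_even (k := 1 + 1)) // taup_mon mul1n -scalerAl -scalerAr mulrA.
Qed.

(** The same sign [esgn] appears when the coefficients at c and c' are exchanged in a bracket of g
    ([brk_move]). The two cancel, so that brackets of copies of one element of degree 1 are
    symmetric. *)
Lemma st_swap w c c' : st (st w c) c' = esgn c c' *: st (st w c') c.
Proof.
rewrite !st2 (monC c) taup_mon -!scalerAl !scalerA esgnE -!exprD.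
rewrite -signr_odd -[in RHS]signr_odd !oddD.
by case: (odd _); case: (odd _); case: (odd _).
Qed.

Lemma foldl_st_move w r c r' : foldl st w (r ++ c :: r') =
  (\prod_(c' <- r) esgn c' c) *: foldl st w (c :: r ++ r').
Proof.
elim: r w => [|c' r IH] w /=; first by rewrite big_nil scale1r.
rewrite IH /= st_swap (linZ (foldl_st_linear (r ++ r'))) scalerA big_cons.
by rewrite mulrC.
Qed.

(** The sign of the unshuffle with mask b: each cell left out is passed by all the later selected
    ones. *)
Fixpoint msign (b : bitseq) (cs : seq (cell n)) : K :=
  match b, cs with
  | x :: b', c :: cs' =>
      (if x then 1 else \prod_(c' <- mask b' cs') esgn c' c) * msign b' cs'
  | _, _ => 1
  end.

Lemma foldl_st_mask w b cs : size b = size cs ->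
  foldl st w (mask b cs ++ mask (map negb b) cs) = msign b cs *: foldl st w cs.
Proof.
elim: b cs w => [|x b IH] [|c cs] w //=; first by rewrite scale1r.
move=> [bcs]; case: x => /=; first by rewrite mul1r IH.
by rewrite foldl_st_move /= IH // scalerA.
Qed.

Lemma unshuffle_msign m (I : {set 'I_m}) (cs : seq (cell n)) (c0 : cell n) : size cs = m ->
  unshuffle_sign K (fun i : 'I_m => deg1 (nth c0 cs i)) I =
  msign [seq i \in I | i <- enum 'I_m] cs.
Proof.
move=> mcs; pose f (i : 'I_m) := nth c0 cs i.
have {2}<- : map f (enum 'I_m) = cs.
  by rewrite (map_comp (nth c0 cs) val) val_enum_ord map_nth_iota0 -mcs ?take_size.
have eE : index_enum 'I_m = enum 'I_m by rewrite /index_enum [locked_with _ _]unlock -enumT.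
transitivity (\prod_(i <- enum 'I_m | i \in I)
    \prod_(j <- enum 'I_m | (j \notin I) && (j < i)%N) esgn (f i) (f j)).
  rewrite /unshuffle_sign eE; apply: eq_bigr => i _.
  by apply: eq_bigl => j; rewrite inE.
have: sorted (relpre (@nat_of_ord m) ltn) (enum 'I_m).
  by rewrite -sorted_map val_enum_ord iota_ltn_sorted.
have trlt : transitive (relpre (@nat_of_ord m) ltn) by move=> a b d; exact: ltn_trans.
elim: (enum 'I_m) => [|j r IH] /= jr; first by rewrite big_nil.
have /allP jlt := order_path_min trlt jr.
rewrite -IH ?(path_sorted jr) // big_cons; have [jI|jI] /= := boolP (j \in I).
  rewrite mul1r big_cons jI /= big_seq_cond big1 ?mul1r => [|l /andP[lr /andP[_ lj]]].
    by apply: eq_bigr => i _; rewrite big_cons jI.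
  by have /= := jlt _ lr; rewrite ltnNge (ltnW lj).
rewrite -map_mask -filter_mask big_map big_filter -big_split /=.
rewrite big_seq_cond [RHS]big_seq_cond; apply: eq_bigr => i /andP[ir _].
by have /= ji := jlt _ ir; rewrite big_cons jI /= ji.
Qed.

Section DegreeOne.

Variable a : gf.
Hypothesis a1 : forall c, homog (deg1 c) a@_c.

Lemma brk_move r1 r c zs :
  brk (r1 ++ [seq a@_c | c <- r] ++ a@_c :: zs) =
  (\prod_(c' <- r) esgn c' c) *: brk (r1 ++ a@_c :: [seq a@_c | c <- r] ++ zs).
Proof.
elim: r r1 => [|c' r IH] r1 /=; first by rewrite big_nil scale1r.
rewrite -cat_rcons IH cat_rcons big_cons mulrC -scalerA; congr (_ *: _).
have /eqP := brk_antisym (brkP g) r1 ([seq a@_c | c <- r] ++ zs) (a1 c') (a1 c).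
by rewrite addr_eq0 => /eqP ->; rewrite scaleNr.
Qed.

(** Each word in the support of [a] gives the Jacobi identity of g for its coefficients, tensored
    with [foldl st 1 cs], since the unshuffle sign is also the sign of reordering the forms
    ([foldl_st_mask]). By [wsum_mask] all subsets of size k contribute equally, whence the binomial
    coefficient. *)
Lemma hb_jacobi m : (0 < m)%N ->
  \sum_(1 <= k < m.+1) ((-1) ^+ k * 'C(m, k)%:R : K) *:
     hb (hb (nseq k a) :: nseq (m - k) a) = 0.
Proof.
move=> m0; pose c0 : cell n := (onecm _, set0).
pose bI (I : {set 'I_m}) : bitseq := [seq i \in I | i <- enum 'I_m].
have bm I : size (bI I) = m by rewrite size_map size_enum_ord.
pose H c1 c2 : gf := tn (brk (brk [seq a@_c | c <- c1] :: [seq a@_c | c <- c2]))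
     (foldl st 1 (c1 ++ c2)).
pose J k cs := \sum_(I : {set 'I_m} | #|I| == k) H (mask (bI I) cs) (mask (map negb (bI I)) cs).
transitivity (wsum (msupp a) m (fun cs => \sum_(1 <= k < m.+1) ((-1) ^+ k : K) *: J k cs)).
  rewrite wsum_sum; apply: eq_big_nat => k /andP[k0 km].
  have ZL : linear (fun u : gf => ((-1) ^+ k : K) *: u) by exact: (lin_scale _ (@lin_id K gf)).
  rewrite -(wsum_linear (F := fun u : gf => ((-1) ^+ k : K) *: u) (msupp a) m (J k) ZL).
  rewrite -scalerA; congr (_ *: _); rewrite /J wsum_sum.
  rewrite (eq_bigr (fun=> hb (hb (nseq k a) :: nseq (m - k) a))).
    rewrite sumr_const scaler_nat; congr (_ *+ _).
    have -> : 'C(m, k) = #|[set A : {set 'I_m} | #|A| == k]| by rewrite card_draws card_ord.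
    by apply: eq_card => I; rewrite !inE.
  move=> I /eqP Ik.
  have bk : count id (bI I) = k.
    rewrite count_map -Ik cardE -size_filter; congr (size _).
    by rewrite [in RHS]/enum_mem -enumT.
  have bmk : count negb (bI I) = (m - k)%N.
    by rewrite -bk -[X in (X - _)%N](bm I) -(count_predC id) addKn.
  rewrite -{1}(bm I) (wsum_mask _ _ H) bk bmk.
  rewrite /hb (hbx_nseq a k) (wsum_linear _ _ _ (hbx_linear [::] (nseq (m - k) a) [::] 1)).
  apply: eq_wsum => c1 _; rewrite -/(hb _) hb_tn_nseq; apply: eq_wsum => c2 _.
  by rewrite /H foldl_cat.
transitivity (wsum (msupp a) m (fun=> 0 : gf)); last exact: wsum0.
apply: eq_wsum => cs mcs; pose x (i : 'I_m) := a@_(nth c0 cs i).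
have := brk_jacobi (brkP g) m0 (d := fun i => deg1 (nth c0 cs i)) (x := x) (fun i => a1 _).
move=> /(congr1 (fun y => tn y (foldl st 1 cs))).
have tL := tn_linear (V := g) (foldl st 1 cs).
rewrite (lin0 tL) => /(eq_trans _); apply; rewrite (lin_sum tL); apply: eq_bigr => k _.
rewrite (linZ tL) (lin_sum tL) /J; congr (_ *: _); apply: eq_bigr => I _.
rewrite (linZ tL) (unshuffle_msign _ _ mcs) /H (foldl_st_mask _ (etrans (bm I) (esym mcs))).
rewrite linearZ /=.
have xE (A : {set 'I_m}) : [seq x i | i <- enum A] =
    [seq a@_c | c <- mask [seq i \in A | i <- enum 'I_m] cs].
  rewrite -{1}(take_size cs) -(map_nth_iota0 c0 (leqnn _)) mcs -val_enum_ord -map_comp.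
  by rewrite -map_mask -map_comp -filter_mask {1}/enum_mem -enumT.
rewrite !xE; congr (_ *: tn (brk (_ :: [seq _ | c <- mask _ _])) _).
by rewrite -map_comp; apply: eq_map => i /=; rewrite inE.
Qed.

(** On x (x) a of total degree 1, with a of degree p, the term (-1)^|x| x (x) da is - x (x) dt a,
    since |x| = 1 - p. *)
Definition dt (w : Omega) : Omega := df (taup 1 w).

Lemma dt_linear : linear dt.
Proof. exact: (lin_comp (@df_linear K n) (@taup_linear K K^o n 1)). Qed.

Lemma dt_dt w : dt (dt w) = 0.
Proof. by rewrite /dt taup_df (linN (@df_linear K n)) df_df oppr0. Qed.

Lemma kform_dt_mon (c : cell n) : is_kform #|c.2|.+1 (dt (mon c)).
Proof. by rewrite /dt taup_mon; apply/kform_df/kformZ/kform_mon. Qed.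

Lemma dt_st w c : dt (st w c) = dt (mon c) * w - st (dt w) c.
Proof.
rewrite /dt /st taupM !taupD (taup_even (k := 1 + 1)) // dfM taupD (taup_even (k := 1 + 1)) //.
by rewrite taup_df taupD (taup_even (k := 1 + 1)) // mulrN opprK.
Qed.

Lemma kform_foldl_st k v w cs : is_kform k v ->
  v * foldl st w cs = ((-1) ^+ (\sum_(c <- cs) k * #|c.2|.+1) : K) *: foldl st (v * w) cs.
Proof.
move=> vk; elim: cs w => [|c cs IH] w /=; first by rewrite big_nil scale1r.
rewrite IH big_cons addnC exprD -scalerA; congr (_ *: _).
rewrite -(linZ (foldl_st_linear cs)); congr (foldl st _ cs).
rewrite /st taupM (kform_taup 1 vk) mul1n -scalerAl -scalerAr scalerA mulrA.
rewrite (kformC (mon c) vk) taup_mon -!scalerAl mulrA -exprD mulnS; congr (_ *: _).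
rewrite -signr_odd -[RHS]signr_odd !oddD.
by case: (odd k); case: (odd _).
Qed.

(** Each of the m+1 positions contributes the same once the differentiated entry is moved to the
    front; the common sign is (-1)^m. *)
Lemma hb_leibniz m :
  vx dt (hb (nseq m.+1 a)) = ((-1) ^+ m * m.+1%:R : K) *: hb (vx dt a :: nseq m a).
Proof.
(* In [A] the operator dt has still to act on the first k letters, having already passed [es]; in
   [Z] it has hit a letter, which stands at the front. *)
pose A k es := wsum (msupp a) k (fun cs =>
  tn (brk ([seq a@_c | c <- cs] ++ [seq a@_c | c <- es])) (foldl st (dt (foldl st 1 cs)) es)).
pose Z k es := wsum (msupp a) k (fun cs => \sum_(c <- msupp a)
  tn (brk (a@_c :: [seq a@_c | c <- cs ++ es])) (foldl st (dt (mon c)) (cs ++ es))).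
have -> : vx dt (hb (nseq m.+1 a)) = A m.+1 [::].
  rewrite /hb hbx_nseq (wsum_linear _ _ _ (@vx_linear K g n n dt)); apply: eq_wsum => cs _.
  by rewrite (vx_tn _ _ dt_linear) cats0.
have -> : hb (vx dt a :: nseq m a) = Z m [::].
  rewrite vx_sum_tn (lin_sum (hb_linear (nseq m a))) /Z wsum_sum; apply: eq_bigr => c _.
  by rewrite hb_tn_nseq; apply: eq_wsum => cs _; rewrite cats0.
have A0 es : A 0 es = 0.
  by rewrite /A /= /dt taup_1 df_1 (lin0 (foldl_st_linear es)) linear0.
(* By [dt_st], dt either acts on the last letter or passes it with a minus sign. In the first case,
   moving the letter to the front costs -1 for each of the k letters before it, bracket and form
   signs taken together. *)
have AS k es : A k.+1 es = ((-1) ^+ k : K) *: Z k es - \sum_(c <- msupp a) A k (c :: es).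
  have ZL : linear (fun u : gf => ((-1) ^+ k : K) *: u) by exact: (lin_scale _ (@lin_id K gf)).
  rewrite /A wsum_rcons -(wsum_sum (msupp a) k (enum_fset (msupp a)) xpredT).
  rewrite -scaleN1r /Z (wsum_linear _ _ _ ZL) (wsum_linear _ _ _ (lin_scale (-1) (@lin_id K gf))).
  rewrite -wsumD; apply: eq_wsum => cs ks.
  rewrite scaler_sumr scaleN1r -sumrB; apply: eq_bigr => c _.
  rewrite foldl_rcons dt_st (linB (foldl_st_linear es)) linearB /=.
  rewrite map_rcons cat_rcons; congr (_ - _).
  rewrite (brk_move [::]) map_cat foldl_cat (kform_foldl_st _ _ (@kform_dt_mon c)) mulr1.
  rewrite (linZ (foldl_st_linear es)) (linZ (tn_linearr _)) (linZ (tn_linear _)) scalerA.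
  congr (_ *: _); rewrite -ks; elim: cs {ks} => [|c' cs IH]; first by rewrite !big_nil mulr1.
  rewrite !big_cons exprD mulrACA IH esgnE -exprD /= exprS; congr (_ * _).
  rewrite -signr_odd !(oddD, oddM) /=.
  by case: (odd #|c.2|); case: (odd #|c'.2|).
have ZS k es : \sum_(c <- msupp a) Z k (c :: es) = Z k.+1 es.
  rewrite /Z wsum_rcons -(wsum_sum (msupp a) k (enum_fset (msupp a)) xpredT).
  apply: eq_wsum => cs _; apply: eq_bigr => c _; apply: eq_bigr => c' _.
  by rewrite cat_rcons.
elim: m [::] => [|m IH] es.
  by rewrite AS big1 ?subr0 ?mulr1 // => c _; rewrite A0.
rewrite AS (eq_bigr (fun c => ((-1) ^+ m * m.+1%:R : K) *: Z m (c :: es))) => [|c _]; last exact: IH.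
rewrite -scaler_sumr ZS -scalerBl; congr (_ *: _).
by rewrite exprS -mulNr mulN1r -[m.+2]addn1 natrD mulrDr mulr1 addrC mulNr.
Qed.

End DegreeOne.

End Bracket.

Arguments st {K n} w c.
Arguments dt {K n} w.
Arguments hbx {K g n} us xs w.
Arguments hb {K g n} us.

(** * The lower central filtration *)

Section Filtration.

Variables (K : fieldType) (g : Linfty K).

Lemma homog_lin (V : graded K) d (a : K) (x y : V) :
  homog d x -> homog d y -> homog d (a *: x + y).
Proof. by move=> /eqP dx /eqP dy; apply/eqP; rewrite linearP dx dy. Qed.

Lemma homog0 (V : graded K) d : homog d (0 : V).
Proof. by apply/eqP; rewrite linear0. Qed.

(* Iterated brackets of homogeneous elements: [hl i d x] if [x] is one of degree
   [d] in [i] letters.  Their spans [fil i], over at least [i] letters, replace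
   the F^i, which need not be nested. *)
Inductive hl : nat -> int -> g -> Prop :=
| hl_1 d x : homog d x -> hl 1 d x
| hl_brk (ps : seq (nat * int * g)) : (2 <= size ps)%N ->
    (forall p, p \in ps -> hl p.1.1 p.1.2 p.2) ->
    hl (sumn [seq p.1.1 | p <- ps]) (\sum_(d <- [seq p.1.2 | p <- ps]) d + 2 - (size ps)%:Z)
       (brk [seq p.2 | p <- ps]).

Lemma all2_maps (S T U : Type) (r : T -> U -> bool) (f : S -> T) (h : S -> U) s :
  all2 r (map f s) (map h s) = all (fun p => r (f p) (h p)) s.
Proof. by elim: s => [|x s IH] //=; rewrite IH. Qed.

Lemma hl_homog i d x : hl i d x -> homog d x.
Proof.
elim=> {i d x} [//|ps s2 _ IH].
have := brk_degree (brkP g) (ds := [seq p.1.2 | p <- ps]) (xs := [seq p.2 | p <- ps]).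
rewrite size_map; apply; first by case: ps s2 {IH}.
by rewrite all2_maps; apply/allP => p /IH.
Qed.

Lemma hl_gt0 i d x : hl i d x -> (0 < i)%N.
Proof.
elim=> {i d x} [//|[|p ps] //= s2 _ IH].
by rewrite addn_gt0 IH // inE eqxx.
Qed.

Lemma hl_lcs i d x : hl i d x -> lcs i x.
Proof.
elim=> {i d x} [d x _|ps s2 hps IH]; first exact: lcs_1.
apply: lcs_brk; rewrite ?size_map // => p pps.
  rewrite (nth_map (0%N, 0, 0)) //; apply: hl_gt0; apply: hps.
  exact: mem_nth.
by rewrite !(nth_map (0%N, 0, 0)) //; apply/IH/mem_nth.
Qed.

Inductive fil (i : nat) : g -> Prop :=
| fil_0 : fil i 0
| fil_lin (a : K) x y : fil i x -> fil i y -> fil i (a *: x + y)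
| fil_hl j d x : (i <= j)%N -> hl j d x -> fil i x.

Lemma fil_le i j x : (i <= j)%N -> fil j x -> fil i x.
Proof.
move=> ij; elim=> {x} [|a x y _ IHx _ IHy|k d x jk hx]; first exact: fil_0.
  exact: fil_lin.
exact: fil_hl (leq_trans ij jk) hx.
Qed.

Lemma filZ i (a : K) x : fil i x -> fil i (a *: x).
Proof. by move=> ix; rewrite -[_ *: _]addr0; apply: fil_lin => //; exact: fil_0. Qed.

Lemma filD i x y : fil i x -> fil i y -> fil i (x + y).
Proof. by move=> ix iy; rewrite -[x]scale1r; exact: fil_lin. Qed.

Lemma fil_sum i (I : Type) (r : seq I) (P : pred I) (F : I -> g) :
  (forall j, P j -> fil i (F j)) -> fil i (\sum_(j <- r | P j) F j).
Proof.
move=> Fi; elim: r => [|j r IH]; first by rewrite big_nil; exact: fil_0.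
by rewrite big_cons; case: ifP => // Pj; apply: filD => //; exact: Fi.
Qed.

Lemma fil_1 x : fil 1 x.
Proof.
have /andP[u /eqP ->] := xchooseP (gcomp_fin x).
apply: fil_sum => d _; apply: (fil_hl (leqnn 1)); apply: (hl_1 (d := d)).
by rewrite /homog gcomp_comp eqxx eqxx.
Qed.

Lemma fil_brk (ps : seq (nat * g)) : (2 <= size ps)%N ->
  (forall p, p \in ps -> fil p.1 p.2) ->
  fil (sumn [seq p.1 | p <- ps]) (brk [seq p.2 | p <- ps]).
Proof.
move=> s2 hps.
(* The entries are expanded one at a time: those in [qs] are already iterated brackets, those in
   [ps] are still arbitrary. *)
suff: forall qs : seq (nat * int * g), (2 <= size qs + size ps)%N ->
    (forall q, q \in qs -> hl q.1.1 q.1.2 q.2) ->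
    fil (sumn [seq q.1.1 | q <- qs] + sumn [seq p.1 | p <- ps])
      (brk ([seq q.2 | q <- qs] ++ [seq p.2 | p <- ps])).
  by move/(_ [::]); apply.
elim: ps {s2} hps => [|[i x] ps IH] hps qs /=.
  by rewrite addn0 cats0 addn0 => s2 hqs; apply: (fil_hl (leqnn _)); exact: hl_brk.
move=> s2 hqs; have hps' p : p \in ps -> fil p.1 p.2 by move=> pps; apply: hps; rewrite inE pps orbT.
have: fil i x by apply: (hps (i, x)); rewrite inE eqxx.
elim=> {x hps} [|a x y _ IHx _ IHy|j d x ij hx].
- by rewrite (lin0 (brk_linear_at _ _)); exact: fil_0.
- by rewrite (brk_linear_at _ _); exact: fil_lin.
have := IH hps' (rcons qs (j, d, x)).
rewrite size_rcons addSnnS !map_rcons sumn_rcons cat_rcons /=.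
move=> /(_ s2) {}IH; apply: (fil_le _ (IH _)); first by rewrite -addnA leq_add2l leq_add2r.
by move=> q; rewrite mem_rcons inE => /orP[/eqP ->|/hqs].
Qed.

Lemma sumn_enum m (I : {set 'I_m}) (f : 'I_m -> nat) :
  sumn [seq f i | i <- enum I] = \sum_(i in I) f i.
Proof. by rewrite sumnE big_map big_enum. Qed.

(** delta is not among the brackets that build [hl], so the Jacobi identity for the m entries is
    solved for its k = m term, which is delta of their bracket. In every other term the outer
    bracket has at least two entries; the inner one is delta of an entry (k = 1, by induction) or a
    bracket of k >= 2 entries. The number of letters is kept throughout. *)
Lemma fil_delta i x : fil i x -> fil i (brk [:: x]).
Proof.
elim=> {x} [|a x y _ IHx _ IHy|j d x ij hx].
- by rewrite (lin0 (brk_linear_at [::] [::])); exact: fil_0.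
- by rewrite (brk_linear_at [::] [::]); exact: fil_lin.
apply: (fil_le ij) => {i ij}; elim: hx => {j d x} [d x _|ps s2 hps IH]; first exact: fil_1.
pose p0 : nat * int * g := (0%N, 0, 0).
pose m := size ps; pose p (i : 'I_m) := nth p0 ps i.
have pps i : p i \in ps by exact: mem_nth.
have m0 : (0 < m)%N by exact: leq_trans s2.
have psE : [seq p i | i <- enum [set: 'I_m]] = ps.
  have -> : enum [set: 'I_m] = enum 'I_m by apply: eq_enum => i; rewrite inE.
  by rewrite (map_comp (nth p0 ps) val) val_enum_ord map_nth_iota0 ?take_size.
have := brk_jacobi (brkP g) m0 (d := fun i => (p i).1.2) (x := fun i => (p i).2)
  (fun i => hl_homog (hps _ (pps i))).
rewrite big_nat_recr //= (big_pred1 [set: 'I_m]) => [|I]; last first.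
  rewrite /= eqEcard subsetT cardsT card_ord eqn_leq andTb.
  by have := max_card I; rewrite card_ord => ->.
have -> : unshuffle_sign K (fun i => (p i).1.2) [set: 'I_m] = 1.
  rewrite /unshuffle_sign big1 // => i _.
  by rewrite setCT big_pred0 // => k; rewrite inE.
rewrite setCT scale1r enum_set0 /= => /eqP; rewrite addrC addr_eq0 => /eqP.
have -> : [seq (p i).2 | i <- enum [set: 'I_m]] = [seq q.2 | q <- ps].
  by rewrite -[in RHS]psE -map_comp.
move=> /(congr1 (fun y => ((-1) ^+ m : K) *: y)); rewrite scalerA -exprMn mulrNN mulr1 expr1n.
rewrite scale1r => ->; apply: filZ; rewrite -scaleN1r; apply: filZ.
rewrite big_seq_cond; apply: fil_sum => k; rewrite mem_index_iota andbT => /andP[k0 km].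
apply: filZ; apply: fil_sum => I /eqP Ik; apply: filZ.
pose w (J : {set 'I_m}) := sumn [seq (p i).1.1 | i <- enum J].
have wE : (w I + w (~: I))%N = sumn [seq q.1.1 | q <- ps].
  rewrite -[in RHS]psE -map_comp /w !sumn_enum [RHS](bigID [in I]) /=.
  by congr (_ + _)%N; apply: eq_bigl => i; rewrite !inE ?andbT.
have cI : #|~: I| = (m - k)%N by rewrite cardsCs setCK card_ord Ik.
have hI : fil (w I) (brk [seq (p i).2 | i <- enum I]).
  case: (leqP 2 k) => [k2|]; last first.
    move=> k1; have {k1 k0} k1 : k = 1%N by apply/eqP; rewrite eqn_leq k0 -ltnS k1.
    move: Ik; rewrite k1 => /eqP /cards1P[i ->].
    by rewrite /w enum_set1 /= addn0; exact: IH.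
  rewrite /w; have := @hl_brk [seq p i | i <- enum I].
  rewrite size_map -cardE Ik => /(_ k2) hI.
  apply: (@fil_hl _ _ (\sum_(d <- [seq (p i).1.2 | i <- enum I]) d + 2 - k%:Z) _ (leqnn _)).
  have := hI _; rewrite -!map_comp; apply=> q /mapP[i _ ->]; exact: hps.
have := @fil_brk ((w I, brk [seq (p i).2 | i <- enum I]) ::
  [seq ((p i).1.1, (p i).2) | i <- enum (~: I)]).
rewrite /= size_map -cardE cI -!map_comp -wE; apply; first by rewrite ltnS subn_gt0.
move=> q; rewrite inE => /orP[/eqP -> //|/mapP[i _ ->]] /=.
exact: fil_hl (leqnn _) (hps _ (pps i)).
Qed.

Lemma fil_nilpotent N : (forall i, (N <= i)%N -> forall x : g, lcs i x -> x = 0) ->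
  forall i x, (N <= i)%N -> fil i x -> x = 0.
Proof.
move=> hN i x Ni; elim=> {x} [|a x y _ -> _ ->|j d x ij /hl_lcs hx] //.
  by rewrite scaler0 addr0.
exact: hN (leq_trans Ni ij) _ hx.
Qed.

Section Forms.

Variable n : nat.
Local Notation gf := (gform g n).

Definition Fil i (u : gf) := forall c, fil i u@_c.

Lemma Fil_0 i : Fil i 0.
Proof. by move=> c; rewrite mcoeff0; exact: fil_0. Qed.

Lemma Fil_lin i (a : K) u v : Fil i u -> Fil i v -> Fil i (a *: u + v).
Proof. by move=> iu iv c; rewrite mcoeffD gcoeffZ; exact: fil_lin. Qed.

Lemma FilZ i (a : K) u : Fil i u -> Fil i (a *: u).
Proof. by move=> iu; rewrite -[_ *: _]addr0; apply: Fil_lin => //; exact: Fil_0. Qed.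

Lemma FilD i u v : Fil i u -> Fil i v -> Fil i (u + v).
Proof. by move=> iu iv; rewrite -[u]scale1r; exact: Fil_lin. Qed.

Lemma FilN i u : Fil i u -> Fil i (- u).
Proof. by rewrite -scaleN1r; exact: FilZ. Qed.

Lemma Fil_sum i (I : Type) (r : seq I) (P : pred I) (F : I -> gf) :
  (forall j, P j -> Fil i (F j)) -> Fil i (\sum_(j <- r | P j) F j).
Proof.
move=> Fi; elim: r => [|j r IH]; first by rewrite big_nil; exact: Fil_0.
by rewrite big_cons; case: ifP => // Pj; apply: FilD => //; exact: Fi.
Qed.

Lemma Fil_le i j u : (i <= j)%N -> Fil j u -> Fil i u.
Proof. by move=> ij ju c; exact: fil_le (ju c). Qed.

Lemma Fil_1 u : Fil 1 u.
Proof. by move=> c; exact: fil_1. Qed.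

Lemma Fil_tn i x w : fil i x -> Fil i (tn x w).
Proof. by move=> ix c; rewrite tn_coeff; exact: filZ. Qed.

Lemma Fil_hbx (qs : seq (nat * g)) (ps : seq (nat * gf)) w :
  (2 <= size qs + size ps)%N -> (forall q, q \in qs -> fil q.1 q.2) ->
  (forall p, p \in ps -> Fil p.1 p.2) ->
  Fil (sumn [seq q.1 | q <- qs] + sumn [seq p.1 | p <- ps])
    (hbx [seq p.2 | p <- ps] [seq q.2 | q <- qs] w).
Proof.
elim: ps qs w => [|[i u] ps IH] qs w /=.
  by rewrite !addn0 => s2 hqs _; apply: Fil_tn; exact: fil_brk.
move=> s2 hqs hps; apply: Fil_sum => c _.
have := IH (rcons qs (i, u@_c)) (st w c).
rewrite size_rcons addSnnS !map_rcons sumn_rcons /= addnA => /(_ s2); apply.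
  move=> q; rewrite mem_rcons inE => /orP[/eqP ->|/hqs //] /=.
  by apply: (hps (i, u)); rewrite inE eqxx.
by move=> p pps; apply: hps; rewrite inE pps orbT.
Qed.

Lemma Fil_hb (ps : seq (nat * gf)) : (2 <= size ps)%N ->
  (forall p, p \in ps -> Fil p.1 p.2) ->
  Fil (sumn [seq p.1 | p <- ps]) (hb [seq p.2 | p <- ps]).
Proof. by move=> s2; exact: (@Fil_hbx [::]). Qed.

Lemma Fil_delta i u : Fil i u -> Fil i (hb [:: u]).
Proof. by move=> iu; apply: Fil_sum => c _; apply/Fil_tn/fil_delta/iu. Qed.

Lemma Fil_hb_at i r1 u r2 : (0 < size r1 + size r2)%N -> Fil i u ->
  Fil (size r1 + i + size r2) (hb (r1 ++ u :: r2)).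
Proof.
move=> s0 iu; pose f (v : gf) : nat * gf := (1%N, v).
have := @Fil_hb (map f r1 ++ (i, u) :: map f r2).
rewrite size_cat /= !size_map addnS ltnS => /(_ s0).
have E r : sumn [seq p.1 | p <- map f r] = size r.
  by elim: r => [|v r IH] //=; rewrite IH.
have E2 r : [seq p.2 | p <- map f r] = r by elim: r => [|v r IH] //=; rewrite IH.
rewrite !map_cat /= sumn_cat /= !E !E2 addnA; apply=> p.
rewrite mem_cat inE => /or3P[/mapP[v _ ->]|/eqP ->|/mapP[v _ ->]] //=; exact: Fil_1.
Qed.

(** Telescoping, one copy of a being replaced by b at a time: each difference is a bracket with an
    entry a - b and at least one other entry, which adds a letter. This makes the fixed point maps
    below contracting. *)
Lemma Fil_hb_diff i a b l : (2 <= l)%N -> Fil i (a - b) ->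
  Fil i.+1 (hb (nseq l a) - hb (nseq l b)).
Proof.
move=> l2 iab.
suff: forall k j, (2 <= j + k)%N ->
    Fil i.+1 (hb (nseq j b ++ nseq k a) - hb (nseq (j + k) b)) by move/(_ l 0%N l2).
elim=> [|k IH] j jk; first by rewrite addn0 cats0 subrr; exact: Fil_0.
have := IH j.+1; rewrite addSnnS => /(_ jk) {}IH.
rewrite -[X in Fil _ X](subrKA (hb (nseq j.+1 b ++ nseq k a))); apply: FilD => //.
have -> : nseq j.+1 b ++ nseq k a = nseq j b ++ b :: nseq k a.
  by rewrite -addn1 nseqD -catA.
rewrite -(linB (hbx_linear (nseq j b) (nseq k a) [::] 1)).
apply: (Fil_le _ (Fil_hb_at _ iab)); last by move: jk; rewrite !size_nseq addnS ltnS.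
by rewrite !size_nseq addnAC -add1n leq_add2r; move: jk; rewrite addnS ltnS.
Qed.

End Forms.

Lemma Fil_lx m n i (L : cell m -> Omega K n) (u : gform g m) : Fil i u -> Fil i (lx L u).
Proof.
move=> iu; rewrite [u]gform_tn (lin_sum (@lx_linear K g m n L)); apply: Fil_sum => c _.
by rewrite lx_tn_mon; exact/Fil_tn/iu.
Qed.

End Filtration.

Lemma wsum_ind (T : Type) (W : zmodType) (P : W -> Prop) (r : seq T) m (G : seq T -> W) :
  P 0 -> (forall x y, P x -> P y -> P (x + y)) ->
  (forall cs, size cs = m -> P (G cs)) -> P (wsum r m G).
Proof.
move=> P0 PD; elim: m G => [|m IH] G PG /=; first exact: PG.
apply: big_ind => // c _; apply: IH => cs ms; apply: PG; by rewrite /= ms.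
Qed.

(** Regroups nested brackets by l = m + k, the number of copies of a in them; the terms of the
    square beyond the triangle vanish by nilpotency where this is applied. *)
Lemma big_nat_triangle (W : zmodType) B (T : nat -> nat -> W) :
  (forall m k, (B <= m + k)%N -> T m k = 0) ->
  \sum_(0 <= m < B) \sum_(1 <= k < B) T m k =
  \sum_(1 <= l < B) \sum_(1 <= k < l.+1) T (l - k)%N k.
Proof.
move=> T0; rewrite exchange_big /=.
transitivity (\sum_(1 <= k < B) \sum_(1 <= l < B | (k <= l)%N) T (l - k)%N k); last first.
  rewrite (exchange_big_dep_nat xpredT) //=; apply: eq_big_nat => l /andP[l1 lB].
  rewrite (big_cat_nat (n := l.+1)) //= [X in _ + X]big_nat_cond [X in _ + X]big1 ?addr0.
    by rewrite big_nat_cond [RHS]big_nat; apply: eq_bigl => k; rewrite ltnS; case: (k <= l)%N; rewrite ?andbT ?andbF.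
  by move=> k /andP[/andP[lk _]]; rewrite leqNgt lk.
apply: eq_big_nat => k /andP[k1 kB].
rewrite (big_cat_nat (n := (B - k)%N)) ?leq_subr //= [X in _ + X]big_nat_cond.
rewrite [X in _ + X]big1 ?addr0; last first.
  by move=> m /andP[/andP[Bm _] _]; apply: T0; rewrite addnC -leq_subLR.
rewrite [RHS](big_cat_nat (n := k)) //=; last exact: ltnW.
rewrite [X in X + _]big_nat_cond [X in X + _]big1 ?add0r; last first.
  by move=> l /andP[/andP[_ lk]]; rewrite leqNgt lk.
transitivity (\sum_(0 + k <= l < B) T (l - k)%N k).
  by rewrite big_addn; apply: eq_bigr => m _; rewrite addnK.
rewrite add0n [LHS]big_nat_cond [RHS]big_nat_cond; apply: eq_bigl => l.
by case: (k <= l)%N; rewrite ?andbT.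
Qed.

(** * Total degrees and the internal differential *)

Section Degrees.

Variables (K : fieldType) (g : Linfty K).

Definition hom n (d : int) (u : gform g n) : Prop := forall c : cell n, homog (d - #|c.2|%:Z) u@_c.

Lemma hom_tcomp n d (u : gform g n) : homog (V := tgraded g n) d u <-> hom d u.
Proof.
split=> [/eqP du c|du]; first by apply/eqP; rewrite -{2}du; exact/esym/tcompE.
apply/eqP/malgP => c; rewrite [LHS]tcompE; exact/eqP/du.
Qed.

Lemma hom0 n d : hom d (0 : gform g n).
Proof. by move=> c; rewrite mcoeff0; exact: homog0. Qed.

Lemma hom_lin n d (a : K) (u v : gform g n) : hom d u -> hom d v -> hom d (a *: u + v).
Proof. by move=> du dv c; rewrite mcoeffD gcoeffZ; exact: homog_lin. Qed.

Lemma homD n d (u v : gform g n) : hom d u -> hom d v -> hom d (u + v).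
Proof. by move=> du dv; rewrite -[u]scale1r; exact: hom_lin. Qed.

Lemma homZ n d (a : K) (u : gform g n) : hom d u -> hom d (a *: u).
Proof. by move=> du; rewrite -[_ *: _]addr0; apply: hom_lin => //; exact: hom0. Qed.

Lemma hom_sum n d (I : Type) (r : seq I) (P : pred I) (F : I -> gform g n) :
  (forall i, P i -> hom d (F i)) -> hom d (\sum_(i <- r | P i) F i).
Proof. by move=> dF; apply: big_ind => //; [exact: hom0|move=> u v; exact: homD]. Qed.

Lemma hom_tn n d k x (w : Omega K n) : homog (d - k%:Z) x -> is_kform k w -> hom d (tn x w).
Proof.
move=> dx /kformP wk c; rewrite tn_coeff; have [->|ck] := eqVneq #|c.2| k.
  by rewrite -[_ *: x]addr0; apply: homog_lin => //; exact: homog0.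
by rewrite wk // scale0r; exact: homog0.
Qed.

(** The alternative F (mon c) = 0 covers operators of degree -1 on 0-forms, where no natural number
    k fits. *)
Lemma hom_vx m n d e (F : Omega K m -> Omega K n) (u : gform g m) :
  (forall c : cell m, F (mon c) = 0 \/
     exists k, is_kform k (F (mon c)) /\ k%:Z = #|c.2|%:Z + e) ->
  hom d u -> hom (d + e) (vx F u).
Proof.
move=> Fe du; rewrite vx_sum_tn; apply: hom_sum => c _.
have [->|[k [Fk ke]]] := Fe c; first by rewrite linear0; exact: hom0.
apply: (hom_tn _ Fk); rewrite ke.
by have -> : d + e - (#|c.2|%:Z + e) = d - #|c.2|%:Z by ring.
Qed.

Lemma kform_st n k w (c : cell n) : is_kform k w -> is_kform (#|c.2| + k) (st w c : Omega K n).
Proof.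
move=> wk; apply: kformM; first exact: kform_mon.
by rewrite (kform_taup _ wk); exact: kformZ.
Qed.

Lemma kform_foldl n k w (cs : seq (cell n)) : is_kform k w ->
  is_kform (\sum_(c <- cs) #|c.2| + k) (foldl st w cs : Omega K n).
Proof.
elim: cs k w => [|c cs IH] k w wk /=; first by rewrite big_nil.
by rewrite big_cons [(#|_| + _)%N]addnC -addnA; apply: IH; exact: kform_st.
Qed.

Lemma hom_hb_nseq n m (a : gform g n) : (0 < m)%N -> hom 1 a -> hom 2 (hb (nseq m a)).
Proof.
move=> m0 a1; rewrite /hb hbx_nseq; apply: wsum_ind => [|u v|cs ms].
- exact: hom0.
- exact: homD.
apply: (@hom_tn _ _ (\sum_(c <- cs) #|c.2|)%N).
  have := brk_degree (brkP g) (ds := [seq deg1 c | c <- cs]) (xs := [seq a@_c | c <- cs]).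
  rewrite size_map ms => H; have {}H := H _ _.
  suff -> : 2 - (\sum_(c <- cs) #|c.2|)%N%:Z =
      \sum_(d <- [seq deg1 c | c <- cs]) d + 2 - m%:Z :> int.
    apply: H; first by case: cs ms m0 => [|? ?] //= <-.
    by rewrite all2_maps; apply/allP => c _; exact: a1.
  rewrite big_map -ms; elim: cs {ms H} => [|c cs IH]; first by rewrite !big_nil.
  rewrite !big_cons /= -addn1 !PoszD /deg1.
  have -> : \sum_(j <- cs) (1 - #|j.2|%:Z) =
      (size cs)%:Z - (\sum_(j <- cs) #|j.2|)%N%:Z :> int.
    by move: IH; rewrite /deg1 => IH; apply: (addIr (2 - (size cs)%:Z)); rewrite addrA -IH; ring.
  by ring.
have := @kform_foldl n 0 1 cs (@kform1 K n).
by rewrite addn0.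
Qed.

Definition delta n (u : gform g n) : gform g n := hb [:: u].

Lemma delta_linear n : linear (@delta n).
Proof. exact: hb_linear. Qed.

Lemma delta_tn n (x : g) (w : Omega K n) : delta (tn x w) = tn (brk [:: x]) w.
Proof. by rewrite /delta /hb hbx_tn taup_1 mulr1. Qed.

Lemma hom_delta n d (u : gform g n) : hom d u -> hom (d + 1) (delta u).
Proof.
move=> du; rewrite [u]gform_tn (lin_sum (@delta_linear n)); apply: hom_sum => c _.
rewrite delta_tn; apply: (@hom_tn _ _ #|c.2|); last exact: kform_mon.
have := brk_degree (brkP g) (ds := [:: d - #|c.2|%:Z]) (xs := [:: u@_c]) isT.
rewrite /= andbT => /(_ (du c)); rewrite big_seq1.
by have -> : d - #|c.2|%:Z + 2 - 1%:Z = d + 1 - #|c.2|%:Z :> int by ring.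
Qed.

Lemma delta_vx m n (F : Omega K m -> Omega K n) (u : gform g m) : linear F ->
  delta (vx F u) = vx F (delta u).
Proof.
move=> FL; have L1 := lin_comp (@delta_linear n) (@vx_linear K g m n F).
have L2 := lin_comp (@vx_linear K g m n F) (@delta_linear m).
by move: u; apply: (gform_linear_eq L1 L2) => x c; rewrite !(vx_tn _ _ FL, delta_tn).
Qed.

Lemma brk_brk1 (x : g) : brk [:: brk [:: x]] = 0.
Proof.
have L := lin_comp (brk_linear_at [::] [::]) (brk_linear_at (g := g) [::] [::]).
have /andP[u /eqP ->] := xchooseP (gcomp_fin x).
rewrite (lin_sum L) big1 // => d _.
have dx : homog d (gcomp g d x) by rewrite /homog gcomp_comp eqxx eqxx.
have := brk_jacobi (brkP g) (ltnSn 0) (d := fun=> d) (x := fun=> gcomp g d x) (fun=> dx).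
rewrite big_nat1 (big_pred1 [set: 'I_1]) => [|I]; last first.
  rewrite /= eqEcard subsetT cardsT card_ord eqn_leq andTb.
  by have := max_card I; rewrite card_ord => ->.
have -> : unshuffle_sign K (fun=> d) [set: 'I_1] = 1.
  rewrite /unshuffle_sign big1 // => i _.
  by rewrite setCT big_pred0 // => k; rewrite inE.
have -> : enum [set: 'I_1] = [:: ord0].
  have -> : [set: 'I_1] = [set ord0] by apply/setP => i; rewrite !inE (ord1 i) eqxx.
  by rewrite enum_set1.
rewrite setCT enum_set0 /= scale1r expr1 scaleN1r => /eqP.
by rewrite oppr_eq0 => /eqP.
Qed.

Lemma delta_delta n (u : gform g n) : delta (delta u) = 0.
Proof.
have L1 := lin_comp (@delta_linear n) (@delta_linear n).
have L2 := lin_scale 0 (@delta_linear n).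
rewrite -[RHS](scale0r (delta u)); move: u; apply: (gform_linear_eq L1 L2) => x c.
by rewrite !delta_tn brk_brk1 scale0r (lin0 (tn_linear _)).
Qed.

End Degrees.

(** * Curvature and gauge flow *)

Section Curvature.

Variables (K : fieldType) (g : Linfty K) (N : nat).
Hypothesis charK : [pchar K] =i pred0.
Hypothesis gN : forall i, (N <= i)%N -> forall x : g, lcs i x -> x = 0.

Lemma Fil_eq0 n i (u : gform g n) : (N <= i)%N -> Fil i u -> u = 0.
Proof.
move=> Ni iu; apply/malgP => c; rewrite mcoeff0.
exact: (fil_nilpotent gN Ni (iu c)).
Qed.

Lemma natf_neq0 k : (0 < k)%N -> k%:R != 0 :> K.
Proof. by case: k => // k _; exact: natK_neq0. Qed.

Definition vdt n (u : gform g n) : gform g n := vx dt u.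

Lemma vdt_linear n : linear (@vdt n).
Proof. exact: vx_linear. Qed.

(** Brackets of N or more entries vanish, so cutting the sum after N+1 entries loses nothing. *)
Definition brksum n (a : gform g n) : gform g n :=
  \sum_(2 <= l < N.+2) (l`!%:R^-1 : K) *: hb (nseq l a).

Definition curv n (a : gform g n) : gform g n := delta a - vdt a + brksum a.

Lemma Fil_brksum n i (a b : gform g n) : Fil i (a - b) -> Fil i.+1 (brksum a - brksum b).
Proof.
move=> iab; rewrite /brksum -sumrB big_seq_cond; apply: Fil_sum => l.
rewrite mem_index_iota andbT => /andP[l2 _].
by rewrite -scalerBr; apply: FilZ; exact: Fil_hb_diff.
Qed.

Lemma hom_brksum n (a : gform g n) : hom 1 a -> hom 2 (brksum a).
Proof.
move=> a1; rewrite /brksum big_seq_cond; apply: hom_sum => l.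
rewrite mem_index_iota andbT => /andP[l2 _].
by apply/homZ/hom_hb_nseq => //; exact: leq_trans l2.
Qed.

(** The m-th term of the differential twisted by a. The sign is what remains of the (-1)^k of the
    Jacobi identity after multiplication by (-1)^(m+k). *)
Definition brkad n (a : gform g n) m (u : gform g n) : gform g n :=
  ((-1) ^+ m * m`!%:R^-1 : K) *: hb (u :: nseq m a).

Lemma brkad_linear n (a : gform g n) m : linear (brkad a m).
Proof. exact: (lin_scale _ (hb_linear (nseq m a))). Qed.

Lemma Fil_brkad n (a : gform g n) m i u : Fil i u -> Fil (i + m) (brkad a m u).
Proof.
move=> iu; apply: FilZ; case: m => [|m]; first by rewrite addn0; exact: Fil_delta.
have := @Fil_hb_at _ _ _ i [::] u (nseq m.+1 a).
by rewrite /= size_nseq; exact.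
Qed.

Lemma vdt_vdt n (u : gform g n) : vdt (vdt u) = 0.
Proof.
rewrite /vdt vx_comp; last exact: dt_linear.
by rewrite -[RHS](vx0 n u); apply: eq_vx => w; rewrite dt_dt.
Qed.

Lemma delta_vdt n (u : gform g n) : delta (vdt u) = vdt (delta u).
Proof. by apply: delta_vx; exact: dt_linear. Qed.

Lemma delta_vdt_sqr n (u : gform g n) :
  delta (delta u - vdt u) + vdt (delta u - vdt u) = 0.
Proof.
rewrite (linB (@delta_linear K g n)) (linB (@vdt_linear n)) delta_delta vdt_vdt.
by rewrite subr0 sub0r delta_vdt addNr.
Qed.

Lemma delta_vdt_sqr' n (u : gform g n) :
  delta (delta u + vdt u) - vdt (delta u + vdt u) = 0.
Proof.
rewrite (linD (@delta_linear K g n)) (linD (@vdt_linear n)) delta_delta vdt_vdt.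
by rewrite add0r addr0 delta_vdt subrr.
Qed.

Lemma curvE n (a : gform g n) :
  curv a = \sum_(1 <= k < N.+2) (k`!%:R^-1 : K) *: hb (nseq k a) - vdt a.
Proof. by rewrite /curv [in RHS]big_ltn // (_ : 1`! = 1%N) // invr1 scale1r addrAC. Qed.

(** The twisted differential of the curvature is zero. By [hb_leibniz], [vdt (curv a)] is the sum of
    the [brkad a m (vdt a)], and adding [vdt a] to [curv a] leaves only brackets of a; the resulting
    double sum is a Jacobi identity for each total number l of entries. *)
Lemma bianchi n (a : gform g n) : hom 1 a ->
  delta (curv a) + vdt (curv a) = - \sum_(1 <= m < N.+2) brkad a m (curv a).
Proof.
move=> a1; apply/eqP; rewrite -addr_eq0 addrAC; apply/eqP.
have -> : delta (curv a) + \sum_(1 <= m < N.+2) brkad a m (curv a) =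
    \sum_(0 <= m < N.+2) brkad a m (curv a).
  by rewrite [RHS]big_ltn // /brkad fact0 invr1 mulr1 expr0 scale1r.
pose c k := (k`!%:R^-1 : K) *: hb (nseq k a).
have -> : vdt (curv a) = \sum_(0 <= m < N.+2) brkad a m (vdt a).
  rewrite curvE (linB (@vdt_linear n)) vdt_vdt subr0 (lin_sum (@vdt_linear n)).
  (* The Leibniz rule yields the terms m <= N only; the missing one vanishes. *)
  have h0 : brkad a N.+1 (vdt a) = 0.
    apply: (@Fil_eq0 _ (1 + N.+1)); first by rewrite addnC addn1 -addn2 leq_addr.
    by apply: Fil_brkad; exact: Fil_1.
  rewrite [RHS]big_nat_recr //= h0 addr0.
  rewrite big_add1 /=; apply: eq_big_nat => m _.
  rewrite (linZ (@vdt_linear n)) /vdt hb_leibniz; last exact: a1.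
  rewrite scalerA /brkad mulrCA; congr ((_ * _) *: _).
  by rewrite factS natrM invfM mulrAC mulVf ?mul1r // natf_neq0.
rewrite -big_split /=.
rewrite (eq_bigr (fun m => \sum_(1 <= k < N.+2) brkad a m (c k))) => [|m _]; last first.
  by rewrite curvE -(linD (brkad_linear a m)) subrK (lin_sum (brkad_linear a m)).
rewrite (@big_nat_triangle _ N.+2 (fun m k => brkad a m (c k))) => [|m k mk]; last first.
  apply: (@Fil_eq0 _ (k + m)); first by rewrite addnC; apply: leq_trans mk; rewrite -addn2 leq_addr.
  apply: Fil_brkad; apply: FilZ; case: k {mk} => [|[|k]]; [|exact: Fil_1|].
    exact: (Fil_le (leq0n 1) (@Fil_1 _ _ _ _)).
  have := @Fil_hb_at _ _ _ 1 [::] a (nseq k.+1 a); rewrite /= size_nseq add1n.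
  by apply=> //; exact: Fil_1.
rewrite big_nat_cond big1 // => l /andP[/andP[l1 _] _].
(* The factor (-1)^l / l! turns the coefficient (-1)^k binom(l,k) into (-1)^(l-k) / (k! (l-k)!). *)
have := hb_jacobi a1 l1 => /(congr1 (fun u => ((-1) ^+ l * l`!%:R^-1 : K) *: u)).
rewrite scaler0 => /(eq_trans _); apply; rewrite scaler_sumr; apply: eq_big_nat => k /andP[k1 kl].
rewrite /c (linZ (brkad_linear a _)) /brkad !scalerA; congr (_ *: _).
rewrite -(bin_fact (m := k) (n := l)) // !natrM !invfM.
have -> : (-1 : K) ^+ l = (-1) ^+ (l - k) * (-1) ^+ k by rewrite -exprD subnK.
have kk : (-1 : K) ^+ k * (-1) ^+ k = 1 by rewrite -exprMn mulrNN mulr1 expr1n.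
have C0 : 'C(l, k)%:R != 0 :> K by apply: natf_neq0; rewrite bin_gt0.
transitivity (((-1) ^+ (l - k) * k`!%:R^-1 * (l - k)`!%:R^-1) *
   (((-1) ^+ k * (-1) ^+ k) * ('C(l, k)%:R^-1 * 'C(l, k)%:R)) : K); last by ring.
by rewrite kk mulVf // mulr1 mulr1 mulrC mulrAC.
Qed.

Section FixedPoint.

Variables (n : nat) (T : gform g n -> gform g n).
Hypothesis Tcontr : forall i a b, Fil i (a - b) -> Fil i.+1 (T a - T b).

(** After k steps the orbits of any two points agree modulo Fil (k+1). This is applied to the orbits
    of T 0 and of 0, with k = N. *)
Lemma contr_fix : T (iter N T 0) = iter N T 0.
Proof.
suff: forall k a b, Fil k.+1 (iter k T a - iter k T b).
  move/(_ N (T 0) 0); rewrite -iterSr iterS => /(Fil_eq0 (leqnSn N)) /eqP.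
  by rewrite subr_eq0 => /eqP.
by elim=> [|k IH] a b; [exact: Fil_1|rewrite !iterS; apply/Tcontr/IH].
Qed.

Lemma contr_uniq a b : T a = a -> T b = b -> a = b.
Proof.
move=> Ta Tb; apply/eqP; rewrite -subr_eq0; apply/eqP/(@Fil_eq0 _ N) => //.
elim: {1}N => [|k IH]; first exact: (Fil_le (leq0n 1) (@Fil_1 _ _ _ _)).
by rewrite -Ta -Tb; apply/Tcontr/IH.
Qed.

End FixedPoint.

Lemma hb_psub m n (p : 'I_m -> Omega K n) (p0 : forall i, is_kform 0 (p i))
    (us : seq (gform g m)) :
  vx (psub p (V := K^o)) (hb us) = hb [seq vx (psub p (V := K^o)) u | u <- us].
Proof.
pose f := psub p (V := K^o); have fL : linear f by exact: psub_linear.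
suff H : forall (us : seq (gform g m)) (xs : seq g) (w : Omega K m), vx f (hbx us xs w) = hbx [seq vx f u | u <- us] xs (f w).
  by rewrite /hb -/f H /f psub_1.
elim=> [|u us' IH] xs w /=; first by rewrite (vx_tn _ _ fL).
transitivity (hbx (vx f u :: [seq vx f v | v <- us']) xs (f w)); last by [].
rewrite (lin_sum (@vx_linear K g m n f)) vx_sum_tn.
rewrite (lin_sum (hbx_linear [::] [seq vx f v | v <- us'] xs (f w))).
apply: eq_bigr => c _; rewrite IH hbx_tn /st /f psubM // psub_taup //.
Qed.

End Curvature.

Arguments brksum {K g} N {n} a.
Arguments curv {K g} N {n} a.
Arguments vdt {K g n} u.
Arguments brkad {K g n} a m u.

(** * The gauge action *)

Section Flow.

Variables (K : fieldType) (g : Linfty K) (N : nat).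
Hypothesis charK : [pchar K] =i pred0.
Hypothesis gN : forall i, (N <= i)%N -> forall x : g, lcs i x -> x = 0.

Local Notation Omega := (Omega K).
Local Notation psv p := (vx (psub p (V := K^o))).

Section Naturality.

Variables (m n : nat) (p : 'I_m -> Omega n).
Hypothesis p0 : forall i, is_kform 0 (p i).

Lemma brksum_psub (a : gform g m) : psv p (brksum N a) = brksum N (psv p a).
Proof.
have pL := @vx_linear K g m n (psub p (V := K^o)).
rewrite (lin_sum pL); apply: eq_bigr => l _; rewrite (linZ pL); congr (_ *: _).
by rewrite (hb_psub charK p0) map_nseq.
Qed.

Lemma delta_psub (u : gform g m) : psv p (delta u) = delta (psv p u).
Proof. exact: (hb_psub charK p0 [:: u]). Qed.

Lemma vdt_psub (u : gform g m) : psv p (vdt u) = vdt (psv p u).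
Proof.
rewrite /vdt !vx_comp; [|exact: dt_linear|exact: psub_linear].
by apply: eq_vx => w; rewrite /dt psub_df // psub_taup.
Qed.

Lemma curv_psub (a : gform g m) : psv p (curv N a) = curv N (psv p a).
Proof.
have pL := @vx_linear K g m n (psub p (V := K^o)).
by rewrite /curv (linD pL) (linB pL) brksum_psub delta_psub vdt_psub.
Qed.

Lemma hom_psub d (u : gform g m) : hom d u -> hom d (psv p u).
Proof.
move=> du; rewrite -[d]addr0; apply: hom_vx du => c; right; exists #|c.2|; rewrite addr0; split=> //.
by apply: kform_psub => //; exact: kform_mon.
Qed.

Lemma Fil_vx i (F : Omega m -> Omega n) (u : gform g m) : Fil i u -> Fil i (vx F u).
Proof. exact: Fil_lx. Qed.

End Naturality.

(** The differential on elements of even total degree: there (-1)^|x| = (-1)^p on x (x) a with a of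
    degree p. *)
Definition tot n (u : gform g n) : gform g n := delta u + vdt u.

Lemma tot_linear n : linear (@tot n).
Proof. exact: (lin_add (@delta_linear K g n) (@vdt_linear K g n)). Qed.

Lemma hom_vdt n d (u : gform g n) : hom d u -> hom (d + 1) (vdt u).
Proof.
move=> du; apply: hom_vx du => c; right; exists #|c.2|.+1; split.
  exact: kform_dt_mon.
by rewrite -addn1 PoszD.
Qed.

Lemma hom_tot n d (u : gform g n) : hom d u -> hom (d + 1) (tot u).
Proof. by move=> du; apply: homD; [exact: hom_delta|exact: hom_vdt]. Qed.

Lemma Fil_tot n i (u : gform g n) : Fil i u -> Fil i (tot u).
Proof. by move=> iu; apply: FilD; [exact: Fil_delta|exact: Fil_vx]. Qed.

Lemma taup_hint n (w : Omega n.+1) : taup 1 (hint w) = - hint (taup 1 w).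
Proof.
have L1 := lin_comp (@taup_linear K K^o n.+1 1) (@hint_linear K n).
have L2 := lin_scale (-1) (lin_comp (@hint_linear K n) (@taup_linear K K^o n.+1 1)).
rewrite -scaleN1r; move: w; apply: (Omega_linear_eq L1 L2) => c; rewrite scaleN1r.
have := kform_hint (@kform_mon K _ c); rewrite taup_mon mul1n (linZ (@hint_linear K n)).
case E: #|c.2| => [|k] hc.
  have -> : hint (mon c : Omega n.+1) = 0.
    by apply: kform0_hint; rewrite -E; exact: kform_mon.
  by rewrite (lin0 (@taup_linear K K^o n.+1 1)) scaler0 oppr0.
by rewrite (kform_taup _ hc) mul1n /= exprS mulN1r scaleNr opprK.
Qed.

(** The parity makes this a homotopy for [dt] instead of [df]. On elements of degree 2 the operator
    [hcyl] is then minus integration with its Koszul sign, which is why it enters [cylT] with a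
    plus. *)
Definition hsig n (w : Omega n.+1) : Omega n.+1 := taup 1 (hint w).

Lemma hsig_linear n : linear (@hsig n).
Proof. exact: (lin_comp (@taup_linear K K^o n.+1 1) (@hint_linear K n)). Qed.

Lemma hsig_homotopy n (w : Omega n.+1) : dt (hsig w) + hsig (dt w) = w - up (ev 0 w).
Proof.
rewrite -(hint_homotopy charK) /dt /hsig taupD taup_even //; congr (_ + _).
by rewrite taup_hint taup_df taupD taup_even // (linN (@hint_linear K n)) opprK.
Qed.

Definition hcyl n (u : gform g n.+1) : gform g n.+1 := vx (@hsig n) u.

Lemma hcyl_linear n : linear (@hcyl n).
Proof. exact: vx_linear. Qed.

Lemma hcyl_homotopy n (u : gform g n.+1) :
  vdt (hcyl u) + hcyl (vdt u) = u - vx (@up K n) (vx (ev 0) u).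
Proof.
rewrite /vdt /hcyl !vx_comp; [|exact: up_linear|exact: hsig_linear|exact: dt_linear].
rewrite -vxD -{2}(vx_id u) -vxB; apply: eq_vx => w.
exact: hsig_homotopy.
Qed.

Lemma hom_hcyl n d (u : gform g n.+1) : hom d u -> hom (d - 1) (hcyl u).
Proof.
move=> du; apply: hom_vx du => c; rewrite /hsig.
have := kform_hint (@kform_mon K _ c); case E: #|c.2| => [|k] hc.
  left; rewrite (kform0_hint (w := mon c)); last by rewrite -E; exact: kform_mon.
  exact: (lin0 (@taup_linear K K^o n.+1 1)).
right; exists k; split; last by rewrite -addn1 PoszD addrK.
by rewrite (kform_taup _ hc); exact: kformZ.
Qed.

Definition mulU n (w : Omega n) : Omega n.+1 := tvar ord0 * up w.

Lemma mulU_linear n : linear (@mulU n).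
Proof. exact: (lin_comp (mul_linearr (tvar ord0)) (@up_linear K n)). Qed.

Lemma ev_mulU n e (w : Omega n) : ev e (mulU w) = e *: w.
Proof. by rewrite /mulU evM // ev_U ev_up // -scalerAl mul1r. Qed.

Lemma hom_mulU n d (u : gform g n) : hom d u -> hom d (vx (@mulU n) u).
Proof.
move=> du; rewrite -[d]addr0; apply: hom_vx du => c; right; exists #|c.2|; rewrite addr0; split=> //.
rewrite -[#|_|]add0n; apply: kformM; first exact: kform_tvar.
by apply: kform_psub => //; [exact: kform_up_var|exact: kform_mon].
Qed.

(* The path t |-> exp(t lam) . al in MC(g (x) Omega_n), as a Maurer-Cartan element
   of g (x) Omega_(n+1), whose first coordinate is t. *)
Definition cylT n (lam al : gform g n) (a : gform g n.+1) : gform g n.+1 :=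
  vx (@up K n) al + tot (vx (@mulU n) lam) + hcyl (brksum N a).

Definition cyl n (lam al : gform g n) : gform g n.+1 := iter N (cylT lam al) 0.

Lemma cylT_contr n (lam al : gform g n) i a b :
  Fil i (a - b) -> Fil i.+1 (cylT lam al a - cylT lam al b).
Proof.
move=> iab; rewrite /cylT opprD addrACA subrr add0r -(linB (@hcyl_linear n)).
by apply/Fil_vx/Fil_brksum.
Qed.

Lemma cyl_fix n (lam al : gform g n) : cylT lam al (cyl lam al) = cyl lam al.
Proof. exact: (contr_fix gN (@cylT_contr n lam al)). Qed.

Lemma cyl_uniq n (lam al : gform g n) a : cylT lam al a = a -> a = cyl lam al.
Proof. by move=> aT; apply: (contr_uniq gN (@cylT_contr n lam al)) => //; exact: cyl_fix. Qed.

Lemma hom_cyl n (lam al : gform g n) : hom 0 lam -> hom 1 al -> hom 1 (cyl lam al).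
Proof.
move=> lam0 al1; rewrite /cyl; elim: N => [|k IH]; first exact: hom0.
rewrite iterS; apply: homD; first apply: homD.
- by apply: hom_psub => //; exact: kform_up_var.
- by rewrite -[1]add0r; apply/hom_tot/hom_mulU.
- by apply: (@hom_hcyl n 2); exact: hom_brksum.
Qed.

(** Bootstraps from Fil j to Fil (j+1) for j < i: in the fixed point equation the brackets gain a
    step, and the terms linear in lam lie in Fil i. *)
Lemma Fil_cyl n (lam lam' al : gform g n) i : Fil i (lam - lam') ->
  Fil i (cyl lam al - cyl lam' al).
Proof.
move=> ilam; suff H j : (j <= i)%N -> Fil j (cyl lam al - cyl lam' al) by exact: H.
elim: j => [|j IH] ji; first exact: (Fil_le (leq0n 1) (@Fil_1 _ _ _ _)).
rewrite -(cyl_fix lam) -(cyl_fix lam') /cylT opprD addrACA; apply: FilD.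
  rewrite opprD addrACA subrr add0r -(linB (@tot_linear n.+1)) -(linB (@vx_linear K g _ _ _)).
  by apply/Fil_tot/Fil_vx/(Fil_le ji).
rewrite -(linB (@hcyl_linear n)); apply/Fil_vx/Fil_brksum/IH; exact: ltnW.
Qed.

Lemma vx_ev_up n e (u : gform g n) : vx (ev e) (vx (@up K n) u) = u.
Proof.
rewrite vx_comp; last exact: ev_linear.
by rewrite -[RHS]vx_id; apply: eq_vx => w; exact: ev_up.
Qed.

Lemma vx_ev_tot n e (u : gform g n.+1) : vx (ev e) (tot u) = tot (vx (ev e) u).
Proof.
have p0 := @kform_ev_var K n e.
by rewrite /tot (linD (@vx_linear K g _ _ _)) (delta_psub p0) (vdt_psub p0).
Qed.

Lemma vx_ev_mulU n e (u : gform g n) : vx (ev e) (vx (@mulU n) u) = e *: u.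
Proof.
rewrite vx_comp; last exact: ev_linear.
have -> : e *: u = e *: vx id u + vx (fun=> 0) u by rewrite vx0 vx_id addr0.
by rewrite -vx_lin; apply: eq_vx => w; rewrite ev_mulU addr0.
Qed.

Lemma vx_ev0_hcyl n (u : gform g n.+1) : vx (ev 0) (hcyl u) = 0.
Proof.
rewrite vx_comp; last exact: ev_linear.
rewrite -[RHS](vx0 n u); apply: eq_vx => w.
by rewrite /hsig ev_taup // ev0_hint // (lin0 (@taup_linear K K^o n 1)).
Qed.

Lemma ev0_cyl n (lam al : gform g n) : vx (ev 0) (cyl lam al) = al.
Proof.
have eL := @vx_linear K g _ _ (@ev K n 0).
rewrite -cyl_fix /cylT (linD eL (_ + _)) (linD eL (vx _ al)) vx_ev_up vx_ev_tot vx_ev_mulU vx_ev0_hcyl scale0r.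
by rewrite (lin0 (@tot_linear n)) !addr0.
Qed.

Definition mc n (a : gform g n) : Prop := hom 1 a /\ curv N a = 0.

(** The bookkeeping for [mc_cyl]: X comes from [al], with bracket part f; Y is the exact term; H is
    [hcyl Z], for Z the bracket part of the path, and h is [hcyl (vdt Z)]. *)
Lemma curv_sum3 n (X Y H Z f h : gform g n) : delta X - vdt X + f = 0 ->
  delta Y - vdt Y = 0 -> vdt H + h = Z - f ->
  delta (X + Y + H) - vdt (X + Y + H) + Z = delta H + h.
Proof.
move=> dX dY HD.
rewrite !(linD (@delta_linear K g n)) !(linD (@vdt_linear K g n)).
have {dY} -> : delta Y = vdt Y by apply/eqP; rewrite -subr_eq0 dY.
have {dX} -> : delta X = vdt X - f by apply/eqP; rewrite -subr_eq0 opprB addrA addrAC dX.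
move/eqP: HD; rewrite eq_sym subr_eq => /eqP ->.
apply/eqP; rewrite addrAC subr_eq; apply/eqP.
by rewrite [LHS](AC (4 * 3) ((2 * 7) * ((4 * 6) * (1 * 3 * 5)))) /= addNr add0r.
Qed.

Lemma mc_cyl n (lam al : gform g n) : hom 0 lam -> mc al -> mc (cyl lam al).
Proof.
move=> lam0 [al1 al0]; have a1 := hom_cyl lam0 al1; split=> //.
have u0 := @kform_up_var K n.
have bianchi_a := bianchi charK gN a1.
have HD := hcyl_homotopy (brksum N (cyl lam al)).
have dH : delta (hcyl (brksum N (cyl lam al))) = hcyl (delta (brksum N (cyl lam al))).
  by apply: delta_vx; exact: hsig_linear.
have dY := delta_vdt_sqr' (vx (@mulU n) lam).
(* The linear part [delta a - vdt a] is killed by [tot], so the brackets may be replaced by the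
   whole curvature in the equation [cH]. *)
have tC : tot (curv N (cyl lam al)) = tot (brksum N (cyl lam al)).
  have tL := @tot_linear n.+1.
  rewrite /curv (linD tL (_ - _)); have := delta_vdt_sqr (cyl lam al).
  by rewrite -/(tot _) => ->; rewrite add0r.
have cH : curv N (cyl lam al) = hcyl (tot (curv N (cyl lam al))).
  have EF : vx (@up K n) (vx (ev 0) (brksum N (cyl lam al))) = brksum N (vx (@up K n) al).
    by rewrite (brksum_psub (@kform_ev_var K n 0)) ev0_cyl (brksum_psub u0).
  have dX : delta (vx (@up K n) al) - vdt (vx (@up K n) al) + brksum N (vx (@up K n) al) = 0.
    by rewrite -/(curv N _) -(curv_psub u0) al0 (lin0 (@vx_linear K g _ _ _)).
  rewrite EF in HD.
  have E : delta (cylT lam al (cyl lam al)) - vdt (cylT lam al (cyl lam al)) +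
      brksum N (cyl lam al) = _ := curv_sum3 dX dY HD.
  rewrite cyl_fix in E.
  by rewrite [LHS]E tC /tot (linD (@hcyl_linear n)) dH.
(* By [bianchi], [tot] of the curvature consists of brackets of the curvature with at least one more
   entry, so [cH] raises its filtration by one. *)
suff H k : Fil k (curv N (cyl lam al)) by exact: (Fil_eq0 gN (leqnn N) (H N)).
elim: k => [|k IH]; first exact: (Fil_le (leq0n 1) (@Fil_1 _ _ _ _)).
rewrite cH [tot _]bianchi_a; apply/Fil_vx/FilN; rewrite big_seq_cond; apply: Fil_sum => m.
rewrite mem_index_iota andbT => /andP[m1 _].
apply: (Fil_le _ (Fil_brkad _ m IH)).
by rewrite -addn1 leq_add2l.
Qed.

Definition flow n (lam al : gform g n) : gform g n := vx (ev 1) (cyl lam al).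

Lemma flowE n (lam al : gform g n) :
  flow lam al = al + tot lam + vx (ev 1) (hcyl (brksum N (cyl lam al))).
Proof.
have eL := @vx_linear K g _ _ (@ev K n 1).
rewrite /flow -[in LHS]cyl_fix /cylT (linD eL (_ + _)) (linD eL (vx _ al)).
by rewrite vx_ev_up vx_ev_tot vx_ev_mulU scale1r.
Qed.

Lemma mc_psub m n (p : 'I_m -> Omega n) (p0 : forall i, is_kform 0 (p i)) (a : gform g m) :
  mc a -> mc (psv p a).
Proof.
move=> [a1 a0]; split; first exact: hom_psub.
by rewrite -(curv_psub p0) a0 (lin0 (@vx_linear K g _ _ _)).
Qed.

Lemma mc_flow n (lam al : gform g n) : hom 0 lam -> mc al -> mc (flow lam al).
Proof.
by move=> lam0 mal; apply: mc_psub; [exact: kform_ev_var|exact: mc_cyl].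
Qed.

(** The constant path solves the equation: forms pulled back by [up] contain no du and are killed by
    integration along u. *)
Lemma flow0 n (al : gform g n) : flow 0 al = al.
Proof.
rewrite /flow -(cyl_uniq (a := vx (@up K n) al)) ?vx_ev_up //.
rewrite /cylT (lin0 (@vx_linear K g _ _ _)) (lin0 (@tot_linear n.+1)) addr0.
rewrite -[X in _ + X = _](_ : 0 = _) ?addr0 //.
rewrite -(brksum_psub (@kform_up_var K n)) /hcyl vx_comp; last exact: hsig_linear.
rewrite -[LHS](vx0 n.+1 (brksum N al)); apply: eq_vx => w.
rewrite /hsig -/(up w); have := @hint_U K charK n 0 w; rewrite expr0 mul1r => ->.
by rewrite (lin0 (@taup_linear K K^o n.+1 1)).
Qed.

(** By uniqueness: the substitution [cyl_var p], which fixes u and du, commutes with every term of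
    [cylT] and so carries the path for lam and al to the path for their images. *)
Lemma flow_psub m n (p : 'I_m -> Omega n) (p0 : forall i, is_kform 0 (p i))
    (lam al : gform g m) :
  psv p (flow lam al) = flow (psv p lam) (psv p al).
Proof.
have c0 := kform_cyl_var p0.
have cL := @vx_linear K g _ _ (psub (cyl_var p) (V := K^o)).
have -> : flow (psv p lam) (psv p al) = vx (ev 1) (psv (cyl_var p) (cyl lam al)).
  congr (vx _ _); apply/esym/cyl_uniq.
  rewrite -[X in _ = vx _ X]cyl_fix /cylT (linD cL (vx (@up K m) al + tot (vx (@mulU m) lam))).
  rewrite (linD cL (vx (@up K m) al)); apply: (congr2 +%R); first apply: (congr2 +%R).
  - rewrite !vx_comp; [|exact: psub_linear|exact: up_linear].
    by apply: eq_vx => w; rewrite (psub_cyl_up charK p0).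
  - rewrite /tot (linD cL) (delta_psub c0) (vdt_psub c0); congr (delta _ + vdt _).
      rewrite !vx_comp; [|exact: psub_linear|exact: mulU_linear].
      apply: eq_vx => w; rewrite /mulU psubM // (psub_cyl_U p0).
      by rewrite (psub_cyl_up charK p0).
    rewrite !vx_comp; [|exact: psub_linear|exact: mulU_linear].
    apply: eq_vx => w; rewrite /mulU psubM // (psub_cyl_U p0).
    by rewrite (psub_cyl_up charK p0).
  rewrite -(brksum_psub c0) /hcyl !vx_comp; [|exact: psub_linear|exact: hsig_linear].
  by apply: eq_vx => w; rewrite /hsig (psub_taup charK c0) (psub_cyl_hint charK p0).
rewrite /flow !vx_comp; [|exact: ev_linear|exact: psub_linear].
by apply: eq_vx => w; rewrite (ev_psub_cyl charK p0).
Qed.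

End Flow.

(** * Comparison with the Maurer-Cartan equation of the statement *)

Section MaurerCartan.

Variables (K : fieldType) (g : Linfty K) (N : nat).
Hypothesis gN : forall i, (N <= i)%N -> forall x : g, lcs i x -> x = 0.

(** The list [gdegs x] may contain degrees other than d0, and may miss d0 when x = 0; in both cases
    the vanishing of G at 0 settles it. *)
Lemma sum_gdegs (W : zmodType) (V : graded K) (d0 : int) (x : V) (G : int -> V -> W) :
  homog d0 x -> (forall d, G d 0 = 0) ->
  \sum_(d <- gdegs x) G d (gcomp V d x) = G d0 x.
Proof.
move=> /eqP d0x G0; have xE d : gcomp V d x = if d == d0 then x else 0.
  by rewrite -{1}d0x gcomp_comp d0x.
have /andP[ux _] := xchooseP (gcomp_fin x); rewrite -/(gdegs x) in ux.
have [d0in|d0out] := boolP (d0 \in gdegs x).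
  rewrite (bigD1_seq d0) //= xE eqxx big1 ?addr0 // => d dd0.
  by rewrite xE (negbTE dd0).
have x0 : x = 0 by rewrite -d0x gcomp_outdegs.
by rewrite big1 ?x0 // => d _; rewrite linear0.
Qed.

Lemma sum_terms n (W : zmodType) (u : gform g n) (G : int * g * cell n -> W) : hom 1 u ->
  (forall d c, G (d, 0, c) = 0) ->
  \sum_(p <- terms u) G p = \sum_(c <- msupp u) G (deg1 c, u@_c, c).
Proof.
move=> u1 G0; rewrite /terms big_allpairs_dep /=; apply: eq_bigr => c _.
by rewrite (sum_gdegs (G := fun d x => G (d, x, c)) (u1 c)).
Qed.

Lemma sum_choices n (W : zmodType) (u : gform g n) m (G : seq (int * g * cell n) -> W) :
  hom 1 u -> (forall r1 d c r2, G (r1 ++ (d, 0, c) :: r2) = 0) ->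
  \sum_(p <- choices (nseq m (terms u))) G p =
  wsum (msupp u) m (fun cs => G [seq (deg1 c, u@_c, c) | c <- cs]).
Proof.
move=> u1; elim: m G => [|m IH] G G0 /=; first by rewrite big_seq1.
rewrite big_allpairs_dep /= (sum_terms (G := fun p => \sum_(q <- choices _) G (p :: q))) //=.
  by apply: eq_bigr => c _; rewrite IH // => r1 d c' r2; exact: (G0 (_ :: r1)).
by move=> d c; rewrite big1 // => q _; exact: (G0 [::]).
Qed.

Lemma exchange_rcons n (p : seq (int * g * cell n)) q :
  exchange_sign (rcons p q) =
  exchange_sign p * ksign K (\sum_(i < size p) [seq (cdeg r.2)%:Z | r <- p]`_i * q.1.1).
Proof.
have N1 : (-1 : K) != 0 by rewrite oppr_eq0 oner_neq0.
rewrite /exchange_sign /ksign -expfzDr // size_rcons big_ord_recr /= !map_rcons.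
congr (_ ^ (_ + _)).
  apply: eq_bigr => j _; rewrite big_mkcond big_ord_recr /= ltnNge (ltnW (ltn_ord j)) addr0.
  rewrite -big_mkcond; apply: eq_bigr => i _.
  by rewrite !nth_rcons !size_map !ltn_ord.
rewrite big_mkcond big_ord_recr /= ltnn addr0; apply: eq_bigr => i _.
by rewrite ltn_ord !nth_rcons !size_map ltn_ord ltnn eqxx.
Qed.

Lemma ksign_deg1 n k (c : cell n) : ksign K (k%:Z * deg1 c) = (-1) ^+ (k * #|c.2|.+1).
Proof.
have N1 : (-1 : K) != 0 by rewrite oppr_eq0 oner_neq0.
have N2 : (-1 : K) ^ (2%:Z) = 1 by rewrite -exprnP sqrrN expr1n.
rewrite /deg1 (_ : k%:Z * _ = (k * #|c.2|.+1)%N%:Z + 2 * - (k * #|c.2|)%N%:Z).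
  by rewrite /ksign expfzDr // -exprz_exp N2 exp1rz mulr1 -exprnP.
by rewrite -addn1 !PoszM PoszD; ring.
Qed.

Lemma exchange_foldl n (u : gform g n) (cs : seq (cell n)) :
  (exchange_sign [seq (deg1 c, u@_c, c) | c <- cs] : K) *: \prod_(c <- cs) mon c =
  foldl st 1 cs.
Proof.
elim/last_ind: cs => [|cs c IH].
  by rewrite /exchange_sign /= big_ord0 /ksign expr0z scale1r big_nil.
have Pk : is_kform (\sum_(c <- cs) #|c.2|) (\prod_(c <- cs) mon c : Omega K n).
  by elim: (cs) => [|c' r IHr]; [rewrite !big_nil; exact: kform1|
    rewrite !big_cons; apply: kformM => //; exact: kform_mon].
rewrite map_rcons exchange_rcons foldl_rcons -IH /= -cats1 big_cat big_seq1 /=.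
rewrite /st (linZ (@taup_linear K K^o n 1)) (kform_taup _ Pk) scalerA -scalerAr monC.
rewrite (kform_taup _ Pk) -scalerAl !scalerA -mulrA; congr (_ * _ *: _).
rewrite -mulr_suml size_map.
have -> : \sum_(i < size cs) [seq (cdeg r.2)%:Z | r <- [seq (deg1 c, u@_c, c) | c <- cs]]`_i =
    (\sum_(c <- cs) #|c.2|)%N%:Z.
  rewrite -map_comp (big_morph Posz PoszD (erefl _)) (big_nth (onecm _, set0)) big_mkord.
  by apply: eq_bigr => i _; rewrite (nth_map (onecm _, set0)).
by rewrite ksign_deg1 mul1n mulnS exprD [(#|_| * _)%N]mulnC.
Qed.

Lemma tbrk_hb n (u : gform g n) m : hom 1 u -> tbrk (nseq m.+2 u) = hb (nseq m.+2 u).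
Proof.
move=> u1; pose G (p : seq (int * g * cell n)) : gform g n := (exchange_sign p : K) *:
  tn (brk [seq q.1.2 | q <- p]) (\prod_(q <- p) mon q.2).
transitivity (\sum_(p <- choices (nseq m.+2 (terms u))) G p).
  rewrite -map_nseq; apply: eq_bigr => p _; congr (_ *: _); rewrite tn.unlock; congr (tens _ _).
  have oE : @omul K n = *%R by transitivity (@mulo K n); first by rewrite mulo.unlock.
  have o1 : oone K n = 1 by rewrite -mon1 mon.unlock.
  by rewrite oE o1 mon.unlock.
rewrite (sum_choices _ u1) => [|r1 d c r2].
  rewrite /hb hbx_nseq; apply: eq_wsum => cs _.
  by rewrite /G -map_comp big_map -(linZ (tn_linearr _)) (exchange_foldl u).
by rewrite /G map_cat /= (lin0 (brk_linear_at _ _)) (lin0 (tn_linear _)) scaler0.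
Qed.

Lemma tbrk1 n (u : gform g n) : hom 1 u -> tbrk [:: u] = delta u - vdt u.
Proof.
move=> u1; pose G (p : int * g * cell n) : gform g n :=
  tn (brk [:: p.1.2]) (mon p.2) + ksign K p.1.1 *: tn p.1.2 (df (mon p.2)).
transitivity (\sum_(p <- terms u) G p).
  have tnE (x : g) w : tens x w = tn x w by rewrite tn.unlock.
  have monE (c : cell n) : mono K c = mon c by rewrite mon.unlock.
  have dE (c : cell n) : dcell K c = df (mon c).
    rewrite -dformE; transitivity (lx (@dcell K n) (mon c)); first by rewrite lx_mon.
    by rewrite lx.unlock.
  by apply: eq_bigr => p _; rewrite monE dE (tnE n (brk [:: p.1.2])) (tnE n p.1.2).
rewrite sum_terms // => [|d c]; last first.
  by rewrite /G /= (lin0 (brk_linear_at [::] [::])) !(lin0 (tn_linear _)) scaler0 addr0.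
rewrite /G big_split /=; congr (_ + _).
  rewrite [in RHS](gform_tn u) (lin_sum (@delta_linear K g n)).
  by apply: eq_bigr => c _; rewrite delta_tn.
rewrite /vdt vx_sum_tn -sumrN; apply: eq_bigr => c _.
have := @ksign_deg1 n 1 c; rewrite mul1r mul1n => ->.
rewrite /dt taup_mon mul1n (linZ (@df_linear K n)) (linZ (tn_linearr _)) -scaleNr.
by rewrite exprS mulN1r.
Qed.

(** All partial sums beyond N entries equal [curv N u], so the bound left existential in [is_MC] can
    be compared with N at a single common M. *)
Lemma MC_simplexP n (u : gform g n) : MC_simplex u <-> mc N u.
Proof.
have E M : hom 1 u -> (N < M)%N ->
    \sum_(1 <= l < M.+1) (l`!%:R^-1 : K) *: tbrk (nseq l u) = curv N u.
  move=> u1 NM; rewrite big_ltn ?ltnS; last exact: leq_ltn_trans NM.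
  rewrite (tbrk1 u1) (_ : 1`! = 1%N) // invr1 scale1r; congr (_ + _).
  rewrite (big_cat_nat (n := N.+2)) //= [X in _ + X]big_nat_cond [X in _ + X]big1 ?addr0.
    by apply: eq_big_nat => -[|[|l]] // _; rewrite tbrk_hb.
  move=> [|[|l]] /andP[/andP[Nl _] _] //; rewrite tbrk_hb //.
  suff -> : hb (nseq l.+2 u) = 0 by rewrite scaler0.
  apply: (Fil_eq0 gN (i := (1 + l.+1)%N)); first by rewrite (leq_trans _ Nl) // -addn2 leq_addr.
  have := @Fil_hb_at _ _ _ 1 [::] u (nseq l.+1 u); rewrite /= size_nseq.
  by apply=> //; exact: Fil_1.
split=> [[/hom_tcomp u1 [M HM]]|[u1 u0]].
  split=> //; rewrite -(E (maxn M N.+1)) ?leq_maxr //.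
  exact: HM (leq_maxl _ _).
split; first exact/hom_tcomp.
by exists N.+1 => M NM; rewrite [LHS]E.
Qed.

End MaurerCartan.

(** * The retraction onto gamma *)

Section Gauge.

Variables (K : fieldType) (g : Linfty K) (N : nat).
Hypothesis charK : [pchar K] =i pred0.
Hypothesis gN : forall i, (N <= i)%N -> forall x : g, lcs i x -> x = 0.

Variable s : forall n : nat, {linear Omega K n -> Omega K n}.
Hypothesis s_gauge : is_gauge s.

Let sL n : linear (s n). Proof. by move=> a u v; exact: linearP. Qed.
Let sC : is_contraction s := s_gauge.1.
Let ss n (a : Omega K n) : s n (s n a) = 0 := s_gauge.2 n a.

Lemma s_mon n (c : cell n) :
  s n (mon c) = 0 \/ exists2 k, #|c.2| = k.+1 & is_kform k (s n (mon c)).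
Proof.
have := @kform_mon K n c; case: #|c.2| => [|k] ck.
  by left; exact: (contraction_deg0 sC).
by right; exists k => //; exact: (contraction_deg sC).
Qed.

Lemma integral_s k (b : Omega K k) : integral (s k b) = 0.
Proof.
suff H : forall c : cell k, c.2 == [set: 'I_k] -> (s k b)@_c = 0.
  rewrite /integral big1 // => c /H h0.
  by rewrite (_ : ((s k b)@_c : K) = 0) ?mul0r.
elim/Omega_ind: b => [|a u v IHu IHv|c] c' cT.
- by rewrite linear0 mcoeff0.
- by rewrite linearP mcoeffD gcoeffZ IHu // IHv // scaler0 addr0.
case: (s_mon c) => [->|[j cj /kformP sj]]; first by rewrite mcoeff0.
apply: sj; rewrite (eqP cT) cardsT card_ord.
have := max_card c.2; rewrite card_ord cj => jk.
by rewrite neq_ltn jk orbT.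
Qed.

(** Since s commutes with restriction to faces, the integral of s a over a k-face is that of s of a
    form on the k-simplex, which has no component of degree k. *)
Lemma Pform_s n (a : Omega K n) : Pform (s n a) = 0.
Proof.
rewrite /Pform big1 // => k _; rewrite big1 // => f /forallP fI.
rewrite /Iint -(contraction_simplicial sC) ?integral_s ?scale0r // => p q.
rewrite leq_eqVlt => /predU1P[/val_inj -> //|pq].
by move/forallP: (fI p) => /(_ q); rewrite pq => /ltnW.
Qed.

Lemma s_df_s n (a : Omega K n) : s n (df (s n a)) = s n a.
Proof.
have := contraction_homotopy sC (s n a).
rewrite Pform_s subr0 ss !dformE (lin0 (@df_linear K n)) add0r.
exact: esym.
Qed.

Lemma taup_s n (w : Omega K n) : taup 1 (s n w) = - s n (taup 1 w).
Proof.
have tL := @taup_linear K K^o n 1.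
have L1 := lin_comp tL (@sL n).
have L2 := lin_scale (-1) (lin_comp (@sL n) tL).
rewrite -scaleN1r; move: w; apply: (Omega_linear_eq L1 L2) => c; rewrite scaleN1r.
rewrite taup_mon mul1n (linZ (@sL n)).
case: (s_mon c) => [->|[k ck sk]]; first by rewrite (lin0 tL) scaler0 oppr0.
by rewrite (kform_taup _ sk) mul1n ck exprS mulN1r scaleNr opprK.
Qed.

(* The sign (-1)^(p-1) makes [id (x) s] anticommute with the internal part
   [delta] of the differential. *)
Definition ssig n (w : Omega K n) : Omega K n := taup 1 (s n w).

Lemma ssig_linear n : linear (@ssig n).
Proof. exact: (lin_comp (@taup_linear K K^o n 1) (@sL n)). Qed.

Lemma ssig_dt_ssig n (w : Omega K n) : ssig (dt (ssig w)) = ssig w.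
Proof. by rewrite /ssig /dt taupD (taup_even (k := 1 + 1)) // s_df_s. Qed.

Lemma ssig_ssig n (w : Omega K n) : ssig (ssig w) = 0.
Proof.
by rewrite /ssig taup_s taupD (taup_even (k := 1 + 1)) // ss oppr0.
Qed.

Definition sgauge n (u : gform g n) : gform g n := vx (@ssig n) u.

Lemma sgauge_linear n : linear (@sgauge n).
Proof. exact: vx_linear. Qed.

Lemma sgauge_eq0 n (u : gform g n) : vx (s n) u = 0 <-> sgauge u = 0.
Proof.
have tL := @taup_linear K K^o n 1.
have E : sgauge u = vx (taup 1) (vx (s n) u) by rewrite vx_comp.
split=> [u0|]; first by rewrite E u0 (lin0 (@vx_linear K g _ _ _)).
rewrite E => /(congr1 (vx (taup 1 : Omega K n -> Omega K n))).
rewrite (lin0 (@vx_linear K g _ _ _)) vx_comp //.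
by rewrite (eq_vx (G := id)) ?vx_id // => w; rewrite taupD (taup_even (k := 1 + 1)).
Qed.

Lemma sgauge_vdt_sgauge n (u : gform g n) : sgauge (vdt (sgauge u)) = sgauge u.
Proof.
rewrite /sgauge /vdt vx_comp; last exact: ssig_linear.
rewrite vx_comp; last exact: (lin_comp (@ssig_linear n) (@dt_linear K n)).
by apply: eq_vx => w; exact: ssig_dt_ssig.
Qed.

Lemma sgauge_sgauge n (u : gform g n) : sgauge (sgauge u) = 0.
Proof.
rewrite /sgauge vx_comp; last exact: ssig_linear.
by rewrite -[RHS](vx0 n u); apply: eq_vx => w; exact: ssig_ssig.
Qed.

Lemma delta_sgauge n (u : gform g n) : delta (sgauge u) = sgauge (delta u).
Proof. by apply: delta_vx; exact: ssig_linear. Qed.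

(** s d s = s settles the [vdt] part; the [delta] part disappears since [sgauge] commutes with
    [delta] and has square zero. Thus the linear term [tot lam] of the flow contributes exactly lam
    to [sgauge]. *)
Lemma sgauge_tot_sgauge n (u : gform g n) : sgauge (tot (sgauge u)) = sgauge u.
Proof.
rewrite /tot (linD (@sgauge_linear n)) sgauge_vdt_sgauge -delta_sgauge sgauge_sgauge.
by rewrite (lin0 (@delta_linear K g n)) add0r.
Qed.

Lemma hom_sgauge n d (u : gform g n) : hom d u -> hom (d - 1) (sgauge u).
Proof.
move=> du; apply: hom_vx du => c; rewrite /ssig; case: (s_mon c) => [->|[k ck sk]].
  by left; exact: (lin0 (@taup_linear K K^o n 1)).
right; exists k; split; last by rewrite ck -addn1 PoszD addrK.
by rewrite (kform_taup _ sk); exact: kformZ.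
Qed.

Section Pull.

Variables (k n : nat) (f : 'I_k.+1 -> 'I_n.+1).

Lemma pull_vx (V : lmodType K) (u : gform V n) : pull f u = vx (psub (pcoord K f) (V := K^o)) u.
Proof.
rewrite pullE; apply: eq_lx => c.
by rewrite /psub /sub lx_mon.
Qed.

Lemma pull_linear (V : lmodType K) : linear (pull f : gform V n -> gform V k).
Proof. by move=> a u v; rewrite !pull_vx (@vx_linear K V). Qed.

Lemma pull_flow (lam al : gform g n) : pull f (flow N lam al) = flow N (pull f lam) (pull f al).
Proof. by rewrite !pull_vx; apply: flow_psub => //; exact: kform_pcoord. Qed.

Lemma mc_pull (a : gform g n) : mc N a -> mc N (pull f a).
Proof. by rewrite pull_vx; apply: mc_psub => //; exact: kform_pcoord. Qed.

Lemma hom_pull d (u : gform g n) : hom d u -> hom d (pull f u).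
Proof. by rewrite pull_vx; apply: hom_psub => //; exact: kform_pcoord. Qed.

Hypothesis f_mono : nondecreasing f.

Lemma sgauge_pull (u : gform g n) : sgauge (pull f u) = pull f (sgauge u).
Proof.
rewrite !pull_vx /sgauge !vx_comp; [|exact: psub_linear|exact: ssig_linear].
apply: eq_vx => w; rewrite /ssig psub_taup //; last exact: kform_pcoord.
by rewrite -!pullE (contraction_simplicial sC).
Qed.

End Pull.

(* Since [s d s = s], the fixed points of [gauge_step al] are the [lam] in the image of
   [s] for which [s] vanishes on [flow N lam al]. *)
Definition gauge_step n (al lam : gform g n) : gform g n :=
  - sgauge (al + vx (ev 1) (hcyl (brksum N (cyl N lam al)))).

Definition lam n (al : gform g n) : gform g n := iter N (gauge_step al) 0.

Lemma gauge_step_contr n (al : gform g n) i a b :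
  Fil i (a - b) -> Fil i.+1 (gauge_step al a - gauge_step al b).
Proof.
move=> iab; rewrite /gauge_step -opprD -(linN (@sgauge_linear n)) -(linD (@sgauge_linear n)).
rewrite -(linN (@sgauge_linear n)); apply: Fil_vx; apply: FilN.
rewrite opprD addrACA subrr add0r -(linB (@vx_linear K g _ _ _)) -(linB (@hcyl_linear K g n)).
by apply/Fil_vx/Fil_vx/Fil_brksum/Fil_cyl.
Qed.

Lemma gauge_fix n (al : gform g n) : gauge_step al (lam al) = lam al.
Proof. exact: (contr_fix gN (@gauge_step_contr n al)). Qed.

Lemma lam_uniq n (al a : gform g n) : gauge_step al a = a -> a = lam al.
Proof. by move=> aT; apply: (contr_uniq gN (@gauge_step_contr n al)) => //; exact: gauge_fix. Qed.

Lemma lam_sgauge n (al : gform g n) : exists u, lam al = sgauge u.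
Proof. by eexists; rewrite -gauge_fix /gauge_step -(linN (@sgauge_linear n)). Qed.

(** Expresses the higher terms of the flow through [flow] itself, whose naturality and value at lam
    = 0 are known. *)
Lemma flow_rest n (lam al : gform g n) :
  vx (ev 1) (hcyl (brksum N (cyl N lam al))) = flow N lam al - al - tot lam.
Proof. by rewrite (flowE charK gN) -[RHS]addrA -opprD [RHS]addrAC subrr add0r. Qed.

(** By uniqueness: the pulled back parameter solves the equation of [pull f al], because s commutes
    with simplicial operators and the flow with pullbacks. *)
Lemma lam_pull k n (f : 'I_k.+1 -> 'I_n.+1) (al : gform g n) : nondecreasing f ->
  lam (pull f al) = pull f (lam al).
Proof.
move=> f_mono; apply/esym/lam_uniq.
have p0 := @kform_pcoord K k n f.
rewrite -[in RHS]gauge_fix /gauge_step (linN (pull_linear f (V := g))) -sgauge_pull //; congr (- sgauge _).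
rewrite (linD (pull_linear f (V := g))) !flow_rest.
rewrite !(linB (pull_linear f (V := g))) pull_flow /tot (linD (pull_linear f (V := g))).
by rewrite !pull_vx (delta_psub charK p0) (vdt_psub charK p0).
Qed.

Lemma lam_eq0 n (al : gform g n) : sgauge al = 0 -> lam al = 0.
Proof.
move=> al0; apply/esym/lam_uniq; rewrite /gauge_step flow_rest flow0 // subrr sub0r.
by rewrite (lin0 (@tot_linear K g n)) subr0 al0 oppr0.
Qed.

Lemma hom_lam n (al : gform g n) : hom 1 al -> hom 0 (lam al).
Proof.
move=> al1; rewrite /lam; elim: {1}N => [|k IH]; first exact: hom0.
rewrite iterS /gauge_step -scaleN1r; apply: homZ; apply: (@hom_sgauge n 1); apply: homD => //.
apply: hom_psub => //; first exact: kform_ev_var.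
by apply: (@hom_hcyl K g n 2); apply/hom_brksum/hom_cyl.
Qed.

Definition retract n (al : gform g n) : gform g n := flow N (lam al) al.

Lemma mc_retract n (al : gform g n) : mc N al -> mc N (retract al).
Proof. by move=> al_mc; apply: mc_flow => //; apply/hom_lam/al_mc.1. Qed.

Lemma sgauge_retract n (al : gform g n) : sgauge (retract al) = 0.
Proof.
rewrite /retract flowE // addrAC (linD (@sgauge_linear n)).
have -> : sgauge (tot (lam al)) = lam al by have [u ->] := lam_sgauge al; exact: sgauge_tot_sgauge.
by rewrite -[X in _ + X](gauge_fix al) /gauge_step subrr.
Qed.

Lemma retract_pull k n (f : 'I_k.+1 -> 'I_n.+1) (al : gform g n) : nondecreasing f ->
  retract (pull f al) = pull f (retract al).
Proof. by move=> f_mono; rewrite /retract pull_flow lam_pull. Qed.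

Lemma retract_id n (al : gform g n) : sgauge al = 0 -> retract al = al.
Proof. by move=> al0; rewrite /retract lam_eq0 // flow0. Qed.

Lemma gamma_simplexP n (u : gform g n) : gamma_simplex (s n) u <-> mc N u /\ sgauge u = 0.
Proof.
rewrite /gamma_simplex (MC_simplexP gN) -sgauge_eq0 /vx lx.unlock mon.unlock.
by [].
Qed.

(** Omega_0 has only 0-forms, which s kills. Hence all vertices lie in gamma and are fixed by the
    retraction. *)
Lemma sgauge_dim0 (u : gform g 0) : sgauge u = 0.
Proof.
apply/sgauge_eq0; rewrite -(vx0 0 u); apply: eq_lx => c.
case: (s_mon c) => [//|[k]]; have -> : c.2 = set0 by apply/setP => -[].
by rewrite cards0.
Qed.


Lemma nondecreasing_lift n (j : 'I_n.+2) : nondecreasing (lift j).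
Proof. by move=> p q pq; rewrite /= leq_bump2. Qed.

Lemma nondecreasing_cst k n (i : 'I_n.+1) : nondecreasing (fun _ : 'I_k.+1 => i).
Proof. by []. Qed.

Local Notation act := (fun (k n : nat) (f : 'I_k.+1 -> 'I_n.+1) => pull f).
Local Notation X := (fun n : nat => gamma_simplex (s n)).
Local Notation Y := (fun n : nat => @MC_simplex K g n).

Lemma gamma_retract n (u : gform g n) : MC_simplex u -> gamma_simplex (s n) (retract u).
Proof. by move/(MC_simplexP gN) => u_mc; apply/gamma_simplexP; split; [exact: mc_retract|exact: sgauge_retract]. Qed.

Lemma retract_gamma n (u : gform g n) : gamma_simplex (s n) u -> retract u = u.
Proof. by move/gamma_simplexP => [_]; exact: retract_id. Qed.

Lemma retract_face n (j : 'I_n.+2) (u : gform g n.+1) :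
  retract (face (U := gform g) act j u) = face (U := gform g) act j (retract u).
Proof. by apply: retract_pull; exact: nondecreasing_lift. Qed.

Lemma retract_dim0 (u : gform g 0) : retract u = u.
Proof. exact/retract_id/sgauge_dim0. Qed.

Lemma retract_degenerate n (u : gform g 0) :
  retract (degenerate (U := gform g) act n u) = degenerate (U := gform g) act n u.
Proof. by rewrite /degenerate retract_pull ?retract_dim0. Qed.

(** * Extending a form that vanishes on the boundary *)

Section Extension.

Variables (n : nat) (u : gform g n.+1).
Hypothesis u0 : forall j : 'I_n.+2, pull (lift j) u = 0.

(** For i < n+1 this vertex map is not monotone; it is used for pullback and for naturality of the
    flow, not for s. For i = n+1 it is the last degeneracy. *)
Definition collapse (i : 'I_n.+2) (j : 'I_n.+3) : 'I_n.+2 :=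
  if unlift ord_max j is Some k then k else i.

Lemma collapse_lift_max i m : collapse i (lift ord_max m) = m.
Proof. by rewrite /collapse liftK. Qed.

Lemma pull_collapse_lift (V : lmodType K) (i i0 : 'I_n.+2) (v : gform V n.+1) : i != i0 ->
  exists f : 'I_n.+2 -> 'I_n.+1,
    pull (fun m => collapse i (lift (lift ord_max i0) m)) v = pull f (pull (lift i0) v).
Proof.
(* The composite avoids i0, as this vertex is missing from the face and the last vertex goes to i;
   the default [ord0] is never taken. *)
move=> ii0; exists (fun m => odflt ord0 (unlift i0 (collapse i (lift (lift ord_max i0) m)))).
rewrite [RHS](pull_comp charK); apply: eq_pull => m; rewrite /collapse.
case: unliftP => [k mk|_]; last by case: unliftP ii0 => [k -> //|->]; rewrite eqxx.
case: unliftP => [k' -> //|ki0].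
by have := neq_lift (lift ord_max i0) m; rewrite mk ki0 eqxx.
Qed.

(* On face [i], the factor [t_i] kills the term of index [i], and [u0] the others;
   on the last face all the simplices in the sum restrict to [u]. *)
Definition extend : gform g n.+2 :=
  \sum_i vx (fun w => coord K (lift ord_max i) * w) (pull (collapse i) u).

Lemma vx_mul_pull k m (f : 'I_k.+1 -> 'I_m.+1) (a : Omega K m) (v : gform g m) :
  pull f (vx (fun w => a * w) v) = vx (fun w => pull f a * w) (pull f v).
Proof.
rewrite [LHS]pull_vx [pull f v]pull_vx !vx_comp; [|exact: mul_linearr|exact: psub_linear].
by apply: eq_vx => w; rewrite pullE; apply: psubM => //; exact: kform_pcoord.
Qed.

Lemma hom_extend d : hom d u -> hom d extend.
Proof.
move=> du; apply: hom_sum => i _; rewrite -[d]addr0; apply: hom_vx; last exact: hom_pull.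
move=> c; right; exists #|c.2|; rewrite addr0; split=> //.
by rewrite -[#|_|]add0n; apply: kformM; [exact: kform_coord|exact: kform_mon].
Qed.

Lemma extend_last : pull (lift ord_max) extend = u.
Proof.
rewrite (lin_sum (pull_linear (lift ord_max) (V := g))).
transitivity (\sum_i vx (fun w => coord K i * w) u).
  apply: eq_bigr => i _; rewrite vx_mul_pull pull_coordE [X in vx _ X](pull_comp charK).
  rewrite (eq_pull (g := id)) ?pull_id // => [|m]; last exact: collapse_lift_max.
  apply: eq_vx => w; rewrite /pull_coord (big_pred1 i) // => m.
  by rewrite (inj_eq lift_inj).
rewrite -[RHS]vx_id [RHS](eq_vx (G := fun w => \sum_i coord K i * w)) => [|w]; last first.
  by rewrite -mulr_suml sum_coord mul1r.
by rewrite vx_sum.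
Qed.

Lemma extend_other (i : 'I_n.+2) : pull (lift (lift ord_max i)) extend = 0.
Proof.
rewrite (lin_sum (pull_linear (lift (lift ord_max i)) (V := g))) big1 // => k _.
rewrite vx_mul_pull pull_coordE [X in vx _ X](pull_comp charK); have [->|ki] := eqVneq k i.
  rewrite -(vx0 _ (pull (fun m => collapse i (lift (lift ord_max i) m)) u)).
  apply: eq_vx => w; rewrite /pull_coord big_pred0 ?mul0r // => m.
  by rewrite eq_sym (negbTE (neq_lift _ _)).
have [f ->] := pull_collapse_lift u ki.
by rewrite u0 (lin0 (pull_linear f (V := g))) (lin0 (@vx_linear K g _ _ _)).
Qed.

End Extension.

(** * The maps induced on homotopy groups *)

Lemma retract_sphere (x0 : gform g 0) n (u : gform g n.+1) :
  sphere (U := gform g) act Y x0 u -> sphere (U := gform g) act X x0 (retract u).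
Proof.
move=> [uY uf]; split; first exact: gamma_retract.
by move=> j; rewrite -[LHS]retract_face (uf j) [LHS]retract_degenerate.
Qed.

Lemma collapse_max_lift n (m : 'I_n.+2) :
  collapse ord_max (lift (lift ord_max ord_max) m) = m.
Proof.
rewrite /collapse; case: unliftP => [k|] /(congr1 val) /= E; apply/val_inj => /=.
  by move: E (ltn_ord m) (ltn_ord k); rewrite /bump; lia.
by move: E (ltn_ord m); rewrite /bump; lia.
Qed.

Lemma retract_homotopic (x0 : gform g 0) n (u : gform g n.+1) :
  sphere (U := gform g) act Y x0 u -> homotopic (U := gform g) act Y x0 u (retract u).
Proof.
move=> uS; have [uY uf] := uS; have [rX rf] := retract_sphere uS.
split; first exact: uS; first by split; [exact: rX.1|exact: rf].
(* Each face of u is a degenerate vertex, and the gauge parameter of such a simplex is 0. *)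
have l0 (j : 'I_n.+2) : pull (lift j) (lam u) = 0.
  rewrite -[LHS]lam_pull; last exact: nondecreasing_lift.
  rewrite [pull _ u](uf j); apply: lam_eq0; rewrite [LHS]sgauge_pull; last exact: nondecreasing_cst.
  by rewrite sgauge_dim0 (lin0 (pull_linear _ (V := g))).
have u_mc : mc N u by exact/(MC_simplexP gN).
(* The degeneracy has faces n+1 and n+2 equal to u and all others degenerate at x0. The extended
   parameter is zero on every face but the last, where it is [lam u]; so only that face moves, to
   [retract u]. *)
exists (flow N (extend (lam u)) (pull (collapse ord_max) u)); split.
  apply/(MC_simplexP gN)/mc_flow; [exact: charK|exact: gN| |exact: mc_pull].
  by apply/hom_extend/hom_lam/u_mc.1.
move=> j; rewrite /face [LHS]pull_flow (pull_comp charK (lift j)).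
case: (unliftP ord_max j) => [i ->|->]; last first.
  rewrite extend_last (eq_pull (g := id)) => [|m]; last exact: collapse_lift_max.
  rewrite (pull_id charK) (_ : (ord_max == n :> nat) = false); last by rewrite gtn_eqF.
  by rewrite (_ : (ord_max == n.+1 :> nat) = false) ?eqxx //= gtn_eqF.
rewrite (extend_other l0) (flow0 charK gN); have [->|iN] := eqVneq i ord_max.
  rewrite (eq_pull (g := id)) => [|m]; last exact: collapse_max_lift.
  have eN : lift ord_max (ord_max : 'I_n.+2) = n.+1 :> nat by rewrite /= /bump ltnn.
  rewrite (pull_id charK) eN (_ : (n.+1 == n)%N = false) ?eqxx //.
  by rewrite gtn_eqF.
have iN' : (i < n.+1)%N.
  by rewrite ltn_neqAle -ltnS ltn_ord andbT; apply: contra iN => /eqP iN; apply/eqP/val_inj.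
have lN : lift ord_max i = i :> nat by rewrite /= /bump leqNgt ltnS (ltnW iN').
rewrite eq_sym in iN; have [f ->] := pull_collapse_lift u iN.
rewrite [pull _ u](uf i) [LHS](pull_comp charK) lN (ltn_eqF iN').
rewrite (ltn_eqF (ltnW iN' : (i < n.+2)%N)).
by case: ifP.
Qed.

Lemma sphere_gamma_MC (x0 : gform g 0) n (u : gform g n.+1) :
  sphere (U := gform g) act X x0 u -> sphere (U := gform g) act Y x0 u.
Proof. by case=> [[uY _] uf]; split; [exact: uY|exact: uf]. Qed.

Lemma bounds_gamma_MC (x0 : gform g 0) n (u v w : gform g n.+1) :
  bounds (U := gform g) act X x0 u v w -> bounds (U := gform g) act Y x0 u v w.
Proof. by case=> z [[zY _] zf]; exists z; split; [exact: zY|exact: zf]. Qed.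

Lemma homotopic_gamma_MC (x0 : gform g 0) n (u v : gform g n.+1) :
  homotopic (U := gform g) act X x0 u v -> homotopic (U := gform g) act Y x0 u v.
Proof.
by case=> uS vS uv; split; [exact: sphere_gamma_MC|exact: sphere_gamma_MC|exact: bounds_gamma_MC].
Qed.

Lemma clos_rst_map (S T : Type) (f : S -> T) (P : S -> S -> Prop) (Q : T -> T -> Prop) :
  (forall x y, P x y -> Q (f x) (f y)) -> forall x y,
  clos_refl_sym_trans S P x y -> clos_refl_sym_trans T Q (f x) (f y).
Proof.
move=> PQ x y; elim=> [{}x {}y /PQ|{}x|{}x {}y _|{}x {}y z _ xy _]; first exact: rst_step.
- exact: rst_refl.
- exact: rst_sym.
- exact: rst_trans xy.
Qed.

Lemma pi_eq_gamma_MC (x0 : gform g 0) n (u v : gform g n.+1) :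
  pi_eq (U := gform g) act X x0 u v -> pi_eq (U := gform g) act Y x0 u v.
Proof. by apply: (clos_rst_map (f := id)) => x y; exact: homotopic_gamma_MC. Qed.

Lemma homotopic_retract (x0 : gform g 0) n (u v : gform g n.+1) :
  homotopic (U := gform g) act Y x0 u v ->
  homotopic (U := gform g) act X x0 (retract u) (retract v).
Proof.
case=> uS vS [w [wY wf]]; split; [exact: retract_sphere|exact: retract_sphere|].
exists (retract w); split; first exact: gamma_retract.
move=> j; rewrite -[LHS]retract_face (wf j).
case: ifP => _; first exact: retract_degenerate.
case: ifP => _; first by [].
by case: ifP => _; [|exact: retract_degenerate].
Qed.

Lemma edge_retract (u v : gform g 0) : edge (U := gform g) act Y u v ->
  edge (U := gform g) act X (retract u) (retract v).
Proof.
case=> e [eY <- <-]; exists (retract e); split; first exact: gamma_retract.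
  by rewrite -[LHS]retract_face.
by rewrite -[LHS]retract_face.
Qed.

(** On vertices the retraction is the identity, so it turns a chain of edges in MC into one in gamma
    with the same ends. *)
Lemma gamma_MC_pi0 : pi0_iso (U := gform g) act X Y.
Proof.
split=> [u [uY _]|u v _ _|v vY]; first exact: uY.
  split; last first.
    by rewrite -{2}(retract_dim0 u) -{2}(retract_dim0 v); apply: clos_rst_map; exact: edge_retract.
  apply: (clos_rst_map (f := id)) => x y [e [[eY _] ex ey]].
  by exists e; split; [exact: eY|exact: ex|exact: ey].
exists v; last exact: rst_refl.
by rewrite -(retract_dim0 v); exact: gamma_retract.
Qed.

(** Injectivity holds because [retract] sends chains of homotopies into gamma and fixes spheres of
    gamma; surjectivity is [retract_homotopic]. Products are preserved since the simplices
    witnessing them in gamma lie in MC. *)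
Lemma gamma_MC_pi (x0 : gform g 0) n : pi_iso (U := gform g) act X Y x0 n.
Proof.
split; last first.
  move=> x y z _ _ _ [x' [y' [z' [xx' yy' zz' [xS [yS zS]] b]]]].
  exists x', y', z'; split; try exact: pi_eq_gamma_MC; last exact: bounds_gamma_MC.
  by split; [|split]; exact: sphere_gamma_MC.
split=> [u|u v [uX _] [vX _]|v vS]; first exact: sphere_gamma_MC.
  split; first exact: pi_eq_gamma_MC.
  rewrite -{2}(retract_gamma uX) -{2}(retract_gamma vX); apply: clos_rst_map.
  exact: homotopic_retract.
exists (retract v); first exact: retract_sphere.
by apply/rst_sym/rst_step; exact: retract_homotopic.
Qed.

End Gauge.

Theorem corollary5p9 (K : fieldType) (charK : [pchar K] =i pred0)
    (s : forall n : nat, {linear Omega K n -> Omega K n}) (s_gauge : is_gauge s)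
    (g : Linfty K) (g_nilpotent : nilpotent g) :
  homotopy_equivalence (U := gform g) (fun (k n : nat) (f : 'I_k.+1 -> 'I_n.+1) => pull f)
    (fun n : nat => gamma_simplex (s n)) (fun n : nat => @MC_simplex K g n).
Proof.
case: g_nilpotent => N gN; split=> [n u [uY _]||x0 x0Y]; first exact: uY.
  exact: (gamma_MC_pi0 charK gN s_gauge).
split; last by move=> n; exact: (gamma_MC_pi charK gN s_gauge).
by rewrite -(retract_dim0 charK gN s_gauge x0); exact: (gamma_retract charK gN s_gauge).
Qed.
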